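(* Let $p\ge r$, $0<\gamma<1$ and $\omega:=p-r\gamma>1$. Assume $\Psi(\sigma)>0$ on $(0,\Sigma)$, that $$I(\Sigma):=\int_0^{\Sigma}\Psi(\theta)\,e^{(1-\omega)\int_0^{\theta}\Phi(\eta)\,d\eta}\,d\theta<\infty ,$$ and that the initial datum $u_0$ satisfies $$\bar u_0:=\frac{1}{|\Omega_0|}\int_{\Omega_0}u_0\,dx>(\omega-1)^{\frac{1}{1-\omega}}\,I(\Sigma)^{\frac{1}{1-\omega}}>0 .$$ Then the solution $u$ of $$u_\sigma=\Delta u-\Phi(\sigma)u+\frac{\Psi(\sigma)u^p}{\left(\frac{1}{|\Omega_0|}\int_{\Omega_0}u^r\,dx\right)^{\gamma}}\ \text{ in }\Omega_0\times(0,\Sigma),\qquad \frac{\partial u}{\partial\nu}=0\ \text{ on }\partial\Omega_0\times(0,\Sigma),\qquad u(\cdot,0)=u_0>0\ \text{ in }\Omega_0,$$ blows up in finite time $\Sigma_b<\Sigma$, i.e. $\lim_{\sigma\to\Sigma_b}\|u(\cdot,\sigma)\|_\infty=+\infty$.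
   Context: $\Omega_0\subset\mathbb{R}^N$ ($N=1,2,3$) is a bounded domain with smooth boundary and outer unit normal $\nu$; $\Sigma\in(0,\infty]$ is the time horizon. The exponents satisfy $p>1$, $q,r>0$, $s>-1$, and $\gamma=q/(s+1)$. The domain evolution is encoded by a positive $C^1$ function $\phi$ on $[0,\Sigma)$ with $\phi(0)=1$, and $$\Phi(\sigma)=\phi^2(\sigma)+N\frac{\dot\phi(\sigma)}{\phi(\sigma)},\qquad \Psi(\sigma)=\phi^{2(1-\gamma)}(\sigma)\,\Phi^{\gamma}(\sigma).$$ Initial data $u_0$ are sufficiently regular and positive on $\overline{\Omega_0}$; solutions are classical positive solutions, continued as long as they stay bounded. *)

(* Defs.v *)
From HB Require Import structures.
From mathcomp Require Import all_boot all_order all_algebra.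
From mathcomp Require Import all_classical all_reals all_analysis.

Set Implicit Arguments.
Unset Strict Implicit.
Unset Printing Implicit Defensive.

Import Order.TTheory GRing.Theory Num.Theory.
Import numFieldNormedType.Exports.

Local Open Scope classical_set_scope.
Local Open Scope ring_scope.

(* Lebesgue measure on R^N: the N-fold product of lebesgue_measure, carried by
   N-tuples of reals with the product sigma-algebra. *)
Section lebesgue_tuple.
Context {R : realType}.
Local Notation RT n := (n.-tuple (measurableTypeR R)).

Definition cons_pair n (z : measurableTypeR R * RT n) : RT n.+1 :=
  [the n.+1.-tuple (measurableTypeR R) of z.1 :: z.2].

Lemma measurable_cons_pair n : measurable_fun setT (@cons_pair n).
Proof. exact: measurable_cons. Qed.

Section step.
Variables (n : nat) (mu : {sigma_finite_measure set (RT n) -> \bar R}).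

Definition lebesgue_cons : set (RT n.+1) -> \bar R :=
  pushforward (lebesgue_measure \x mu)%E (@cons_pair n).

Let lebesgue_cons0 : lebesgue_cons set0 = 0%E.
Proof. by rewrite /lebesgue_cons /pushforward preimage_set0 measure0. Qed.

Let lebesgue_cons_ge0 A : (0 <= lebesgue_cons A)%E.
Proof. exact: (@measure_ge0 _ _ _ (lebesgue_measure \x mu)%E). Qed.

Let lebesgue_cons_sigma_additive : semi_sigma_additive lebesgue_cons.
Proof.
move=> F mF tF mUF; rewrite /lebesgue_cons /pushforward preimage_bigcup.
have mpre A : measurable A -> measurable (@cons_pair n @^-1` A).
  by move=> mA; rewrite -[X in measurable X]setTI; exact: measurable_cons_pair.
apply: measure_semi_sigma_additive => [i||]; first exact: mpre.
- apply/trivIsetP => i j _ _ ij; rewrite -preimage_setI.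
  by move/trivIsetP : tF => /(_ _ _ _ _ ij) ->//; rewrite preimage_set0.
- by rewrite -preimage_bigcup; exact: mpre.
Qed.

HB.instance Definition _ := isMeasure.Build _ _ _ lebesgue_cons
  lebesgue_cons0 lebesgue_cons_ge0 lebesgue_cons_sigma_additive.

Let lebesgue_cons_sigma_finite : sigma_finite setT lebesgue_cons.
Proof.
have /sigma_finiteP[F [FT ndF Foo]] := sigma_finiteT (@lebesgue_measure R).
have /sigma_finiteP[G [GT ndG Goo]] := sigma_finiteT mu.
pose uncons (t : RT n.+1) : measurableTypeR R * RT n :=
  (thead t, [tuple of behead t]).
have muncons : measurable_fun setT uncons.
  apply/measurable_fun_pairP; split; first exact: measurable_tnth.
  exact: measurable_behead.
have consK : cancel (@cons_pair n) uncons.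
  by case=> x t; congr pair; exact: val_inj.
exists (fun k => uncons @^-1` (F k `*` G k)) => [|k].
  apply/esym; rewrite -subTset => t _.
  have [i _ Fi] : (\bigcup_i F i) (uncons t).1 by rewrite -FT.
  have [j _ Gj] : (\bigcup_i G i) (uncons t).2 by rewrite -GT.
  exists (maxn i j) => //; split.
    by move: Fi; exact/subsetPset/ndF/leq_maxl.
  by move: Gj; exact/subsetPset/ndG/leq_maxr.
have [mF Fk] := Foo k; have [mG Gk] := Goo k; split.
  rewrite -[X in measurable X]setTI; apply: muncons => //.
  exact: measurableX.
rewrite /lebesgue_cons /pushforward -comp_preimage.
rewrite [X in X @^-1` _](_ : _ = idfun); last exact/funext/consK.
rewrite preimage_id product_measure1E//.
by rewrite lte_mul_pinfty// ge0_fin_numE.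
Qed.

HB.instance Definition _ := @Measure_isSigmaFinite.Build _ _ _ lebesgue_cons
  lebesgue_cons_sigma_finite.

End step.

Fixpoint lebesgue_tuple n : {sigma_finite_measure set (RT n) -> \bar R} :=
  if n is m.+1 then lebesgue_cons (lebesgue_tuple m)
  else dirac ([tuple] : RT 0).

Lemma lebesgue_tuple_box n (A : 'I_n -> set (measurableTypeR R)) :
  (forall i, measurable (A i)) ->
  lebesgue_tuple n [set t | forall i, A i (tnth t i)] =
  (\prod_(i < n) lebesgue_measure (A i))%E.
Proof.
elim: n A => [|n IH] A mA /=.
  by rewrite big_ord0 diracE mem_set// => -[].
rewrite big_ord_recl -IH// /lebesgue_cons /pushforward -product_measure1E//.
  congr product_measure1; apply/seteqP; split=> -[x t] /=.
    move=> At; split; first exact: (At ord0).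
    by move=> i; have := At (lift ord0 i); rewrite tnthS.
  move=> [Ax At] i; case: (unliftP ord0 i) => [j|] -> //.
  by rewrite tnthS; exact: At.
rewrite (_ : [set _ | _] =
    \bigcap_(i : 'I_n) ((@tnth n _ ^~ i) @^-1` A (lift ord0 i))); last first.
  by apply/seteqP; split=> t /= At i; [move=> _; exact: At|exact: (At i I)].
apply: fin_bigcap_measurable => // i _.
by rewrite -[X in measurable X]setTI; exact: measurable_tnth.
Qed.

End lebesgue_tuple.

Section euclidean.
Context {R : realType} {N : nat}.
Local Notation E := 'rV[R]_N.
Implicit Types (D : set E) (f g : E -> R) (x nu : E).

Definition point (t : N.-tuple (measurableTypeR R)) : E := \row_i tnth t i.

Definition volume D : R := fine (lebesgue_tuple N (point @^-1` D)).

Definition average D f : R :=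
  (volume D)^-1 * \int[lebesgue_tuple N]_(t in point @^-1` D) f (point t).

Definition partial (i : 'I_N) f x : R := 'D_(delta_mx 0 i) f x.

Definition gradient f x : E := \row_i partial i f x.

Definition laplacian f x : R := \sum_i partial i (partial i f) x.

Definition dot (x y : E) : R := \sum_i x 0 i * y 0 i.

(* C^oo on R^N: partial derivatives of all orders exist and are continuous. *)
Definition smooth f := forall s : seq 'I_N,
  continuous (foldr partial f s) /\
  forall i x, derivable (foldr partial f s) x (delta_mx 0 i).

(* For open D. *)
Definition boundary D : set E := closure D `\` D.

(* Near its boundary point x, D is the sublevel set {psi < 0} of a smooth
   function whose gradient does not vanish at x. *)
Definition local_defining_function D x psi :=
  [/\ smooth psi, psi x = 0, gradient psi x != 0 &
      \forall y \near x, D y <-> psi y < 0].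

Definition smooth_boundary D :=
  forall x, boundary D x -> exists psi, local_defining_function D x psi.

(* Independent of the choice of psi. *)
Definition outer_unit_normal D x nu :=
  exists2 psi, local_defining_function D x psi &
    nu = (Num.sqrt (dot (gradient psi x) (gradient psi x)))^-1 *:
         gradient psi x.

Definition bounded_smooth_domain D :=
  [/\ open D, connected D, D !=set0, bounded_set D & smooth_boundary D].

Definition sup_norm D f : \bar R := ereal_sup [set `|f x|%:E | x in D].

End euclidean.

Section evolution.
Context {R : realType}.

Definition time_co (T : \bar R) : set R := [set t | 0 <= t /\ (t%:E < T)%E].

Definition time_oo (T : \bar R) : set R := [set t | 0 < t /\ (t%:E < T)%E].

(* f is C^1 on [0, T): the one-sided derivative at 0 is encoded by the
   continuous extension df to t = 0 of the derivative on (0, T). *)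
Definition C1_co (T : \bar R) (f : R -> R) :=
  {within time_co T, continuous f} /\
  exists2 df : R -> R, {within time_co T, continuous df} &
    forall t, time_oo T t -> is_derive t (1 : R) f (df t).

Definition Phi (N : nat) (phi : R -> R) (t : R) : R :=
  phi t ^+ 2 + N%:R * (derive1 phi t / phi t).

(* Pitfall: a `^ gamma is 1 for a < 0, so positivity of Psi does not by itself
   exclude Phi < 0, where Phi^gamma has no real meaning. *)
Definition Psi (N : nat) (gamma : R) (phi : R -> R) (t : R) : R :=
  phi t `^ (2 * (1 - gamma)) * Phi N phi t `^ gamma.

Definition blowup_integral (N : nat) (gamma omega : R) (phi : R -> R)
    (T : \bar R) : \bar R :=
  \int[lebesgue_measure]_(theta in time_oo T)
    (Psi N gamma phi theta *
     expR ((1 - omega) *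
           \int[lebesgue_measure]_(eta in `[0, theta]) Phi N phi eta))%:E.

(* Positive classical solutions on [0, T): u is continuous on
   closure Om x [0, T), belongs to C^{2,1}(Om x (0, T)), and its spatial
   gradient extends continuously to closure Om x (0, T); the boundary condition
   is imposed on that extension. Values of u elsewhere play no role. *)
Record classical_solution (N : nat) (Om : set 'rV[R]_N) (p r gamma : R)
    (phi : R -> R) (u0 : 'rV[R]_N -> R) (T : \bar R)
    (u : 'rV[R]_N -> R -> R) : Prop := ClassicalSolution {
  solution_continuous :
    {within closure Om `*` time_co T, continuous (fun z => u z.1 z.2)} ;
  solution_derivable_time : forall x t, Om x -> time_oo T t ->
    derivable (u x) t 1 ;
  solution_continuous_time :
    {within Om `*` time_oo T, continuous (fun z => derive1 (u z.1) z.2)} ;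
  solution_derivable_space : forall x t i, Om x -> time_oo T t ->
    derivable (u ^~ t) x (delta_mx 0 i) ;
  solution_derivable_space2 : forall x t i j, Om x -> time_oo T t ->
    derivable (partial j (u ^~ t)) x (delta_mx 0 i) ;
  solution_continuous_space2 : forall i j,
    {within Om `*` time_oo T,
      continuous (fun z => partial i (partial j (u ^~ z.2)) z.1)} ;
  solution_neumann : exists2 G : 'rV[R]_N * R -> 'rV[R]_N,
    {within closure Om `*` time_oo T, continuous G} &
    (forall x t, Om x -> time_oo T t -> G (x, t) = gradient (u ^~ t) x) /\
    (forall x t nu, boundary Om x -> outer_unit_normal Om x nu ->
      time_oo T t -> dot (G (x, t)) nu = 0) ;
  solution_initial : forall x, closure Om x -> u x 0 = u0 x ;
  solution_positive : forall x t, Om x -> time_co T t -> 0 < u x t ;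
  solution_equation : forall x t, Om x -> time_oo T t ->
    derive1 (u x) t = laplacian (u ^~ t) x - Phi N phi t * u x t
      + Psi N gamma phi t * u x t `^ p
        / average Om (fun y => u y t `^ r) `^ gamma }.

(* The solution on [0, T), T <= Sig, is continued as long as it stays bounded:
   it stops before the horizon Sig only if it is unbounded on Om x [0, T). *)
Definition continued_while_bounded (N : nat) (Om : set 'rV[R]_N)
    (Sig T : \bar R) (u : 'rV[R]_N -> R -> R) :=
  (exists M : R, forall x t, Om x -> time_co T t -> `|u x t| <= M) -> T = Sig.

Definition blows_up_at (N : nat) (Om : set 'rV[R]_N) (u : 'rV[R]_N -> R -> R)
    (Sb : R) :=
  sup_norm Om (u ^~ t) @[t --> Sb^'-] --> +oo%E.

End evolution.

(* Main.v *)
(* Let h be a C^2 function on R^N with Om = {h < 0} and nonvanishing gradient on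
   the boundary, glued from local defining functions by bump functions. Cutting
   off by a function of h / e and letting e tend to 0 integrates the equation over
   Om without a divergence theorem: the cut-off Laplacian integrates by parts along
   coordinate lines, and grad h . grad u vanishes on the boundary. So the mean U of
   u satisfies U' = - Phi U + Psi mean(u^p) / mean(u^r)^gamma, and Jensen's
   inequality gives U' >= - Phi U + Psi U^omega. With G the primitive of Phi,
   z = exp(G) U satisfies z' >= Psi exp((1 - omega) G) z^omega; integrating
   z^(1 - omega) bounds the integral of Psi exp((1 - omega) G) over (0, T) by
   U(0)^(1 - omega) / (omega - 1), which excludes T = Sig.

   Hence T < Sig and u is unbounded. That the sup norm tends to infinity, and not
   only along a sequence, follows by comparison: U stays bounded below, hence so
   does mean(u^r) as long as u is bounded, and then a bound u <= K at one time
   persists, with a worse constant, over a time depending only on K. *)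

Require Import Defs.
From mathcomp Require Import all_boot all_order all_algebra.
From mathcomp Require Import all_classical all_reals all_analysis.
From mathcomp Require Import measurable_realfun ring lra.

Import Order.TTheory GRing.Theory Num.Theory.
Import numFieldNormedType.Exports.

Local Open Scope classical_set_scope.
Local Open Scope ring_scope.

Set Implicit Arguments.
Unset Strict Implicit.
Unset Printing Implicit Defensive.

(* classical_sets also has a constant named point. *)
Local Notation pt := Defs.point.
Local Notation RT R n := (n.-tuple (measurableTypeR R)).

(** * Lebesgue measure on R^N *)

Section Point.
Context {R : realType} {N : nat}.
Implicit Types (U D : set 'rV[R]_N) (f : 'rV[R]_N -> R).

(** The regularity assumed of [u] shapes the argument: its second derivatives and its time
    derivative are controlled only inside [Om], so neither the integral of the Laplacian nor
    differentiation under the integral is available before cutting off. The derivative of the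
    cut-off has size 1/e near the boundary. Compactness of closure(Om) x [a, b], a > 0, gives |grad
    h . grad u| <= rho |grad h|^2 + C h^2 with rho as small as desired. The second term is paid by
    |cut'| h^2 <= 2e; the first by the same integration by parts with [h] in place of [u], which
    bounds the integral of |cut'| |grad h|^2 uniformly in e. Cut-off masses and their derivatives
    then converge uniformly on compact time intervals, which makes the mean differentiable. The
    normals of the Neumann condition come from smooth local functions while [h] is only C^2, so
    orthogonality to the normals has to be carried over to grad h. For the comparison, T < Sig makes
    Phi and Psi bounded up to T, and the lower bound of the mean comes from the monotonicity of
    exp(G) U. *)

Lemma normr_coord_le (x : 'rV[R]_N) i : `|x 0 i| <= `|x|.
Proof.
by rewrite [leRHS]/Num.norm/= mx_normrE; exact: (le_bigmax _ _ (ord0, i)).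
Qed.

Lemma measurable_box (A : 'I_N -> set (measurableTypeR R)) :
  (forall i, measurable (A i)) ->
  measurable [set t : N.-tuple (measurableTypeR R) | forall i, A i (tnth t i)].
Proof.
move=> mA; rewrite (_ : [set _ | _] =
    \bigcap_(i : 'I_N) ((@tnth N _ ^~ i) @^-1` A i)); last first.
  by apply/seteqP; split=> t /= At i; [move=> _; exact: At|exact: (At i I)].
apply: fin_bigcap_measurable => // i _.
by rewrite -[X in measurable X]setTI; exact: measurable_tnth.
Qed.

(** The tuples carry the product sigma-algebra, while openness refers to the sup norm on rows: an
    open set is the countable union of the cubes with rational centre and radius [1 / (k + 1)] that
    it contains. *)
Lemma measurable_point_preimage U : open U -> measurable (@pt R N @^-1` U).
Proof.
move=> oU.
pose box (ck : {ffun 'I_N -> rat} * nat) := [set t : N.-tuple (measurableTypeR R) |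
  forall i, ball (ratr (ck.1 i) : R) ck.2.+1%:R^-1 (tnth t i)].
pose F ck := if `[< box ck `<=` @pt R N @^-1` U >] then box ck else set0.
suff -> : @pt R N @^-1` U = \bigcup_ck F ck.
  apply: countable_bigcupT_measurable => // -[c k]; rewrite /F; case: asboolP => // _.
  apply: (@measurable_box (fun i => ball (ratr (c i) : R) k.+1%:R^-1)) => i.
  by rewrite ball_itv; exact: measurable_itv.
apply/seteqP; split=> [t Ut|t [ck _]]; last first.
  by rewrite /F; case: asboolP => // /[apply].
have /nbhs_ballP[e /= e0 eU] : nbhs (pt t) U by exact: open_nbhs_nbhs.
have [k ke] : exists k : nat, k.+1%:R^-1 < e / 2.
  have e20 : 0 < e / 2 by rewrite divr_gt0.
  by have [k _ /(_ k (leqnn k))] := near_infty_natSinv_lt (PosNum e20); exists k.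
have /choice[c ct] : forall i : 'I_N, exists q : rat,
    ball (ratr q : R) k.+1%:R^-1 (tnth t i).
  move=> i; have [|q] := @rat_in_itvoo R (tnth t i - k.+1%:R^-1) (tnth t i + k.+1%:R^-1).
    by rewrite ltrBlDr -addrA ltrDl addr_gt0.
  rewrite in_itv/= => /andP[q1 q2]; exists q.
  rewrite /ball/= ltr_norml; move: (_^-1) (ratr q) (tnth t i) q1 q2 => d x y.
  by lra.
exists ([ffun i => c i], k) => //.
rewrite /F; case: asboolP => [_ i|]; first by rewrite ffunE.
move=> nb; exfalso; apply: nb => s /= bs; apply: eU; split=> // i0 j; rewrite !mxE.
have := bs j; have := ct j; rewrite ffunE /ball/= => h1 h2.
rewrite (le_lt_trans (ler_distD (ratr (c j)) _ _))//.
by rewrite distrC [e]splitr ltrD// (lt_trans _ ke).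
Qed.

Lemma measurable_fun_point D f : open D ->
  (forall x, D x -> {for x, continuous f}) ->
  measurable_fun (@pt R N @^-1` D) (f \o @pt R N).
Proof.
move=> oD cf; move=> mD; apply: (measurability _ (measurable_realfun.RGenOInfty.measurableE R)); last exact: mD.
move=> /= _ [_ [y ->] <-].
rewrite -[X in measurable X]/(pt @^-1` (D `&` f @^-1` `]y, +oo[)).
apply: measurable_point_preimage; rewrite openE => x [Dx] /=.
rewrite in_itv/= andbT => fy.
apply: filterI; first exact: open_nbhs_nbhs.
apply: (cf x Dx); apply: open_nbhs_nbhs; split; first exact: interval_open.
by rewrite /= in_itv/= andbT.
Qed.

Lemma tuple_box_lty (B : R) :
  (lebesgue_tuple N [set t | forall i : 'I_N, `[(- B)%R, B]%classic (tnth t i)] < +oo)%E.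
Proof.
rewrite (@lebesgue_tuple_box _ _ (fun=> `[(- B), B]%classic))//.
rewrite ltey_eq prode_fin_num// => i _.
by rewrite lebesgue_measure_itv/=; case: ifP.
Qed.

Lemma bounded_preimage_lty D : bounded_set D -> measurable (@pt R N @^-1` D) ->
  (lebesgue_tuple N (@pt R N @^-1` D) < +oo)%E.
Proof.
move=> [M [_ /(_ (M + 1))]]; rewrite ltrDl => /(_ ltr01) DM mD.
apply: le_lt_trans (tuple_box_lty (M + 1)).
apply: le_measure; rewrite ?inE//.
  by apply: (@measurable_box (fun=> `[(- (M + 1)), M + 1]%classic)).
move=> t /DM /= tM i; rewrite /= in_itv/= -ler_norml (le_trans _ tM)//.
have -> : tnth t i = pt t 0 i by rewrite mxE.
exact: normr_coord_le.
Qed.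

End Point.

(** * Integration by parts along coordinate lines *)

Section Line.
Context {R : realType} {V W : normedModType R}.

Lemma is_derive_line (f : V -> W) (x v : V) (s : R) (d : W) :
  is_derive s 1 (fun s => f (x + s *: v)) d <-> is_derive (x + s *: v) v f d.
Proof.
have E : (fun h : R => h^-1 *: (f (x + (h *: (1 : R) + s) *: v) - f (x + s *: v))) =
         (fun h : R => h^-1 *: (f (h *: v + (x + s *: v)) - f (x + s *: v))).
  apply/funext => h; congr (_ *: (f _ - _)).
  by rewrite scalerDl addrCA /GRing.scale/= mulr1.
by split=> -[d1 d2]; split; move: d1 d2; rewrite /derivable /derive /= ?E -?E.
Qed.

Lemma is_derive_line0 (f : V -> W) (x v : V) (d : W) :
  is_derive (0 : R) 1 (fun s => f (x + s *: v)) d <-> is_derive x v f d.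
Proof. by have := is_derive_line f x v 0 d; rewrite scale0r addr0. Qed.

Lemma continuous_line (x v : V) : continuous (fun s : R => x + s *: v).
Proof.
move=> s; apply: cvgD; first exact: cvg_cst.
by apply: cvgZr_tmp; exact: cvg_id.
Qed.

Lemma near_line (x v : V) (P : set V) : (\forall y \near x, P y) ->
  \forall s \near (0 : R), P (x + s *: v).
Proof.
move=> nP; have := @continuous_line x v 0; rewrite /continuous_at scale0r addr0.
by apply.
Qed.

End Line.

Section IntegralPartial.
Context {R : realType}.

Lemma bounded_support_integrable d (T : measurableType d)
    (mu : {measure set T -> \bar R}) (D : set T) (f : T -> R) (M : R) :
  measurable D -> (mu D < +oo)%E -> measurable_fun setT f ->
  (forall x, `|f x| <= M) -> (forall x, ~ D x -> f x = 0) ->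
  mu.-integrable setT (EFin \o f).
Proof.
move=> mD Doo mf fM fD.
have -> : EFin \o f = (EFin \o f) \_ D.
  by apply/funext => x; rewrite patchE; case: ifPn => //; rewrite notin_setE /= => /fD ->.
apply: (integrable_mkcond (EFin \o f) mD).1.
apply: measurable_bounded_integrable => //; first exact: measurable_funTS.
by exists M; split; [exact: num_real|move=> x Mx y _; exact: le_trans (fM y) (ltW Mx)].
Qed.

(** Support in a cube, tested coordinate by coordinate rather than by the norm, so that the property
    passes directly to slices in the induction on the dimension. *)
Definition coord_support N (B : R) (f : 'rV[R]_N -> R) :=
  forall (x : 'rV[R]_N) j, B < `|x 0 j| -> f x = 0.

Lemma coord_support_partial N B (f : 'rV[R]_N -> R) i :
  coord_support B f -> coord_support B (partial i f).
Proof.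
move=> fB x j Bx; rewrite /partial (@near_eq_derive _ _ _ _ (cst 0)) ?derive_cst//.
have cj : {for x, continuous (fun y : 'rV[R]_N => `|y 0 j|)}.
  by apply: continuous_comp; [exact: coord_continuous|exact: norm_continuous].
near=> y; apply: (fB y j); near: y.
exact: (cvgr_gt _ cj _ Bx).
Unshelve. all: by end_near. Qed.

Lemma coord_support_bounded N B (f : 'rV[R]_N -> R) :
  coord_support B f -> continuous f -> exists M, forall x, `|f x| <= M.
Proof.
move=> fB cf.
pose K : set 'rV[R]_N := [set x | forall i, `[- `|B|, `|B|]%classic (x 0 i)].
have cK : compact K.
  by apply: (@rV_compact _ _ (fun=> `[- `|B|, `|B|]%classic)) => _; exact: segment_compact.
have K0 : K !=set0.
  by exists 0 => i; rewrite /= in_itv/= mxE oppr_le0 normr_ge0.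
have [|c _ Hc] := @compact_EVT_max _ _ (fun x => `|f x|) K K0 cK.
  apply: continuous_subspaceT => x; apply: continuous_comp; first exact: cf.
  exact: norm_continuous.
exists `|f c| => x; have [Kx|nKx] := pselect (K x); first by apply: Hc; rewrite inE.
have [i xi] : exists i, B < `|x 0 i|.
  apply: contrapT => /forallNP h; apply: nKx => i.
  rewrite /= in_itv/= -ler_norml; apply: le_trans (ler_norm B).
  by rewrite leNgt; apply/negP/h.
by rewrite (fB x i xi) normr0.
Qed.

Lemma coord_support_integrable N B (f : 'rV[R]_N -> R) :
  coord_support B f -> continuous f ->
  (lebesgue_tuple N).-integrable setT (EFin \o (f \o pt)).
Proof.
move=> fB cf; have [M fM] := coord_support_bounded fB cf.
apply: (@bounded_support_integrable _ _ _
  [set t : RT R N | forall i, `[(- B)%R, B]%classic (tnth t i)] _ M).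
- exact: (@measurable_box _ _ (fun=> `[(- B), B]%classic)).
- exact: tuple_box_lty.
- have := @measurable_fun_point R N setT f openT; rewrite preimage_setT; apply.
  by move=> x _; exact: cf.
- by move=> x; exact: fM.
- move=> t /existsNP[i /negP]; rewrite in_itv/= -ler_norml -ltNge => Bt.
  by apply: (fB _ i); rewrite mxE.
Qed.

Lemma integral_derive1_compact (f g : R -> R) (B : R) :
  (forall x : R, is_derive x (1 : R) f (g x)) -> continuous g ->
  (forall x, B < `|x| -> f x = 0) ->
  (\int[lebesgue_measure]_x (g x)%:E = 0)%E.
Proof.
move=> df cg fB.
have gB x : B < `|x| -> g x = 0.
  move=> Bx; have <- := @derive_val _ _ _ _ _ _ _ (df x).
  rewrite (@near_eq_derive _ _ _ _ (cst 0)) ?derive_cst//.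
  near=> y; apply: fB; near: y.
  exact: (cvgr_gt _ (@norm_continuous _ _ x) _ Bx).
(* [B] may be negative; this [b] is positive and exceeds [B], so [f] vanishes at both ends of
   [-b, b]. *)
pose b : R := `|B| + 1.
have b0 : 0 < b by rewrite ltr_wpDl.
have Bb : B < b by rewrite (le_lt_trans (ler_norm B))// ltrDl.
have Bfb : f b = 0 by apply: fB; rewrite gtr0_norm.
have Bfb' : f (- b) = 0 by apply: fB; rewrite normrN gtr0_norm.
have -> : (fun x => (g x)%:E) = (fun x => (g x)%:E) \_ `[(- b), b].
  apply/funext => x; rewrite patchE; case: ifPn => //; rewrite notin_setE /=.
  move=> /negP; rewrite in_itv/= -ler_norml -ltNge => /(lt_trans Bb) /gB ->//.
rewrite -integral_mkcond (@continuous_FTC2 _ g f).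
- by rewrite Bfb Bfb' sube0.
- by rewrite gtrN.
- exact: continuous_subspaceT.
- have cf : continuous f.
    by move=> x; apply: differentiable_continuous; apply/derivable1_diffP; case: (df x).
  split => [x _|/=|/=]; first by case: (df x).
    by apply: cvg_at_right_filter; exact: cf.
  by apply: cvg_at_left_filter; exact: cf.
- by move=> x _; rewrite derive1E; exact: derive_val.
Unshelve. all: by end_near. Qed.

(** Row counterpart of [cons_pair]: coordinate 0 is the factor that [lebesgue_tuple] adds at each
    step of its recursion. *)
Definition cons_row n (x : R) (y : 'rV[R]_n) : 'rV[R]_n.+1 :=
  \row_j (if unlift ord0 j is Some k then y 0 k else x).

Lemma cons_row0 n x (y : 'rV[R]_n) : cons_row x y 0 ord0 = x.
Proof. by rewrite mxE unlift_none. Qed.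

Lemma cons_rowS n x (y : 'rV[R]_n) j : cons_row x y 0 (lift ord0 j) = y 0 j.
Proof. by rewrite mxE liftK. Qed.

Lemma point_cons n x (t : RT R n) :
  pt (cons_pair (x, t)) = cons_row x (pt t).
Proof.
apply/rowP => j; rewrite mxE.
by case: (unliftP ord0 j) => [k ->|->]; rewrite ?cons_rowS ?cons_row0 ?tnthS ?mxE.
Qed.

Lemma cons_rowDl n x s (y : 'rV[R]_n) :
  cons_row (x + s) y = cons_row x y + s *: delta_mx 0 ord0.
Proof.
apply/rowP => j; case: (unliftP ord0 j) => [k ->|->].
  by rewrite !mxE liftK eqxx (eq_sym (lift _ _)) eq_liftF/= mulr0 addr0.
by rewrite !mxE unlift_none !eqxx mulr1.
Qed.

Lemma cons_rowDr n x s (y : 'rV[R]_n) i :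
  cons_row x (y + s *: delta_mx 0 i) = cons_row x y + s *: delta_mx 0 (lift ord0 i).
Proof.
apply/rowP => j; case: (unliftP ord0 j) => [k ->|->].
  by rewrite !mxE liftK !mxE (inj_eq lift_inj).
by rewrite !mxE unlift_none eq_liftF/= mulr0 addr0.
Qed.

Lemma continuous_cons_row n : continuous (fun z : R * 'rV[R]_n => cons_row z.1 z.2).
Proof.
move=> z; apply/cvgrPdist_lt => e e0.
have [d1 d2] : (\forall w \near z, `|z.1 - w.1| < e) /\ (\forall w \near z, `|z.2 - w.2| < e).
  split.
    have : {for z, continuous (fst : R * 'rV[R]_n -> R)} by exact: cvg_fst.
    by move=> /cvgrPdist_lt; apply.
  have : {for z, continuous (snd : R * 'rV[R]_n -> 'rV[R]_n)} by exact: cvg_snd.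
  by move=> /cvgrPdist_lt; apply.
near=> w; rewrite [ltLHS]/Num.norm/= mx_normrE; apply/bigmax_ltP; split=> // -[a j] _ /=.
rewrite ord1; case: (unliftP ord0 j) => [k ->|->]; rewrite !mxE ?liftK ?unlift_none.
  apply: (@le_lt_trans _ _ `|z.2 - w.2|); last by near: w.
  by have := normr_coord_le (z.2 - w.2) k; rewrite !mxE.
by near: w.
Unshelve. all: by end_near. Qed.

Lemma is_derive_cons_row n (f : 'rV[R]_n.+1 -> R) x (y : 'rV[R]_n) j d :
  is_derive (cons_row x y) (delta_mx 0 (lift ord0 j)) f d ->
  is_derive y (delta_mx 0 j) (f \o cons_row x) d.
Proof.
move/is_derive_line0 => fd; apply/is_derive_line0; move: fd.
by under eq_fun do rewrite -cons_rowDr.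
Qed.

Lemma is_derive1_cons_row n (f : 'rV[R]_n.+1 -> R) x (y : 'rV[R]_n) d :
  is_derive (cons_row x y) (delta_mx 0 ord0) f d ->
  is_derive x 1 (fun x => f (cons_row x y)) d.
Proof.
have E s : cons_row s y = cons_row 0 y + s *: delta_mx 0 ord0.
  by rewrite -cons_rowDl add0r.
rewrite E => /is_derive_line.
by under eq_fun do rewrite -E.
Qed.

Lemma continuous_cons_rowl n (y : 'rV[R]_n) : continuous ((@cons_row n)^~ y).
Proof.
move=> x; apply: (@continuous_comp _ _ _ (fun x : R => (x, y)) (fun z => cons_row z.1 z.2)).
  exact: (cvg_pair cvg_id (cvg_cst _)).
exact: continuous_cons_row.
Qed.

Lemma continuous_cons_rowr n x : continuous (@cons_row n x).
Proof.
move=> y; apply: (@continuous_comp _ _ _ (fun y : 'rV[R]_n => (x, y)) (fun z => cons_row z.1 z.2)).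
  move=> A [[/= C D] [Cx Dy] CD]; apply: filterS Dy => z Dz.
  by apply: CD; split=> //; exact: nbhs_singleton.
exact: continuous_cons_row.
Qed.

(** Induction on the dimension by Fubini. For [i = 0] the inner integral over the first coordinate
    vanishes by the fundamental theorem of calculus; otherwise the inner integral over the remaining
    coordinates vanishes by the induction hypothesis applied to a slice. *)
Lemma integral_partial N (f : 'rV[R]_N -> R) (i : 'I_N) B :
  (forall x, derivable f x (delta_mx 0 i)) -> continuous (partial i f) ->
  coord_support B f ->
  (\int[lebesgue_tuple N]_t (partial i f (pt t))%:E = 0)%E.
Proof.
elim: N f i => [|n IH] f i df cf fB; first by case: i df cf => -[].
have gB := coord_support_partial i fB.
have intg := coord_support_integrable gB cf.
pose mu := lebesgue_tuple n : {sigma_finite_measure set _ -> \bar R}.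
pose G (z : measurableTypeR R * RT R n) := (partial i f (pt (cons_pair z)))%:E.
have mg : measurable_fun setT (partial i f \o pt).
  have := @measurable_fun_point R n.+1 setT _ openT; rewrite preimage_setT; apply.
  by move=> x _; exact: cf.
have intG : (lebesgue_measure \x mu)%E.-integrable setT G.
  have [M gM] := coord_support_bounded gB cf.
  apply: (@bounded_support_integrable _ _ _
    (@cons_pair R n @^-1` [set t : RT R n.+1 | forall i, `[(- B)%R, B]%classic (tnth t i)]) _ M).
  - rewrite -[X in measurable X]setTI; apply: measurable_cons_pair => //.
    exact: (@measurable_box _ _ (fun=> `[(- B), B]%classic)).
  - exact: (@tuple_box_lty R n.+1 B).
  - by apply: measurableT_comp mg _; exact: measurable_cons_pair.
  - by move=> x; exact: gM.
  - move=> t /existsNP[k /negP]; rewrite in_itv/= -ler_norml -ltNge => Bt.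
    by apply: (gB _ k); rewrite mxE.
transitivity (\int[(lebesgue_measure \x mu)]_z G z)%E.
  rewrite (@integral_pushforward _ _ _ _ _ (@cons_pair R n) (@measurable_cons_pair R n)
    (lebesgue_measure \x mu)%E setT (EFin \o (partial i f \o pt))) => //.
  exact/measurable_EFinP.
have {}df x : is_derive x (delta_mx 0 i) f (partial i f x) by exact/derivableP/df.
case: (unliftP ord0 i) => [j ij|i0].
  have dj x y : is_derive y (delta_mx 0 j) (f \o cons_row x) (partial i f (cons_row x y)).
    by apply: is_derive_cons_row; rewrite -ij.
  have E x : partial j (f \o cons_row x) = partial i f \o cons_row x.
    by apply/funext => y; exact: derive_val.
  rewrite -integral12_prod_meas1//; apply: integral0_eq => x _.
  rewrite /fubini_F /G.
  under eq_integral => t _.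
    rewrite point_cons -[partial i f _]/((partial i f \o cons_row x) (pt t)) -E.
    over.
  apply: (IH (f \o cons_row x)).
  - by move=> y; case: (dj x y).
  - by rewrite E => y; apply: continuous_comp (cf _); exact: continuous_cons_rowr.
  - by move=> y k Bk; apply: (fB _ (lift ord0 k)); rewrite cons_rowS.
rewrite -integral21_prod_meas1//; apply: integral0_eq => t _.
rewrite /fubini_G /G.
under eq_integral do rewrite point_cons.
apply: (@integral_derive1_compact (fun x => f (cons_row x (pt t)))
  (fun x => partial i f (cons_row x (pt t))) B).
- by move=> x; apply: is_derive1_cons_row; rewrite -i0.
- move=> x; apply: (@continuous_comp _ _ _ ((@cons_row n)^~ (pt t)) (partial i f)).
    exact: continuous_cons_rowl.
  exact: cf.
- by move=> x Bx; apply: (fB _ ord0); rewrite cons_row0.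
Qed.

End IntegralPartial.

(** * One-variable calculus *)

Section OneVariable.
Context {R : realType}.
Implicit Types (f : R -> R) (x : R).

(** Clearing the denominator turns a limit over a punctured neighbourhood into an estimate that also
    holds at [h = 0] and combines well with the triangle inequality. *)
Lemma is_deriveP f x d : is_derive x (1 : R) f d <->
  forall e, 0 < e -> \forall h \near 0, `|f (x + h) - f x - d * h| <= e * `|h|.
Proof.
have E e l h : h != 0 ->
    (`|l - h^-1 *: ((f \o shift x) (h *: (1 : R)) - f x)| <= e) =
    (`|f (x + h) - f x - l * h| <= e * `|h|).
  move=> h0; rewrite -(ler_pM2r (_ : 0 < `|h|)) ?normr_gt0// -normrM [in RHS]distrC mulrBl.
  by rewrite /GRing.scale/= mulrAC mulVf// mul1r mulr1 [h + x]addrC.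
split=> [[fx <-] e e0|H].
  have : h^-1 *: ((f \o shift x) (h *: 1) - f x) @[h --> 0^'] --> 'D_1 f x by exact: fx.
  move=> /cvgrPdist_le/(_ _ e0)/nbhs_ballP[r /= r0 rH].
  apply/nbhs_ballP; exists r => //= h; have [->|h0] := eqVneq h 0.
    by rewrite addr0 mulr0 subrr subr0 !normr0 mulr0.
  by move=> hr; have := rH h hr h0; rewrite E.
have cv : h^-1 *: ((f \o shift x) (h *: 1) - f x) @[h --> 0^'] --> d.
  apply/cvgrPdist_le => e e0; have /nbhs_ballP[r /= r0 rH] := H e e0.
  by apply/nbhs_ballP; exists r => //= h hr h0; rewrite E//; exact: rH.
by split; [apply/cvg_ex; exists d|exact: cvg_lim cv].
Qed.

(** A mean value theorem without a sign condition on [c], as increments along a coordinate may go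
    either way. *)
Lemma MVT_abs f (df : R -> R) (c : R) :
  (forall s, `|s| <= `|c| -> is_derive s (1 : R) f (df s)) ->
  exists2 xi, `|xi| <= `|c| & f c - f 0 = df xi * c.
Proof.
move=> H.
have dcont a b : (forall s, s \in `[a, b] -> `|s| <= `|c|) -> {within `[a, b], continuous f}.
  move=> ab; apply: derivable_within_continuous => s /ab /H fs; exact: ex_derive.
have [c0|/ltW c0] := leP 0 c.
  have bd s : s \in `[0, c] -> `|s| <= `|c|.
    by rewrite in_itv/= => /andP[s0 sc]; rewrite !ger0_norm.
  have [s sab|s ss ->] := @MVT_segment R f df 0 c c0 _ (dcont _ _ bd).
    by apply: H; apply: bd; exact: subset_itv_oo_cc sab.
  by exists s; rewrite ?subr0//; exact: bd.
have bd s : s \in `[c, 0] -> `|s| <= `|c|.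
  by rewrite in_itv/= => /andP[s0 sc]; rewrite !ler0_norm// lerN2.
have [s sab|s ss E] := @MVT_segment R f df c 0 c0 _ (dcont _ _ bd).
  by apply: H; apply: bd; exact: subset_itv_oo_cc sab.
exists s; first exact: bd.
by rewrite -opprB E sub0r mulrN opprK.
Qed.

(** From the second power on, the positive part is differentiable at 0, where the remainder is at
    most [|h| ^+ n.+2]. The square serves the cut-offs, the cube the bump functions. *)
Lemma is_derive_maxX n x :
  is_derive x (1 : R) (fun y => Num.max 0 y ^+ n.+2) (n.+2%:R * Num.max 0 x ^+ n.+1).
Proof.
have [x0|x0|->] := ltgtP x 0.
- rewrite expr0n mulr0.
  apply: (@near_eq_is_derive _ _ _ (cst 0)).
    near=> y; rewrite max_l ?expr0n// ltW//; near: y; exact: lt_nbhsl.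
- have dX : is_derive x (1 : R) (id ^+ n.+2 : R -> R) (n.+2%:R * x ^+ n.+1).
    by have := @is_deriveX _ _ id n.+2 x 1 1 (is_derive_id _ _); rewrite /GRing.scale/= mulr1.
  apply: near_eq_is_derive dX.
  by near=> y; rewrite max_r ?exprfctE// ltW//; near: y; exact: lt_nbhsr.
rewrite expr0n mulr0.
have n0 (e : R) : 0 < e -> \forall h \near (0 : R), `|h| <= e.
  move=> e0; apply/nbhs_ballP; exists e => //= y.
  by rewrite /ball/= sub0r normrN => /ltW.
apply/is_deriveP => e e0; near=> h.
rewrite add0r maxxx expr0n mul0r !subr0 normrX.
have hm : `|Num.max 0 h| <= `|h|.
  by have [h0|h0] := leP 0 h; rewrite ?normr0.
apply: (@le_trans _ _ (`|h| ^+ n.+2)); first exact: lerXn2r.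
rewrite exprSr ler_wpM2r// exprS.
have h1 : `|h| <= 1 by near: h; exact: n0.
rewrite -[leRHS]mulr1 ler_pM ?exprn_ile1//.
Unshelve. all: by end_near. Qed.

(** Were [d2] positive, [f1], which vanishes at 0 since [f] is maximal there, would be positive just
    to the right of 0, and the mean value theorem would push [f] above [f 0]. *)
Lemma second_derivative_at_max (f f1 : R -> R) (d2 : R) :
  (\forall s \near 0, is_derive s (1 : R) f (f1 s)) -> is_derive (0 : R) (1 : R) f1 d2 ->
  (\forall s \near 0, f s <= f 0) -> d2 <= 0.
Proof.
move=> /nbhs_ballP[r1 /= r10 H1] H2 /nbhs_ballP[r3 /= r30 H3].
pose r := Num.min r1 r3.
have r0 : 0 < r by rewrite lt_min r10.
have df s : `|s| < r -> is_derive s (1 : R) f (f1 s).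
  by rewrite lt_min => /andP[sr _]; apply: H1; rewrite /ball/= sub0r normrN.
have fmax s : `|s| < r -> f s <= f 0.
  by rewrite lt_min => /andP[_ sr]; apply: H3; rewrite /ball/= sub0r normrN.
have f10 : f1 0 = 0.
  have : is_derive (0 : R) (1 : R) f 0.
    apply: (@derive1_at_max _ _ (- r) r); first by rewrite ge0_cp// ltW.
    - by move=> t; rewrite in_itv/= -ltr_norml => /df [].
    - by rewrite in_itv/= oppr_lt0 r0.
    - by move=> t; rewrite in_itv/= -ltr_norml => /fmax.
  have := df 0; rewrite normr0 => /(_ r0) h1 h2.
  by rewrite -(@derive_val _ _ _ _ _ _ _ h1) (@derive_val _ _ _ _ _ _ _ h2).
rewrite leNgt; apply/negP => d20.
move/is_deriveP : H2 => /(_ _ (divr_gt0 d20 (ltr0Sn _ 1)))/nbhs_ballP[r2 /= r20 H2].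
pose c := Num.min r r2 / 2.
have c0 : 0 < c by rewrite divr_gt0// lt_min r0.
have /andP[cr cr2] : (c < r) && (c < r2).
  by rewrite -lt_min /c ltr_pdivrMr// ltr_pMr ?ltr1n// lt_min r0.
have [s||xi] := @MVT _ f f1 0 c c0.
- rewrite in_itv/= => /andP[s0 sc]; apply: df; rewrite gtr0_norm//; exact: lt_trans cr.
- apply: derivable_within_continuous => s; rewrite in_itv/= => /andP[s0 sc].
  have := df s; rewrite ger0_norm// => /(_ (le_lt_trans sc cr)) ?; exact: ex_derive.
rewrite in_itv/= => /andP[xi0 xic].
have := H2 xi; rewrite /ball/= sub0r normrN gtr0_norm// => /(_ (lt_trans xic cr2)).
rewrite add0r f10 subr0 ler_norml => /andP[h _] fc.
have f1xi : 0 < f1 xi by nra.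
have := fmax c; rewrite gtr0_norm// => /(_ cr); apply/negP; rewrite -ltNge -subr_gt0 fc.
by rewrite subr0 mulr_gt0.
Unshelve. all: by end_near. Qed.

Lemma near_derive_lt f (d : R) : is_derive (0 : R) (1 : R) f d -> d < 0 ->
  \forall s \near (0 : R), 0 < s -> f s < f 0.
Proof.
move=> /is_deriveP H d0; have d20 : 0 < - d / 2 by lra.
apply: filterS (H _ d20) => s; rewrite add0r ler_norml => /andP[_ h] s0.
by move: h; rewrite gtr0_norm//; nra.
Qed.

Lemma near_derive_gt f (d : R) : is_derive (0 : R) (1 : R) f d -> 0 < d ->
  \forall s \near (0 : R), 0 < s -> f 0 < f s.
Proof.
move=> /is_deriveP H d0; have d20 : 0 < d / 2 by lra.
apply: filterS (H _ d20) => s; rewrite add0r ler_norml => /andP[h _] s0.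
by move: h; rewrite gtr0_norm//; nra.
Qed.

Lemma near0_exists_gt0 (P : R -> Prop) : (\forall s \near (0 : R), P s) ->
  exists2 s, 0 < s & P s.
Proof.
move=> /nbhs_ballP[r /= r0 rP]; exists (r / 2); first by rewrite divr_gt0.
by apply: rP; rewrite /ball/= sub0r normrN gtr0_norm ?divr_gt0//; lra.
Qed.

End OneVariable.

(** * Differentiation through continuous partial derivatives *)

Section Dot.
Context {R : realType} {N : nat}.
Implicit Types x y z : 'rV[R]_N.

Lemma dotC x y : dot x y = dot y x.
Proof. by apply: eq_bigr => i _; rewrite mulrC. Qed.

Lemma dotDl x y z : dot (x + y) z = dot x z + dot y z.
Proof. by rewrite -big_split; apply: eq_bigr => i _; rewrite mxE mulrDl. Qed.

Lemma dotZl (c : R) x y : dot (c *: x) y = c * dot x y.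
Proof. by rewrite /dot mulr_sumr; apply: eq_bigr => i _; rewrite mxE mulrA. Qed.

Lemma dotDr x y z : dot x (y + z) = dot x y + dot x z.
Proof. by rewrite dotC dotDl !(dotC x). Qed.

Lemma dotZr (c : R) x y : dot x (c *: y) = c * dot x y.
Proof. by rewrite dotC dotZl (dotC x). Qed.

Lemma dot0l x : dot 0 x = 0.
Proof. by rewrite -(scale0r (0 : 'rV[R]_N)) dotZl mul0r. Qed.

Lemma dotNl x y : dot (- x) y = - dot x y.
Proof. by rewrite -scaleN1r dotZl mulN1r. Qed.

Lemma dot_suml (I : Type) (r : seq I) (F : I -> 'rV[R]_N) y :
  dot (\sum_(i <- r) F i) y = \sum_(i <- r) dot (F i) y.
Proof.
elim/big_rec2 : _ => [|i a b _ <-]; first exact: dot0l.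
by rewrite dotDl.
Qed.

Lemma dot_ge0 x : 0 <= dot x x.
Proof. by apply: sumr_ge0 => i _; rewrite -expr2 sqr_ge0. Qed.

Lemma dot_gt0 x : x != 0 -> 0 < dot x x.
Proof.
move=> x0; rewrite lt_neqAle dot_ge0 andbT eq_sym; apply: contra x0.
rewrite psumr_eq0 => [/allP h|i _]; last by rewrite -expr2 sqr_ge0.
apply/eqP/rowP => i; have := h i (mem_index_enum _); rewrite mxE.
by rewrite -expr2 sqrf_eq0 => /eqP.
Qed.

End Dot.

Section Partial.
Context {R : realType} {N : nat}.
Local Notation E := 'rV[R]_N.
Implicit Types (f g : E -> R) (x y v w : E) (D : set E).

Lemma is_derive_normed f x v d : is_derive x v f d <->
  is_derive (0 : R) 1 (fun s => f (x + s *: v)) d.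
Proof. by split=> /is_derive_line0. Qed.

(** Corners of the staircase from 0 to [w] with one step per coordinate. *)
Definition truncate (k : nat) w : E := \row_j (if (j < k)%N then w 0 j else 0).

Lemma truncateS w (k : 'I_N) :
  truncate k.+1 w = truncate k w + w 0 k *: delta_mx 0 k.
Proof.
apply/rowP => j; rewrite !mxE eqxx/= ltnS leq_eqVlt.
have [->|jk] := eqVneq j k; first by rewrite eqxx ltnn add0r mulr1.
by rewrite (_ : (j == k :> nat) = false) ?mulr0 ?addr0//; apply/negbTE.
Qed.

Lemma normr_rV_le x (r : R) : 0 <= r -> (forall i, `|x 0 i| <= r) -> `|x| <= r.
Proof.
move=> r0 H; rewrite [leLHS]/Num.norm/= mx_normrE.
by apply/bigmax_leP; split=> // -[i j] _ /=; rewrite ord1.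
Qed.

(* Moving from x to x + w one coordinate at a time reduces the increment of f
   to N applications of the mean value theorem. *)
Lemma increment_partial f x (r e : R) w :
  (forall y i, `|y| < r -> derivable f (x + y) (delta_mx 0 i)) ->
  (forall y i, `|y| < r -> `|partial i f (x + y) - partial i f x| <= e) ->
  `|w| < r ->
  `|f (x + w) - f x - dot (gradient f x) w| <= e * N%:R * `|w|.
Proof.
move=> df ef wr.
(* No coordinate of a point on the staircase exceeds that of [w] in absolute value, so in the sup
   norm the whole staircase stays in the ball of radius [r]. *)
have trunc_le (k : nat) (i : 'I_N) (s : R) : `|s| <= `|w 0 i| -> (k <= i)%N ->
    `|truncate k w + s *: delta_mx 0 i| < r.
  move=> sw ki; apply: le_lt_trans wr; apply: normr_rV_le => // j.
  rewrite !mxE eqxx/=; have [->|ji] := eqVneq j i.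
    by rewrite ltnNge ki/= add0r mulr1 (le_trans sw)// normr_coord_le.
  by rewrite mulr0 addr0; case: ifP => _; rewrite ?normr0// normr_coord_le.
suff H (k : nat) : (k <= N)%N ->
    `|f (x + truncate k w) - f x - \sum_(j < N | (j < k)%N) partial j f x * w 0 j|
      <= e * k%:R * `|w|.
  have := H N (leqnn N); rewrite (_ : truncate N w = w); last first.
    by apply/rowP => j; rewrite mxE ltn_ord.
  rewrite (_ : \sum_(j < N | _) _ = dot (gradient f x) w)//.
  by apply: eq_big => [j|j _]; rewrite ?ltn_ord// mxE.
elim: k => [_|k IH kN].
  rewrite (_ : truncate 0 w = 0) ?big1 ?addr0 ?subrr ?subr0 ?normr0 ?mulr0 ?mul0r//.
  by apply/rowP => j; rewrite !mxE.
pose i := Ordinal kN.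
have -> : truncate k.+1 w = truncate k w + w 0 i *: delta_mx 0 i.
  exact: (truncateS w i).
rewrite (bigD1 i)//= (eq_bigl (fun j : 'I_N => (j < k)%N)); last first.
  move=> j; rewrite ltnS leq_eqVlt.
  have [->|ji] := eqVneq j i; first by rewrite andbF ltnn.
  by rewrite andbT (_ : (j == k :> nat) = false)//; apply/negbTE.
pose g s := f (x + truncate k w + s *: delta_mx 0 i).
have dg s : `|s| <= `|w 0 i| ->
    is_derive s (1 : R) g (partial i f (x + truncate k w + s *: delta_mx 0 i)).
  move=> sw; apply/is_derive_line/derivableP; rewrite -addrA; apply: df.
  exact: trunc_le.
have [xi xiw] := MVT_abs dg.
rewrite /g scale0r addr0 => Eg.
have := ef _ i (@trunc_le k i xi xiw (leqnn _)); rewrite addrA => Exi.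
rewrite addrA.
set A := f (_ + w 0 i *: _) in Eg *; set B := f (x + truncate k w) in Eg IH *.
rewrite (_ : A - f x - _ = (B - f x - \sum_(j < N | (j < k)%N) partial j f x * w 0 j) +
   (partial i f (x + truncate k w + xi *: delta_mx 0 i) - partial i f x) * w 0 i); last first.
  have -> : A = B + partial i f (x + truncate k w + xi *: delta_mx 0 i) * w 0 i.
    by rewrite -Eg addrC subrK.
  ring.
rewrite (le_trans (ler_normD _ _))// -[in leRHS]natr1 mulrDr mulrDl mulr1 lerD//.
  by apply: IH; exact: ltnW.
by rewrite normrM ler_pM// normr_coord_le.
Qed.

Lemma is_derive_partial f x v :
  (\forall y \near x, forall i, derivable f y (delta_mx 0 i)) ->
  (forall i, {for x, continuous (partial i f)}) ->
  is_derive x v f (dot (gradient f x) v).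
Proof.
move=> df cf; apply/is_derive_normed/is_deriveP => e e0.
(* The [+ 1] covers [v = 0]; with this [e'] the bound of [increment_partial] for the increment
   [h *: v] is at most [e] times the absolute value of [h]. *)
pose e' := e / (N%:R * `|v| + 1).
have c0 : 0 < N%:R * `|v| + 1 by rewrite ltr_wpDl// mulr_ge0.
have e'0 : 0 < e' by rewrite divr_gt0.
have : \forall y \near x, forall i, `|partial i f y - partial i f x| <= e'.
  have ei i : \forall y \near x, `|partial i f y - partial i f x| <= e'.
    have /cvgrPdist_le/(_ _ e'0) := cf i.
    by apply: filterS => y; rewrite distrC.
  exact: (filter_forall _ ei).
move: df => /nbhs_ballP[r1 /= r10 H1] /nbhs_ballP[r2 /= r20 H2].
pose r := Num.min r1 r2.
have r0 : 0 < r by rewrite lt_min r10.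
have yball y : `|y| < r -> ball x r1 (x + y) /\ ball x r2 (x + y).
  by rewrite lt_min => /andP[yr1 yr2]; rewrite -!ball_normE/= opprD addrA subrr sub0r normrN.
have incr := @increment_partial f x r e' _
  (fun y i yr => H1 _ (yball y yr).1 i) (fun y i yr => H2 _ (yball y yr).2 i).
near=> h; rewrite scale0r addr0 add0r [_ * h]mulrC -dotZr.
apply: le_trans (incr (h *: v) _) _.
  rewrite normrZ; near: h.
  apply/nbhs_ballP; exists (r / (`|v| + 1)).
    by rewrite /= divr_gt0// ltr_wpDl.
  move=> h; rewrite /ball/= sub0r normrN ltr_pdivlMr ?ltr_wpDl//.
  by apply: le_lt_trans; rewrite ler_wpM2l// lerDl.
rewrite normrZ mulrCA mulrC ler_wpM2r// -mulrA /e' mulrAC ler_pdivrMr// ler_wpM2l ?ltW//.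
by rewrite ltrDl.
Unshelve. all: by end_near. Qed.

End Partial.

Section ContinuousFun.
Context {R : realType} {T : topologicalType}.
Implicit Types (f g : T -> R) (x : T).

Lemma continuous_funD f g : continuous f -> continuous g ->
  continuous (fun x => f x + g x).
Proof. by move=> cf cg x; exact: (cvgD (cf x) (cg x)). Qed.

Lemma continuous_funM f g : continuous f -> continuous g ->
  continuous (fun x => f x * g x).
Proof. by move=> cf cg x; exact: (cvgM (cf x) (cg x)). Qed.

Lemma continuous_fun_sum (I : Type) (r : seq I) (F : I -> T -> R) :
  (forall i, continuous (F i)) ->
  continuous (fun x => \sum_(i <- r) F i x).
Proof.
move=> cF; elim: r => [|i r IH].
  have -> : (fun x => \sum_(i <- [::]) F i x) = fun=> 0.
    by apply/funext => y; rewrite big_nil.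
  exact: cst_continuous.
have -> : (fun x => \sum_(j <- i :: r) F j x) = (fun x => F i x + \sum_(j <- r) F j x).
  by apply/funext => y; rewrite big_cons.
exact: continuous_funD.
Qed.

Lemma near_continuous_gt f x (c : R) : {for x, continuous f} -> c < f x ->
  \forall y \near x, c < f y.
Proof. by move=> cf; exact: cvgr_gt. Qed.

Lemma near_continuous_lt f x (c : R) : {for x, continuous f} -> f x < c ->
  \forall y \near x, f y < c.
Proof. by move=> cf; exact: cvgr_lt. Qed.

End ContinuousFun.

(** * Functions of class C^1 and C^2, bump functions *)

Section C12.
Context {R : realType} {N : nat}.
Local Notation E := 'rV[R]_N.
Implicit Types (f g : E -> R) (x y v w : E).

Definition C1 f := continuous f /\
  forall i, (forall x, derivable f x (delta_mx 0 i)) /\ continuous (partial i f).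

Definition C2 f := C1 f /\ forall i, C1 (partial i f).

Lemma C1_is_derive f x i : C1 f -> is_derive x (delta_mx 0 i) f (partial i f x).
Proof. by move=> [_ /(_ i)[df _]]; exact/derivableP/df. Qed.

Lemma C1_gradient f x v : C1 f -> is_derive x v f (dot (gradient f x) v).
Proof.
move=> [_ C]; apply: is_derive_partial => [|i].
  by apply/nbhs_ballP; exists 1 => //= y _ i; exact: (C i).1.
exact: (C i).2.
Qed.

Lemma is_derive_partialE f (g : 'I_N -> E -> R) :
  (forall i x, is_derive x (delta_mx 0 i) f (g i x)) ->
  forall i, partial i f = g i.
Proof. by move=> fg i; apply/funext => x; exact: (@derive_val _ _ _ _ _ _ _ (fg i x)). Qed.

Lemma C1_intro f (g : 'I_N -> E -> R) : continuous f ->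
  (forall i x, is_derive x (delta_mx 0 i) f (g i x)) ->
  (forall i, continuous (g i)) -> C1 f.
Proof.
move=> cf fg cg; split=> // i; split; first by move=> x; case: (fg i x).
by rewrite (is_derive_partialE fg).
Qed.

Lemma C2_intro f (g : 'I_N -> E -> R) : continuous f ->
  (forall i x, is_derive x (delta_mx 0 i) f (g i x)) ->
  (forall i, C1 (g i)) -> C2 f.
Proof.
move=> cf fg cg; split; first by apply: (C1_intro cf fg) => i; case: (cg i).
by move=> i; rewrite (is_derive_partialE fg).
Qed.

Lemma C1_cst c : C1 (fun _ => c).
Proof.
apply: (@C1_intro _ (fun _ _ => 0)).
- exact: cst_continuous.
- by move=> i; exact: cst_continuous.
Qed.

Lemma C1D f g : C1 f -> C1 g -> C1 (fun x => f x + g x).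
Proof.
move=> Cf Cg; apply: (@C1_intro _ (fun i x => partial i f x + partial i g x)).
- by apply: continuous_funD; [exact: Cf.1|exact: Cg.1].
- by move=> i x; apply: is_deriveD; exact: C1_is_derive.
- by move=> i; apply: continuous_funD; [exact: (Cf.2 i).2|exact: (Cg.2 i).2].
Qed.

Lemma is_deriveM_partial f g i x : C1 f -> C1 g ->
  is_derive x (delta_mx 0 i) (fun x => f x * g x) (partial i f x * g x + f x * partial i g x).
Proof.
move=> Cf Cg; rewrite addrC [partial i f x * _]mulrC.
exact: (is_deriveM (C1_is_derive x i Cf) (C1_is_derive x i Cg)).
Qed.

Lemma C1M f g : C1 f -> C1 g -> C1 (fun x => f x * g x).
Proof.
move=> Cf Cg; apply: (@C1_intro _ (fun i x => partial i f x * g x + f x * partial i g x)).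
- by apply: continuous_funM; [exact: Cf.1|exact: Cg.1].
- by move=> i x; exact: is_deriveM_partial.
- by move=> i; apply: continuous_funD; apply: continuous_funM;
    [exact: (Cf.2 i).2|exact: Cg.1|exact: Cf.1|exact: (Cg.2 i).2].
Qed.

Lemma C2D f g : C2 f -> C2 g -> C2 (fun x => f x + g x).
Proof.
move=> Cf Cg; apply: (@C2_intro _ (fun i x => partial i f x + partial i g x)).
- exact: (C1D Cf.1 Cg.1).1.
- by move=> i x; apply: is_deriveD; apply: C1_is_derive; [exact: Cf.1|exact: Cg.1].
- by move=> i; apply: C1D; [exact: Cf.2|exact: Cg.2].
Qed.

Lemma C2M f g : C2 f -> C2 g -> C2 (fun x => f x * g x).
Proof.
move=> Cf Cg.
apply: (@C2_intro _ (fun i x => partial i f x * g x + f x * partial i g x)).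
- exact: (C1M Cf.1 Cg.1).1.
- by move=> i x; apply: is_deriveM_partial; [exact: Cf.1|exact: Cg.1].
- by move=> i; apply: C1D; apply: C1M; [exact: Cf.2|exact: Cg.1|exact: Cf.1|exact: Cg.2].
Qed.

Lemma partial_cst c i : partial i (fun _ : E => c) = fun _ => 0.
Proof. by apply/funext => x; exact: derive_cst. Qed.

Lemma C2_cst c : C2 (fun _ => c).
Proof. by split=> [|i]; rewrite ?partial_cst; exact: C1_cst. Qed.

Lemma C2_sum (I : eqType) (r : seq I) (F : I -> E -> R) :
  (forall i, i \in r -> C2 (F i)) -> C2 (fun x => \sum_(i <- r) F i x).
Proof.
elim: r => [_|i r IH CF].
  rewrite (_ : (fun x => _) = fun=> 0); first exact: C2_cst.
  by apply/funext => x; rewrite big_nil.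
rewrite (_ : (fun x => _) = fun x => F i x + \sum_(i <- r) F i x).
  apply: (C2D (CF i (mem_head _ _))); apply: IH => j jr; apply: CF.
  by rewrite inE jr orbT.
by apply/funext => x; rewrite big_cons.
Qed.

Lemma is_derive_bigsum (I : eqType) (r : seq I) (F : I -> E -> R) (d : I -> R) x v :
  (forall i, i \in r -> is_derive x v (F i) (d i)) ->
  is_derive x v (fun x => \sum_(i <- r) F i x) (\sum_(i <- r) d i).
Proof.
elim: r => [_|i r IH dF].
  rewrite (_ : (fun x => _) = fun=> 0) ?big_nil; first exact: is_derive_cst.
  by apply/funext => y; rewrite big_nil.
rewrite (_ : (fun x => _) = fun x => F i x + \sum_(i <- r) F i x) ?big_cons.
  apply: (is_deriveD (dF i (mem_head _ _))); apply: IH => j jr; apply: dF.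
  by rewrite inE jr orbT.
by apply/funext => y; rewrite big_cons.
Qed.

Lemma C2_coord (j : 'I_N) : C2 (fun x : E => x 0 j).
Proof.
apply: (@C2_intro _ (fun i _ => (j == i)%:R)).
- exact: coord_continuous.
- move=> i x; apply/is_derive_line0.
  rewrite (_ : (fun s : R => _) = (fun s => x 0 j + s * (j == i)%:R)); last first.
    by apply/funext => s; rewrite !mxE eqxx.
  have := is_deriveD (is_derive_cst (x 0 j) (0:R) 1)
    (is_deriveM (is_derive_id (0:R) 1) (is_derive_cst ((j == i)%:R : R) (0:R) 1)).
  by rewrite scaler0 !add0r /GRing.scale/= mulr1.
- by move=> i; exact: C1_cst.
Qed.

Lemma is_derive_comp_partial (u u' : R -> R) f i x :
  (forall t : R, is_derive t (1 : R) u (u' t)) -> derivable f x (delta_mx 0 i) ->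
  is_derive x (delta_mx 0 i) (fun x => u (f x)) (u' (f x) * partial i f x).
Proof.
move=> du df; apply/is_derive_line0.
have fx : is_derive (0:R) 1 (fun s : R => f (x + s *: delta_mx 0 i)) (partial i f x).
  exact/is_derive_line0/derivableP.
have ux : is_derive (f (x + (0 : R) *: delta_mx 0 i)) 1 u (u' (f x)).
  by rewrite scale0r addr0.
exact: (is_derive1_comp ux fx).
Qed.

Lemma C1_comp (u u' : R -> R) f : (forall t : R, is_derive t (1 : R) u (u' t)) ->
  continuous u' -> C1 f -> C1 (fun x => u (f x)).
Proof.
move=> du cu' Cf; apply: (@C1_intro _ (fun i x => u' (f x) * partial i f x)).
- move=> x; apply: continuous_comp; first exact: Cf.1.
  by apply: differentiable_continuous; apply/derivable1_diffP; case: (du (f x)).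
- by move=> i x; apply: is_derive_comp_partial => //; exact: (Cf.2 i).1.
- move=> i; apply: continuous_funM; last exact: (Cf.2 i).2.
  by move=> x; apply: continuous_comp; [exact: Cf.1|exact: cu'].
Qed.

Lemma C2_comp (u u' u'' : R -> R) f : (forall t : R, is_derive t (1 : R) u (u' t)) ->
  (forall t : R, is_derive t (1 : R) u' (u'' t)) -> continuous u'' ->
  C2 f -> C2 (fun x => u (f x)).
Proof.
move=> du du' cu'' Cf; apply: (@C2_intro _ (fun i x => u' (f x) * partial i f x)).
- move=> x; apply: continuous_comp; first exact: Cf.1.1.
  by apply: differentiable_continuous; apply/derivable1_diffP; case: (du (f x)).
- by move=> i x; apply: is_derive_comp_partial => //; exact: (Cf.1.2 i).1.
- by move=> i; apply: C1M; [exact: C1_comp du' _ Cf.1|exact: Cf.2].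
Qed.

Lemma smooth_C2 f : smooth f -> C2 f.
Proof.
move=> sf; split=> [|i].
  by split=> [|i]; [exact: (sf [::]).1|split; [exact: (sf [::]).2|exact: (sf [:: i]).1]].
split=> [|j]; first exact: (sf [:: i]).1.
by split; [exact: (sf [:: i]).2|exact: (sf [:: j; i]).1].
Qed.

Lemma continuous_dot (F G : E -> E) :
  (forall i, continuous (fun x => F x 0 i)) -> (forall i, continuous (fun x => G x 0 i)) ->
  continuous (fun x => dot (F x) (G x)).
Proof.
by move=> cF cG; apply: continuous_fun_sum => i; apply: continuous_funM; [exact: cF|exact: cG].
Qed.

Lemma continuous_gradient f i : C1 f -> continuous (fun x => gradient f x 0 i).
Proof.
move=> Cf; rewrite (_ : (fun x => _) = partial i f); first exact: (Cf.2 i).2.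
by apply/funext => x; rewrite mxE.
Qed.

Lemma continuous_laplacian f : C2 f -> continuous (laplacian f).
Proof. by move=> Cf; apply: continuous_fun_sum => i; exact: ((Cf.2 i).2 i).2. Qed.

(** The cube makes the positive part C^2. The squared Euclidean distance is used because it is a
    polynomial; the Euclidean ball lies in the sup-norm ball of the same radius, which is what
    [bump_ball] exploits. *)
Definition bump (c : E) (r : R) x : R :=
  Num.max 0 (r ^+ 2 - \sum_(j < N) (x 0 j - c 0 j) ^+ 2) ^+ 3.

Lemma continuous_max0 : continuous (fun x : R => Num.max 0 x).
Proof.
have -> : (fun x : R => Num.max 0 x) = (fun x : R => 2^-1 * (x + `|x|)).
  by apply/funext => x; rewrite maxr_absE add0r sub0r normrN mulrC.
apply: continuous_funM; first exact: cst_continuous.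
by apply: continuous_funD; [move=> x; exact: cvg_id|exact: norm_continuous].
Qed.

Lemma C2_bump c r : C2 (bump c r).
Proof.
apply: (C2_comp (@is_derive_maxX R 1) (u'' := fun t => 6%:R * Num.max 0 t)).
- move=> t.
  have := is_deriveM (is_derive_cst (3%:R : R) t 1) (@is_derive_maxX R 0 t).
  move=> /is_derive_eq; apply.
  by rewrite scaler0 addr0 /GRing.scale/= /cst expr1 mulrA -natrM.
- by apply: continuous_funM; [exact: cst_continuous|exact: continuous_max0].
apply: C2D; first exact: C2_cst.
rewrite (_ : (fun x => _) = (fun x => -1 * \sum_(j < N) (x 0 j - c 0 j) ^+ 2)); last first.
  by apply/funext => x; rewrite mulN1r.
apply: C2M; first exact: C2_cst.
apply: C2_sum => j _.
by apply: C2M; apply: C2D; (exact: C2_coord || exact: C2_cst).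
Qed.

Lemma bump_ge0 c r x : 0 <= bump c r x.
Proof. by rewrite exprn_ge0// le_max lexx. Qed.

Lemma bump_ball c r x : 0 < r -> 0 < bump c r x -> ball c r x.
Proof.
move=> r0; rewrite /bump; case: (ltP 0 (r ^+ 2 - _)) => [h _|]; last by rewrite expr0n ltxx.
split=> // i j; rewrite ord1 /ball/= distrC -(ltr_pXn2r (ltn0Sn 1)) ?nnegrE// ?ltW//.
rewrite -normrX ger0_norm ?sqr_ge0//; move: h; rewrite subr_gt0; apply: le_lt_trans.
by rewrite (bigD1 j)//= lerDl; apply: sumr_ge0 => k _; exact: sqr_ge0.
Qed.

Lemma bump_center c r : 0 < r -> 0 < bump c r c.
Proof.
move=> r0; rewrite /bump big1 => [|j _]; last by rewrite subrr expr0n.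
by rewrite subr0 max_r ?exprn_gt0// sqr_ge0.
Qed.

End C12.

(** * A global defining function *)

Lemma near_and_join {T : topologicalType} (x : T) (P Q : T -> Prop) :
  (\forall y \near x, P y) -> (\forall y \near x, Q y) ->
  \forall y \near x, [/\ P y, Q y & \forall z \near y, Q z].
Proof.
move=> nP nQ; apply: filterS (filterI nP (filterI nQ (near_join nQ))).
by move=> y [? []].
Qed.

Section DefiningFunction.
Context {R : realType} {N : nat}.
Local Notation E := 'rV[R]_N.
Implicit Types (Om : set E) (f g psi h : E -> R) (x y v w : E).

(** [h] will be only C^2, since the bumps are, whereas a [local_defining_function] is smooth; hence
    the gradient of [h] is not by definition a multiple of an outer unit normal. [defining_normal]
    carries the Neumann condition over to this gradient. *)
Record defining_function Om h : Prop := DefiningFunction {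
  defining_C2 : C2 h ;
  defining_lt0 : forall x, Om x <-> h x < 0 ;
  defining_boundary : forall x, boundary Om x -> h x = 0 ;
  defining_gradient : forall x, boundary Om x -> 0 < dot (gradient h x) (gradient h x) ;
  defining_normal : forall x w, boundary Om x ->
    (forall nu, outer_unit_normal Om x nu -> dot w nu = 0) ->
    dot w (gradient h x) = 0 }.

Lemma boundary_eq0 Om psi x : C2 psi -> boundary Om x ->
  (\forall y \near x, Om y <-> psi y < 0) -> psi x = 0.
Proof.
move=> Cpsi [clx nOx] nx; apply/eqP; rewrite eq_le; apply/andP; split; last first.
  by rewrite leNgt; apply/negP => /(nbhs_singleton nx).2.
rewrite leNgt; apply/negP => psix.
have psi0 := near_continuous_gt (Cpsi.1.1 x) psix.
have [y [Oy [H1 H2]]] := clx _ (filterI nx psi0).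
by have := H1.1 Oy; rewrite ltNge ltW.
Qed.

(* If dot a b <= 0, the direction v = b - a enters {f < 0} but leaves {g < 0}. *)
Lemma local_defining_dot_gt0 Om f g x :
  local_defining_function Om x f -> local_defining_function Om x g ->
  0 < dot (gradient f x) (gradient g x).
Proof.
move=> [sf f0 gf0 nf] [sg g0 gg0 ng].
rewrite ltNge; apply/negP => ab0.
set a := gradient f x in gf0 ab0; set b := gradient g x in gg0 ab0.
pose v := b - a.
have av : dot a v < 0.
  by rewrite /v -scaleN1r dotDr dotZr mulN1r; have := dot_gt0 gf0; lra.
have bv : 0 < dot b v.
  by rewrite /v -scaleN1r dotDr dotZr mulN1r [dot b a]dotC; have := dot_gt0 gg0; lra.
have Cf := (smooth_C2 sf).1; have Cg := (smooth_C2 sg).1.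
have /near_derive_lt/(_ av) Hf : is_derive (0 : R) (1 : R) (fun s => f (x + s *: v)) (dot a v).
  by apply/is_derive_line0; exact: C1_gradient.
have /near_derive_gt/(_ bv) Hg : is_derive (0 : R) (1 : R) (fun s => g (x + s *: v)) (dot b v).
  by apply/is_derive_line0; exact: C1_gradient.
have [s s0 [[Hfs Hgs] [nfs ngs]]] :=
  near0_exists_gt0 (filterI (filterI Hf Hg) (filterI (near_line v nf) (near_line v ng))).
move: (Hfs s0) (Hgs s0); rewrite scale0r addr0 f0 g0 => /nfs.2/ngs.1.
by move=> /lt_trans h /h; rewrite ltxx.
Qed.

(* Interior points carry the constant function -1, boundary points a local
   defining function. *)
Definition chart Om (x : E) (c : (E -> R) * R) := [/\ C2 c.1, 0 < c.2 &
  forall y, ball x c.2 y -> (Om y <-> c.1 y < 0) /\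
    (boundary Om y -> local_defining_function Om y c.1)].

(** A local defining function at [x] is one at every boundary point nearby: the nonvanishing of the
    gradient and the sublevel description are open conditions, and [boundary_eq0] gives the value 0
    there. *)
Lemma exists_chart Om x : open Om -> smooth_boundary Om -> closure Om x ->
  exists c, chart Om x c.
Proof.
move=> oOm sOm clx; have [Ox|nOx] := pselect (Om x).
  have /nbhs_ballP[r /= r0 rO] : nbhs x Om by exact: open_nbhs_nbhs.
  exists (fun=> -1, r); split => //=; first exact: C2_cst.
  move=> y /rO Oy; split; last by move=> [].
  by split=> // _; rewrite oppr_lt0.
have bx : boundary Om x by [].
have [psi [spsi psi0 gpsi npsi]] := sOm x bx.
have Cpsi := smooth_C2 spsi.
have gnear : \forall y \near x, 0 < dot (gradient psi y) (gradient psi y).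
  apply: near_continuous_gt; last exact: dot_gt0.
  by apply: continuous_dot => i; exact: continuous_gradient Cpsi.1.
have : \forall y \near x, [/\ 0 < dot (gradient psi y) (gradient psi y),
    Om y <-> psi y < 0 & \forall z \near y, Om z <-> psi z < 0].
  exact: near_and_join gnear npsi.
move=> /nbhs_ballP[r /= r0 rP].
exists (psi, r); split=> [|//|y /rP[gy Oy ny]]; first exact: Cpsi.
split=> [|bdy]; first exact: Oy.
split; [exact: spsi|exact: boundary_eq0 Cpsi bdy ny| |exact: ny].
by apply: contraTneq gy => ->; rewrite dot0l ltxx.
Qed.

Lemma bounded_set_closure Om : bounded_set Om -> bounded_set (closure Om).
Proof.
move=> [M [Mr OM]]; exists M; split=> // m Mm x clx; rewrite /= leNgt; apply/negP => mx.
have nm := near_continuous_gt (@norm_continuous _ _ x) mx.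
have [y [Oy /= my]] := clx _ nm.
by have := OM m Mm y Oy; rewrite /= leNgt my.
Qed.

(** Otherwise a small move against the gradient would make [f] negative. Applied to the bumps: where
    one vanishes, so does its gradient. *)
Lemma gradient_min f x : C1 f -> (forall y, 0 <= f y) -> f x = 0 -> gradient f x = 0.
Proof.
move=> Cf f_ge0 f0; apply/eqP; apply: contraT => /dot_gt0 g0.
have d0 : dot (gradient f x) (- gradient f x) < 0.
  by rewrite -scaleN1r dotZr mulN1r oppr_lt0.
have /near_derive_lt/(_ d0) : is_derive (0 : R) (1 : R)
    (fun s => f (x + s *: - gradient f x)) (dot (gradient f x) (- gradient f x)).
  by apply/is_derive_line0; exact: C1_gradient.
move=> /near0_exists_gt0[s s0 /(_ s0)]; rewrite scale0r addr0 f0.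
by rewrite ltNge f_ge0.
Qed.

(** Nonnegative weights without normalisation suffice, since only signs count: within its ball each
    [psi c] is negative exactly on [Om], and at a boundary point the gradients pairwise form acute
    angles. *)
Lemma exists_defining_function Om : bounded_smooth_domain Om ->
  exists h, defining_function Om h.
Proof.
move=> [oOm _ _ bOm sOm].
have cpt : compact (closure Om).
  apply: bounded_closed_compact; last exact: closed_closure.
  exact: bounded_set_closure.
have /choice[ch chP] : forall x, exists c, closure Om x -> chart Om x c.
  move=> x; have [clx|nclx] := pselect (closure Om x); last by exists (cst 0, 0).
  by have [c] := exists_chart oOm sOm clx; exists c.
have [D DOm pos] : exists2 D : seq E, (forall c, c \in D -> closure Om c) &
    forall y, closure Om y -> exists2 c, c \in D & 0 < bump c (ch c).2 y.
  have := cpt; rewrite compact_cover => /(_ E (closure Om)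
    (fun c => [set y | 0 < bump c (ch c).2 y])) [].
  - move=> c _; rewrite openE => y /= hy.
    apply: near_continuous_gt hy; exact: (C2_bump _ _).1.1.
  - by move=> y cly; exists y => //; have [_ r0 _] := chP y cly; exact: bump_center.
  move=> D DOm cover; exists (finmap.enum_fset D) => [c cD|y /cover[c /= cD]].
    by have := DOm c cD; rewrite inE.
  by exists c.
pose chi c := bump c (ch c).2; pose psi c := (ch c).1.
pose h y := \sum_(c <- D) chi c y * psi c y.
have chiP c y : c \in D -> 0 < chi c y -> (Om y <-> psi c y < 0) /\
    (boundary Om y -> local_defining_function Om y (psi c)).
  move=> /DOm /chP[_ r0 H] /(bump_ball r0); exact: H.
have Cpsi c : c \in D -> C2 (psi c) by move=> /DOm /chP[].
have Cchi c : C2 (chi c) by exact: C2_bump.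
have Ch : C2 h by apply: C2_sum => c /Cpsi; exact: C2M.
have chi0 c y : 0 <= chi c y by exact: bump_ge0.
have psi0 c y : c \in D -> boundary Om y -> 0 < chi c y -> psi c y = 0.
  by move=> cD bdy h0; have [_ ? _ _] := (chiP c y cD h0).2 bdy.
(* The terms of the product rule that differentiate [chi c] drop out: either [chi c y = 0], a
   minimum, or [psi c y = 0]. *)
have grad y : boundary Om y -> gradient h y = \sum_(c <- D) chi c y *: gradient (psi c) y.
  move=> bdy; apply/rowP => i; rewrite summxE mxE.
  have dh : is_derive y (delta_mx 0 i) h (\sum_(c <- D) chi c y * partial i (psi c) y).
    apply: is_derive_bigsum => c cD.
    have := is_deriveM_partial i y (Cchi c).1 (Cpsi c cD).1.
    move=> /is_derive_eq; apply.
    have := chi0 c y; rewrite le_eqVlt => /predU1P[chi_eq0|chi_gt0].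
      have := gradient_min (Cchi c).1 (chi0 c) (esym chi_eq0).
      by move=> /rowP/(_ i); rewrite !mxE => ->; rewrite mul0r add0r.
    by rewrite psi0// mulr0 add0r.
  rewrite [LHS](@derive_val _ _ _ _ _ _ _ dh).
  by apply: eq_bigr => c _; rewrite !mxE.
exists h; split.
- exact: Ch.
- move=> y; split=> [Oy|].
    have [c0 c0D chi0_gt0] := pos y (subset_closure Oy).
    rewrite /h (big_rem c0)//=; apply: ltr_nwDl; last first.
      rewrite big_seq; apply: sumr_le0 => c /mem_rem cD.
      have := chi0 c y; rewrite le_eqVlt => /predU1P[<-|chi_gt0].
        by rewrite mul0r.
      by rewrite mulr_ge0_le0// ltW//; exact/(chiP c y cD chi_gt0).1.1.
    by rewrite pmulr_rlt0//; exact/(chiP c0 y c0D chi0_gt0).1.1.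
  apply: contraPP => nOy; apply/negP; rewrite -leNgt /h big_seq.
  apply: sumr_ge0 => c cD; have := chi0 c y; rewrite le_eqVlt => /predU1P[<-|chi_gt0].
    by rewrite mul0r.
  rewrite mulr_ge0// leNgt; apply/negP => /(chiP c y cD chi_gt0).1.2; exact: nOy.
- move=> y bdy; rewrite /h big_seq big1// => c cD.
  have := chi0 c y; rewrite le_eqVlt => /predU1P[<-|chi_gt0]; first by rewrite mul0r.
  by rewrite psi0// mulr0.
- move=> y bdy; rewrite grad//.
  have [c0 c0D chi0_gt0] := pos y bdy.1.
  (* Inner products of gradients at a common boundary point are positive, so the weighted sum cannot
     cancel. *)
  have dot_pos c c' : c \in D -> c' \in D ->
      0 <= dot (chi c y *: gradient (psi c) y) (chi c' y *: gradient (psi c') y).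
    move=> cD c'D; rewrite dotZl dotZr.
    have := chi0 c y; rewrite le_eqVlt => /predU1P[<-|c_gt0]; first by rewrite mul0r.
    have := chi0 c' y; rewrite le_eqVlt => /predU1P[<-|c'_gt0]; first by rewrite mul0r mulr0.
    apply: mulr_ge0; first exact: ltW.
    apply: mulr_ge0; first exact: ltW.
    apply: ltW.
    exact: local_defining_dot_gt0 ((chiP c y cD c_gt0).2 bdy) ((chiP c' y c'D c'_gt0).2 bdy).
  rewrite dot_suml (big_rem c0)//=; apply: ltr_pwDl; last first.
    rewrite big_seq; apply: sumr_ge0 => c /mem_rem cD; rewrite dotC dot_suml big_seq.
    by apply: sumr_ge0 => c' c'D; exact: dot_pos.
  rewrite dotC dot_suml (big_rem c0)//=; apply: ltr_pwDl; last first.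
    by rewrite big_seq; apply: sumr_ge0 => c /mem_rem cD; exact: dot_pos.
  rewrite dotZl dotZr; apply: mulr_gt0; first exact: chi0_gt0.
  apply: mulr_gt0; first exact: chi0_gt0.
  exact: local_defining_dot_gt0 ((chiP c0 y c0D chi0_gt0).2 bdy) ((chiP c0 y c0D chi0_gt0).2 bdy).
- move=> y w bdy wnu; rewrite grad// dotC dot_suml big_seq big1// => c cD.
  have := chi0 c y; rewrite le_eqVlt => /predU1P[<-|chi_gt0].
    by rewrite scale0r dot0l.
  have ldf := (chiP c y cD chi_gt0).2 bdy; have [_ _ g0 _] := ldf.
  set b := gradient (psi c) y in g0 *.
  (* The chart is a local defining function at [y], so its normalised gradient is an outer unit
     normal to which the hypothesis applies. *)
  have := wnu _ (ex_intro2 _ _ (psi c) ldf erefl); rewrite -/b dotZr => /eqP.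
  rewrite mulf_eq0 invr_eq0 sqrtr_eq0 leNgt dot_gt0//= => /eqP wb.
  by rewrite dotZl dotC wb mulr0.
Qed.

End DefiningFunction.

(** * Cut-off functions *)

Lemma continuous_funV {R : realType} {T : topologicalType} (f : T -> R) :
  continuous f -> (forall x, f x != 0) -> continuous (fun x => (f x)^-1).
Proof. by move=> cf f0 x; exact: (cvgV (f0 x) (cf x)). Qed.

Section Cutoff.
Context {R : realType}.
Implicit Types (e y : R).

(** A C^1 profile that is 0 for [y >= - e], so that [cut e (h x)] vanishes near and beyond the
    boundary, and that tends to 1 as [e] tends to 0 when [y < 0]. *)
Definition cut e y : R := Num.max 0 (- y - e) ^+ 2 / (Num.max 0 (- y - e) ^+ 2 + e ^+ 2).

Definition dcut e y : R :=
  - (2 * Num.max 0 (- y - e) * e ^+ 2) / (Num.max 0 (- y - e) ^+ 2 + e ^+ 2) ^+ 2.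

Lemma cut_den_gt0 e y : 0 < e -> 0 < Num.max 0 (- y - e) ^+ 2 + e ^+ 2.
Proof. by move=> e0; rewrite ltr_wpDl ?sqr_ge0// exprn_gt0. Qed.

Lemma is_derive_cut e y : 0 < e -> is_derive y (1 : R) (cut e) (dcut e y).
Proof.
move=> e0; have d0 := cut_den_gt0 y e0.
pose lin (y : R) : R := - y - e.
have dl : is_derive y (1 : R) lin (-1).
  have := is_deriveB (is_deriveN (is_derive_id y (1 : R))) (is_derive_cst e y (1 : R)).
  by rewrite subr0.
have dP : is_derive y (1 : R) (fun y => Num.max 0 (- y - e) ^+ 2) (- (2 * Num.max 0 (- y - e))).
  have := is_derive1_comp (@is_derive_maxX R 0 (lin y)) dl.
  by rewrite mulrN1 expr1.
have dQ : is_derive y (1 : R) (fun y => Num.max 0 (- y - e) ^+ 2 + e ^+ 2)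
    (- (2 * Num.max 0 (- y - e))).
  by have := is_deriveD dP (is_derive_cst (e ^+ 2) y (1 : R)); rewrite addr0.
have Q0 : Num.max 0 (- y - e) ^+ 2 + e ^+ 2 != 0 by rewrite gt_eqF.
have dV := @is_deriveV _ (fun y => Num.max 0 (- y - e) ^+ 2 + e ^+ 2) _ _ _ Q0 dQ.
have := is_deriveM dP dV.
move=> /is_derive_eq; apply; rewrite /GRing.scale/= /dcut.
by move: (Num.max 0 (- y - e)) Q0 => m Q0; field.
Qed.

Lemma cut_ge0 e y : 0 < e -> 0 <= cut e y.
Proof. by move=> e0; rewrite divr_ge0 ?sqr_ge0// ltW// cut_den_gt0. Qed.

Lemma cut_le1 e y : 0 < e -> cut e y <= 1.
Proof. by move=> e0; rewrite ler_pdivrMr ?cut_den_gt0// mul1r lerDl sqr_ge0. Qed.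

Lemma max0_cut e y : - e <= y -> Num.max 0 (- y - e) = 0.
Proof. by move=> ey; rewrite max_l// subr_le0 lerNl. Qed.

Lemma cut_eq0 e y : - e <= y -> cut e y = 0.
Proof. by move=> ey; rewrite /cut max0_cut// expr0n mul0r. Qed.

Lemma dcut_eq0 e y : - e <= y -> dcut e y = 0.
Proof. by move=> ey; rewrite /dcut max0_cut// mulr0 mul0r oppr0 mul0r. Qed.

Lemma dcut_le0 e y : 0 < e -> dcut e y <= 0.
Proof.
move=> e0; rewrite /dcut mulNr oppr_le0 divr_ge0 ?sqr_ge0// mulr_ge0 ?sqr_ge0//.
by rewrite mulr_ge0// le_max lexx.
Qed.

(** With [m = - y - e > 0], multiply [(m + e)^2 <= 2 (m^2 + e^2)] by [2 m e <= m^2 + e^2]. The slope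
    alone is of order 1/e; the weight [y ^+ 2] brings it down to order e. *)
Lemma dcut_sqr e y : 0 < e -> `|dcut e y| * y ^+ 2 <= 2 * e.
Proof.
move=> e0; rewrite ler0_norm ?dcut_le0// /dcut -mulNr opprK.
case: (ltP 0 (- y - e)) => [m0|_]; last by rewrite mulr0 !mul0r mulr_ge0// ltW.
have -> : y ^+ 2 = ((- y - e) + e) ^+ 2 by rewrite subrK sqrrN.
move: (- y - e) m0 => m m0.
have d0 : 0 < m ^+ 2 + e ^+ 2 by rewrite addr_gt0// exprn_gt0.
rewrite mulrAC ler_pdivrMr ?exprn_gt0//.
have s0 : 0 <= (m - e) ^+ 2 := sqr_ge0 _.
have h1 : (m + e) ^+ 2 <= 2 * (m ^+ 2 + e ^+ 2) by nra.
have h2 : 2 * (m * e) <= m ^+ 2 + e ^+ 2 by nra.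
have -> : 2 * m * e ^+ 2 * (m + e) ^+ 2 = e * ((2 * (m * e)) * (m + e) ^+ 2) by ring.
have -> : 2 * e * (m ^+ 2 + e ^+ 2) ^+ 2 = e * ((m ^+ 2 + e ^+ 2) * (2 * (m ^+ 2 + e ^+ 2))) by ring.
rewrite ler_pM2l// ler_pM ?sqr_ge0// mulr_ge0// mulr_ge0// ltW//.
Qed.

Lemma cvg_cut (y : R) (e : R^nat) : y < 0 -> e n @[n --> \oo] --> (0 : R) ->
  cut (e n) y @[n --> \oo] --> (1 : R).
Proof.
move=> y0 e0; rewrite /cut.
have ce : - y - e n @[n --> \oo] --> - y.
  by rewrite -[X in _ --> X]subr0; apply: cvgB; [exact: cvg_cst|exact: e0].
have cm : Num.max 0 (- y - e n) @[n --> \oo] --> - y.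
  have E : Num.max 0 (- y) = - y by rewrite max_r// oppr_ge0 ltW.
  have := @continuous_max0 R (- y); rewrite /continuous_at E => cM.
  exact: (cvg_comp _ _ ce cM).
have cm2 : Num.max 0 (- y - e n) ^+ 2 @[n --> \oo] --> y ^+ 2.
  by rewrite -sqrrN !expr2; exact: cvgM.
rewrite -[X in _ --> X](mulfV (_ : y ^+ 2 != 0)) ?sqrf_eq0 ?lt_eqF//.
apply: cvgM => //; apply: cvgV; first by rewrite sqrf_eq0 lt_eqF.
rewrite -[X in _ --> X]addr0; apply: cvgD => //.
by rewrite -(mulr0 0); apply: cvgM.
Qed.

Lemma continuous_cut e : 0 < e -> continuous (cut e).
Proof.
move=> e0 y; apply: differentiable_continuous; apply/derivable1_diffP.
by case: (is_derive_cut y e0).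
Qed.

Lemma continuous_dcut e : 0 < e -> continuous (dcut e).
Proof.
move=> e0.
have cm : continuous (fun y : R => Num.max 0 (- y - e)).
  move=> y; apply: (@continuous_comp _ _ _ (fun y : R => - y - e) (Num.max 0)).
    by apply: cvgB; [apply: cvgN; exact: cvg_id|exact: cvg_cst].
  exact: continuous_max0.
have cq : continuous (fun y : R => Num.max 0 (- y - e) ^+ 2 + e ^+ 2).
  by apply: continuous_funD; [apply: continuous_funM|exact: cst_continuous].
rewrite (_ : dcut e = fun y => - (2 * e ^+ 2) * (Num.max 0 (- y - e) *
   ((Num.max 0 (- y - e) ^+ 2 + e ^+ 2) * (Num.max 0 (- y - e) ^+ 2 + e ^+ 2))^-1)); last first.
  by apply/funext => y; rewrite /dcut expr2 !mulNr; congr (- _); ring.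
apply: continuous_funM; first exact: cst_continuous.
apply: continuous_funM; first exact: cm.
apply: continuous_funV; last by move=> y; rewrite mulf_neq0// gt_eqF// cut_den_gt0.
exact: continuous_funM.
Qed.

End Cutoff.

Lemma Rintegral_bigsum d (T : measurableType d) (R : realType)
    (mu : {measure set T -> \bar R}) (D : set T) (I : Type) (r : seq I) (F : I -> T -> R) :
  measurable D -> (forall i, mu.-integrable D (EFin \o F i)) ->
  mu.-integrable D (EFin \o (fun x => \sum_(i <- r) F i x)) /\
  \int[mu]_(x in D) (\sum_(i <- r) F i x) = \sum_(i <- r) \int[mu]_(x in D) F i x.
Proof.
move=> mD intF; elim: r => [|i r [IH1 IH2]].
  rewrite (_ : (fun x => _) = fun=> 0); last by apply/funext => x; rewrite big_nil.
  by rewrite big_nil Rintegral_cst// mul0r; split=> //; exact: integrable0.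
rewrite (_ : (fun x => _) = fun x => F i x + \sum_(i <- r) F i x); last first.
  by apply/funext => x; rewrite big_cons.
split; last by rewrite RintegralD// IH2 big_cons.
by apply: (integrableD mD (intF i) IH1).
Qed.

Lemma near0_continuous {R : realType} {T : topologicalType} (f : T -> R) x :
  (\forall y \near x, f y = 0) -> {for x, continuous f}.
Proof.
move=> f0; rewrite /prop_for /continuous_at (nbhs_singleton f0).
exact: cvg_near_cst.
Qed.

Lemma continuous_at_sum {R : realType} {T : topologicalType} (I : Type) (r : seq I)
    (F : I -> T -> R) x :
  (forall i, {for x, continuous (F i)}) ->
  {for x, continuous (fun x => \sum_(i <- r) F i x)}.
Proof.
move=> cF; rewrite /prop_for /continuous_at; elim: r => [|i r IH].
  have -> : (fun x => \sum_(i <- [::]) F i x) = fun=> 0.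
    by apply/funext => y; rewrite big_nil.
  by rewrite big_nil; exact: cvg_cst.
rewrite big_cons.
have -> : (fun x => \sum_(j <- i :: r) F j x) = (fun x => F i x + \sum_(j <- r) F j x).
  by apply/funext => y; rewrite big_cons.
exact: (cvgD (cF i) IH).
Qed.

(** Only unmixed second derivatives appear: these are what the Laplacian and integration by parts
    along coordinate lines see. *)
Definition C2_on {R : realType} {N : nat} (Om : set 'rV[R]_N) (v : 'rV[R]_N -> R) :=
  forall x, Om x -> forall i, [/\ derivable v x (delta_mx 0 i),
    derivable (partial i v) x (delta_mx 0 i), {for x, continuous (partial i v)} &
    {for x, continuous (partial i (partial i v))}].

Lemma C2_C2_on {R : realType} {N : nat} (Om : set 'rV[R]_N) (v : 'rV[R]_N -> R) :
  C2 v -> C2_on Om v.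
Proof.
move=> Cv x _ i; split; [exact: (Cv.1.2 i).1|exact: ((Cv.2 i).2 i).1|
  exact: (Cv.1.2 i).2|exact: ((Cv.2 i).2 i).2].
Qed.

(** * Integrals over the domain against a cut-off *)

Section Domain.
Context {R : realType} {N : nat}.
Local Notation E := 'rV[R]_N.
Variable Om : set E.
Hypotheses (oOm : open Om) (bOm : bounded_set Om).
Local Notation mu := (lebesgue_tuple N).
Local Notation D := (pt @^-1` Om).
Implicit Types (f v w : E -> R).

Lemma domain_measurable : measurable D.
Proof. exact: measurable_point_preimage. Qed.

Lemma domain_lty : (mu D < +oo)%E.
Proof. by apply: bounded_preimage_lty => //; exact: domain_measurable. Qed.

Lemma domain_integrable f M : (forall x, Om x -> {for x, continuous f}) ->
  (forall x, Om x -> `|f x| <= M) -> mu.-integrable D (EFin \o (f \o pt)).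
Proof.
move=> cf fM; apply: measurable_bounded_integrable.
- exact: domain_measurable.
- exact: domain_lty.
- exact: measurable_fun_point.
- by exists M; split; [exact: num_real|move=> m Mm t Dt; exact: le_trans (fM _ Dt) (ltW Mm)].
Qed.

Lemma domain_cst_integrable (c : R) : mu.-integrable D (EFin \o (fun=> c)).
Proof.
apply: (@domain_integrable (fun=> c) `|c|) => // x _; exact: cst_continuous.
Qed.

Lemma Rintegral_domain_cst (c : R) : \int[mu]_(t in D) c = c * volume Om.
Proof. by rewrite Rintegral_cst//; exact: domain_measurable. Qed.

Variable h : E -> R.
Hypothesis dh : defining_function Om h.
Let Ch : C2 h := defining_C2 dh.

Lemma notin_domain_ge0 x : ~ Om x -> 0 <= h x.
Proof. by move=> nOx; rewrite leNgt; apply/negP => /(defining_lt0 dh x).2. Qed.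

(** [w] is arbitrary outside [Om]; there [h >= 0 > - e], so the product vanishes on a whole
    neighbourhood. *)
Lemma cutoff_continuous (k : R -> R) e w : 0 < e -> continuous k ->
  (forall y, - e <= y -> k y = 0) -> (forall x, Om x -> {for x, continuous w}) ->
  continuous (fun x => k (h x) * w x).
Proof.
move=> e0 ck k0 cw x; have [Ox|nOx] := pselect (Om x).
  apply: (cvgM _ (cw x Ox)); apply: continuous_comp; last exact: ck.
  exact: Ch.1.1.
apply: near0_continuous.
have hx : - e < h x by rewrite (lt_le_trans _ (notin_domain_ge0 nOx))// oppr_lt0.
apply: filterS (near_continuous_gt (Ch.1.1 x) hx) => y hy.
by rewrite k0 ?mul0r// ltW.
Qed.

Lemma cutoff_support : exists B, forall (k : R -> R) e w, 0 < e ->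
  (forall y, - e <= y -> k y = 0) -> coord_support B (fun x => k (h x) * w x).
Proof.
have [M [_ OM]] := bOm; exists (M + 1) => k e w e0 k0 x j Bx.
have nOx : ~ Om x.
  move=> Ox; have /= : `|x| <= M + 1 by apply: OM Ox; rewrite ltrDl.
  by apply/negP; rewrite -ltNge; exact: lt_le_trans Bx (normr_coord_le _ _).
by rewrite k0 ?mul0r// (le_trans _ (notin_domain_ge0 nOx))// oppr_le0 ltW.
Qed.

Lemma cutoff_integral (k : R -> R) e w : 0 < e -> (forall y, - e <= y -> k y = 0) ->
  \int[mu]_(t in D) (k (h (pt t)) * w (pt t)) = \int[mu]_t (k (h (pt t)) * w (pt t)).
Proof.
move=> e0 k0; rewrite Rintegral_mkcond; apply: eq_Rintegral => t _.
rewrite patchE; case: ifPn => //; rewrite notin_setE => /notin_domain_ge0 ht.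
by rewrite k0 ?mul0r// (le_trans _ ht)// oppr_le0 ltW.
Qed.

Lemma cutoff_integrable (k : R -> R) e w : 0 < e -> continuous k ->
  (forall y, - e <= y -> k y = 0) -> (forall x, Om x -> {for x, continuous w}) ->
  mu.-integrable D (EFin \o (fun t => k (h (pt t)) * w (pt t))).
Proof.
move=> e0 ck k0 cw; have [B supp] := cutoff_support.
apply: (integrableS measurableT domain_measurable) => //.
apply: (coord_support_integrable (B := B) (f := fun x => k (h x) * w x)).
  exact: supp e0 k0.
exact: cutoff_continuous e0 ck k0 cw.
Qed.

Lemma integral_cut_laplacian e v : 0 < e ->
  C2_on Om v ->
  \int[mu]_(t in D) (cut e (h (pt t)) * laplacian v (pt t)) =
  - \int[mu]_(t in D) (dcut e (h (pt t)) * dot (gradient h (pt t)) (gradient v (pt t))).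
Proof.
move=> e0 Cv.
have ddv x i : Om x -> derivable (partial i v) x (delta_mx 0 i) by move=> /Cv/(_ i)[].
have cv x i : Om x -> {for x, continuous (partial i v)} by move=> /Cv/(_ i)[].
have ccv x i : Om x -> {for x, continuous (partial i (partial i v))} by move=> /Cv/(_ i)[].
rewrite (cutoff_integral (k := cut e) (laplacian v) e0)//; last exact: cut_eq0.
rewrite (cutoff_integral (k := dcut e) (fun x => dot (gradient h x) (gradient v x)) e0)//; last exact: dcut_eq0.
have [B supp] := cutoff_support.
pose G1 i x := cut e (h x) * partial i (partial i v) x.
pose G2 i x := dcut e (h x) * (partial i h x * partial i v x).
have intG1 i : mu.-integrable setT (EFin \o (G1 i \o pt)).
  apply: (coord_support_integrable (B := B)); first exact: supp e0 (@cut_eq0 _ e).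
  apply: cutoff_continuous e0 (continuous_cut e0) (@cut_eq0 _ e) _ => x Ox; exact: ccv.
have intG2 i : mu.-integrable setT (EFin \o (G2 i \o pt)).
  apply: (coord_support_integrable (B := B)); first exact: supp e0 (@dcut_eq0 _ e).
  apply: cutoff_continuous e0 (continuous_dcut e0) (@dcut_eq0 _ e) _ => x Ox.
  by apply: (cvgM _ (cv x i Ox)); exact: (Ch.1.2 i).2.
have G0 i : \int[mu]_t (G1 i (pt t)) + \int[mu]_t (G2 i (pt t)) = 0.
  (* [F] vanishes near every point outside [Om], so it is differentiable in direction [i] on the
     whole space and [integral_partial] applies to it. *)
  pose F x := cut e (h x) * partial i v x.
  have dF x : is_derive x (delta_mx 0 i) F (G1 i x + G2 i x).
    have [Ox|nOx] := pselect (Om x).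
      have dch := is_derive_comp_partial (fun y => is_derive_cut y e0) ((Ch.1.2 i).1 x).
      have ddvx : is_derive x (delta_mx 0 i) (partial i v) (partial i (partial i v) x).
        exact/derivableP/ddv.
      have := is_deriveM dch ddvx.
      move=> /is_derive_eq; apply; rewrite /GRing.scale/= /G1 /G2; congr (_ + _).
      by rewrite mulrC mulrA.
    have hx : - e < h x by rewrite (lt_le_trans _ (notin_domain_ge0 nOx))// oppr_lt0.
    rewrite /G1 /G2 cut_eq0 ?ltW// dcut_eq0 ?ltW// !mul0r addr0.
    have dc : is_derive x (delta_mx 0 i) (cst (0 : R)) 0 by exact: is_derive_cst.
    apply: near_eq_is_derive dc.
    apply: filterS (near_continuous_gt (Ch.1.1 x) hx) => y hy.
    by rewrite /F cut_eq0 ?mul0r// ltW.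
  have pF : partial i F = fun x => G1 i x + G2 i x.
    by apply/funext => x; exact: (@derive_val _ _ _ _ _ _ _ (dF x)).
  rewrite -RintegralD// /Rintegral.
  have := @integral_partial R N F i B.
  rewrite pF => -> //.
  - apply: continuous_funD.
      apply: cutoff_continuous e0 (continuous_cut e0) (@cut_eq0 _ e) _ => x Ox; exact: ccv.
    apply: cutoff_continuous e0 (continuous_dcut e0) (@dcut_eq0 _ e) _ => x Ox.
    by apply: (cvgM _ (cv x i Ox)); exact: (Ch.1.2 i).2.
  - exact: supp e0 (@cut_eq0 _ e).
  - exact: intG1.
  - exact: intG2.
have [_ E1] := Rintegral_bigsum (index_enum 'I_N) measurableT intG1.
have [_ E2] := Rintegral_bigsum (index_enum 'I_N) measurableT intG2.
apply/eqP; rewrite -addr_eq0; apply/eqP.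
rewrite (_ : \int[mu]_t (cut _ _ * _) = \sum_i \int[mu]_t (G1 i (pt t))); last first.
  by rewrite -E1; apply: eq_Rintegral => t _; rewrite mulr_sumr.
rewrite (_ : \int[mu]_t (dcut _ _ * _) = \sum_i \int[mu]_t (G2 i (pt t))); last first.
  by rewrite -E2; apply: eq_Rintegral => t _; rewrite mulr_sumr; apply: eq_bigr => i _; rewrite !mxE.
by rewrite -big_split/= big1// => i _; exact: G0.
Qed.
(** After integration by parts the weight [- dcut e (h x)], of order 1/e, meets the two terms of the
    hypothesis separately. Against |grad h|^2 its integral equals that of [cut e (h x)] times the
    Laplacian of [h], hence is at most [K * volume Om] for every [e]; against h^2 it is pointwise at
    most [2 * e] by [dcut_sqr]. *)
Lemma cut_laplacian_bound K e v rho C : 0 < e ->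
  (forall x, Om x -> `|laplacian h x| <= K) ->
  C2_on Om v ->
  0 <= rho -> 0 <= C ->
  (forall x, Om x -> `|dot (gradient h x) (gradient v x)| <=
     rho * dot (gradient h x) (gradient h x) + C * h x ^+ 2) ->
  `|\int[mu]_(t in D) (cut e (h (pt t)) * laplacian v (pt t))| <=
  (rho * K + C * (2 * e)) * volume Om.
Proof.
move=> e0 hK Cv rho0 C0 vC.
rewrite (integral_cut_laplacian e0 Cv) normrN.
have mD := domain_measurable.
pose gh x := dot (gradient h x) (gradient h x).
have cgh : continuous gh by apply: continuous_dot => i; exact: continuous_gradient Ch.1.
pose gv x := \sum_i partial i h x * partial i v x.
have gvE x : dot (gradient h x) (gradient v x) = gv x.
  by apply: eq_bigr => i _; rewrite !mxE.
have cgv x : Om x -> {for x, continuous gv}.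
  move=> Ox; apply: continuous_at_sum => i; have [_ _ cvi _] := Cv x Ox i.
  exact: (cvgM ((Ch.1.2 i).2 x) cvi).
have int1 : mu.-integrable D (EFin \o (fun t => dcut e (h (pt t)) *
    dot (gradient h (pt t)) (gradient v (pt t)))).
  rewrite (_ : (fun t => _) = fun t => dcut e (h (pt t)) * gv (pt t)); last first.
    by apply/funext => t; rewrite gvE.
  exact: cutoff_integrable e0 (continuous_dcut e0) (@dcut_eq0 _ e) cgv.
have int2 : mu.-integrable D (EFin \o (fun t => dcut e (h (pt t)) * gh (pt t))).
  by apply: (cutoff_integrable (w := gh) e0 (continuous_dcut e0) (@dcut_eq0 _ e)) => x _; exact: cgh.
have int3 : mu.-integrable D (EFin \o (fun t => cut e (h (pt t)) * laplacian h (pt t))).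
  apply: (cutoff_integrable (w := laplacian h) e0 (continuous_cut e0) (@cut_eq0 _ e)) => x _.
  exact: continuous_laplacian.
have int4 : mu.-integrable D (EFin \o (fun t => - rho * (dcut e (h (pt t)) * gh (pt t)))).
  exact: (integrableZl mD (- rho) int2).
have Eh : \int[mu]_(t in D) (dcut e (h (pt t)) * gh (pt t)) =
    - \int[mu]_(t in D) (cut e (h (pt t)) * laplacian h (pt t)).
  by rewrite (integral_cut_laplacian e0 (C2_C2_on Ch)) opprK.
apply: le_trans (le_normr_Rintegral mD int1) _.
apply: (@le_trans _ _ (\int[mu]_(t in D) (- rho * (dcut e (h (pt t)) * gh (pt t)) + C * (2 * e)))).
  apply: le_Rintegral => //.
  - exact: integrable_norm int1.
  - exact: (integrableD mD int4 (domain_cst_integrable _)).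
  move=> t Dt; have dn := @dcut_le0 R e (h (pt t)) e0.
  have ds := @dcut_sqr R e (h (pt t)) e0.
  rewrite normrM; apply: le_trans (ler_wpM2l (normr_ge0 _) (vC _ Dt)) _.
  rewrite mulrDr lerD//; last by rewrite mulrCA ler_wpM2l.
  by rewrite ler0_norm// /gh mulrCA mulNr mulrN mulNr.
rewrite RintegralD//; last exact: domain_cst_integrable.
rewrite RintegralZl// Eh Rintegral_domain_cst mulrNN (mulrDl (rho * K)) lerD2r -mulrA ler_wpM2l//.
rewrite -Rintegral_domain_cst; apply: le_Rintegral => //; first exact: domain_cst_integrable.
move=> t Dt; apply: le_trans (ler_norm _) _; rewrite normrM ger0_norm ?cut_ge0//.
by rewrite -[leRHS]mul1r ler_pM ?cut_ge0// ?cut_le1// hK.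
Qed.

End Domain.

(** * Continuity on cylinders *)

Lemma continuous_pairl {X Y : topologicalType} (y : Y) : continuous (fun x : X => (x, y)).
Proof.
move=> x A [[/= C B] [Cx By] CB]; apply: filterS Cx => z Cz; apply: CB; split=> //.
exact: nbhs_singleton.
Qed.

Lemma continuous_pairr {X Y : topologicalType} (x : X) : continuous (fun y : Y => (x, y)).
Proof.
move=> y A [[/= C B] [Cx By] CB]; apply: filterS By => z Bz; apply: CB; split=> //.
exact: nbhs_singleton.
Qed.

(** Extracts plain continuity in space alone, or in time alone, from joint continuity on a cylinder,
    as long as the path stays in the set. *)
Lemma within_continuous_path {T T' U : topologicalType} (S : set T) (F : T -> U)
    (c : T' -> T) x : {within S, continuous F} -> {for x, continuous c} ->
  (\forall y \near x, S (c y)) -> {for x, continuous (fun y => F (c y))}.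
Proof.
move=> cF cc Sc A FA.
have nA : nbhs (c x) (fun z => S z -> A (F z)).
  exact: (subspace_continuousP S F).1 cF _ (nbhs_singleton Sc) A FA.
by apply: filterS (filterI Sc (cc _ nA)) => y [Sy Ay]; exact: Ay.
Qed.

Lemma within_continuous_add {T : topologicalType} {R : realType} (A : set T) (f g : T -> R) :
  {within A, continuous f} -> {within A, continuous g} -> {within A, continuous (fun x => f x + g x)}.
Proof. exact: continuous_funD. Qed.

Lemma within_continuous_mul {T : topologicalType} {R : realType} (A : set T) (f g : T -> R) :
  {within A, continuous f} -> {within A, continuous g} -> {within A, continuous (fun x => f x * g x)}.
Proof. exact: continuous_funM. Qed.

Lemma within_continuous_sum {T : topologicalType} {R : realType} (A : set T)
    (I : Type) (r : seq I) (F : I -> T -> R) :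
  (forall i, {within A, continuous (F i)}) ->
  {within A, continuous (fun x => \sum_(i <- r) F i x)}.
Proof. exact: continuous_fun_sum. Qed.

Lemma compact_bounded_fun {T : topologicalType} {R : realType} (A : set T) (f : T -> R) :
  compact A -> {within A, continuous f} -> exists2 M, 0 < M & forall x, A x -> `|f x| <= M.
Proof.
move=> cA cf; have [->|A0] := eqVneq A set0; first by exists 1.
have /set0P A0' := A0.
have [|c _ Hc] := @compact_EVT_max _ _ (fun x => `|f x|) A A0' cA.
  by move=> x; apply: continuous_comp; [exact: cf|exact: norm_continuous].
by exists (`|f c| + 1) => [|x Ax]; [rewrite ltr_wpDl|rewrite ler_wpDr// Hc// inE].
Qed.

(** On negative reals [powR] is constantly 1. That case matters because the sign of [Phi] is not
    prescribed. *)
Lemma continuous_powR_neq0 {R : realType} (a x : R) : x != 0 -> {for x, continuous (@powR R ^~ a)}.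
Proof.
move=> x0; have [x_lt0|x_gt0|x_eq0] := ltgtP x 0.
- rewrite /prop_for /continuous_at lt0_powR1//; apply: cvg_near_cst.
  by near=> y; rewrite lt0_powR1//; near: y; exact: lt_nbhsl.
- apply: differentiable_continuous; apply/derivable1_diffP; apply: derivable_powR.
  by rewrite in_itv/= x_gt0.
- by rewrite x_eq0 eqxx in x0.
Unshelve. all: by end_near. Qed.

Lemma ereal_real_between {R : realType} (x : R) (T : \bar R) : (x%:E < T)%E ->
  exists2 b : R, x < b & (b%:E < T)%E.
Proof.
case: T => [r| |]; rewrite ?lte_fin => xr.
- by exists ((x + r) / 2); rewrite ?lte_fin; lra.
- by exists (x + 1); rewrite ?ltrDl// ltry.
- by [].
Qed.

Lemma normr_powR_le {R : realType} (a v M : R) :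
  0 <= a -> 0 < v -> `|v| <= M -> `|v `^ a| <= M `^ a.
Proof.
move=> a0 v0; rewrite gtr0_norm// => vM; rewrite ger0_norm ?powR_ge0//.
by apply: ge0_ler_powR => //; rewrite nnegrE ltW// (lt_le_trans v0).
Qed.

Lemma continuous_near_eq {T U : topologicalType} (f g : T -> U) x :
  (\forall y \near x, f y = g y) -> {for x, continuous f} -> {for x, continuous g}.
Proof.
move=> fg cf; rewrite /prop_for /continuous_at -(nbhs_singleton fg).
by apply: cvg_trans cf; exact: near_eq_cvg.
Qed.

Lemma near_within_lt {T : topologicalType} {R : realType} (A : set T) (f : T -> R) x c :
  {within A, continuous f} -> A x -> f x < c -> \forall y \near x, A y -> f y < c.
Proof.
move=> cf Ax fc; exact: (subspace_continuousP A f).1 cf x Ax [set y | y < c] (lt_nbhsl fc).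
Qed.

Lemma near_within_gt {T : topologicalType} {R : realType} (A : set T) (f : T -> R) x c :
  {within A, continuous f} -> A x -> c < f x -> \forall y \near x, A y -> c < f y.
Proof.
move=> cf Ax fc; exact: (subspace_continuousP A f).1 cf x Ax [set y | c < y] (lt_nbhsr fc).
Qed.

Lemma continuous_funB {T : topologicalType} {R : realType} (f g : T -> R) :
  continuous f -> continuous g -> continuous (fun x => f x - g x).
Proof. by move=> cf cg x; exact: (cvgB (cf x) (cg x)). Qed.

(** * Solutions on cylinders: integrals of powers and the normal derivative *)

Section Solution.
Context {R : realType} {N : nat}.
Local Notation E := 'rV[R]_N.
Variables (Om : set E) (p r gamma : R) (phi : R -> R) (u0 : E -> R) (T : \bar R).
Variables (u : E -> R -> R) (h : E -> R).
Hypotheses (oOm : open Om) (bOm : bounded_set Om) (dh : defining_function Om h).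
Hypothesis (sol : classical_solution Om p r gamma phi u0 T u).
Local Notation mu := (lebesgue_tuple N).
Local Notation D := (pt @^-1` Om).
Implicit Types (a b t e : R) (x y : E).

Lemma closure_compact : compact (closure Om).
Proof.
by apply: bounded_closed_compact; [exact: bounded_set_closure|exact: closed_closure].
Qed.

Lemma cylinder_compact a b : compact (closure Om `*` `[a, b]%classic).
Proof. by apply: compact_setX; [exact: closure_compact|exact: segment_compact]. Qed.

Lemma itv_time_co a b t : 0 <= a -> (b%:E < T)%E -> t \in `[a, b] -> time_co T t.
Proof.
move=> a0 bT; rewrite in_itv/= => /andP[at_ tb]; split; first exact: le_trans at_.
by apply: le_lt_trans bT; rewrite lee_fin.
Qed.

Lemma itv_time_oo a b t : 0 < a -> (b%:E < T)%E -> t \in `[a, b] -> time_oo T t.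
Proof.
move=> a0 bT; rewrite in_itv/= => /andP[at_ tb]; split; first exact: lt_le_trans at_.
by apply: le_lt_trans bT; rewrite lee_fin.
Qed.

Lemma solution_bounded b : (b%:E < T)%E ->
  exists2 M, 0 < M & forall x t, closure Om x -> t \in `[0, b] -> `|u x t| <= M.
Proof.
move=> bT; have [|M M0 HM] := compact_bounded_fun (@cylinder_compact 0 b) (f := fun z => u z.1 z.2).
  apply: continuous_subspaceW (solution_continuous sol) => -[x t] /= [clx t0b].
  by split=> //; exact: itv_time_co bT t0b.
by exists M => // x t clx t0b; exact: (HM (x, t)).
Qed.

Lemma near_time_oo t : time_oo T t -> \forall s \near t, time_oo T s.
Proof.
move=> [t0 tT]; have [b tb bT] := ereal_real_between tT.
near=> s; split; first by near: s; exact: lt_nbhsr.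
by apply: lt_trans bT; rewrite lte_fin; near: s; exact: lt_nbhsl.
Unshelve. all: by end_near. Qed.

Lemma slice_continuous {U : topologicalType} (S : set R) (F : E * R -> U) x t : {within Om `*` S, continuous F} ->
  Om x -> S t -> {for x, continuous (fun y => F (y, t))}.
Proof.
move=> cF Ox St; apply: (within_continuous_path (c := fun y => (y, t)) cF).
  exact: continuous_pairl.
by apply: filterS (open_nbhs_nbhs (conj oOm Ox)).
Qed.

Lemma solution_space_continuous x t : Om x -> time_co T t -> {for x, continuous (u^~ t)}.
Proof.
move=> Ox Tt; apply: (slice_continuous (S := time_co T) (F := fun z => u z.1 z.2)) => //.
apply: continuous_subspaceW (solution_continuous sol) => -[y s] /= [Oy Ts].
by split=> //; exact: subset_closure.
Qed.

Lemma solution_abs_continuous x t : Om x -> (`|t|%:E < T)%E ->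
  {for t, continuous (fun s : R => u x `|s|)}.
Proof.
move=> Ox tT; have [b tb bT] := ereal_real_between tT.
apply: (within_continuous_path (c := fun s : R => (x, `|s|)) (solution_continuous sol)).
  apply: (@continuous_comp _ _ _ (fun s : R => `|s|) (fun s => (x, s))).
    exact: norm_continuous.
  exact: continuous_pairr.
apply: filterS (near_continuous_lt (@norm_continuous _ _ t) tb) => s sb.
split; first exact: subset_closure.
by split=> //=; apply: lt_trans bT; rewrite lte_fin.
Qed.

Lemma solution_pos x t : Om x -> time_co T t -> 0 < u x t.
Proof. exact: (solution_positive sol). Qed.

(** The even reflection in time gives the integral a meaning on both sides of 0, so that continuity
    at the initial time is ordinary two-sided continuity on an open interval. *)
Definition power_integral a t : R := \int[mu]_(z in D) (u (pt z) `|t| `^ a).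

Lemma power_space_continuous a x t : Om x -> time_co T t ->
  {for x, continuous (fun y => u y t `^ a)}.
Proof.
move=> Ox Tt; apply: (@continuous_comp _ _ _ (u^~ t) (@powR R ^~ a)).
  exact: solution_space_continuous.
by apply: continuous_powR_neq0; rewrite gt_eqF// solution_pos.
Qed.

Lemma power_integrable a t : 0 <= a -> time_co T t ->
  mu.-integrable D (EFin \o (fun z => u (pt z) t `^ a)).
Proof.
move=> a0 Tt; have [M M0 HM] := solution_bounded Tt.2.
apply: (domain_integrable oOm bOm (f := fun x => u x t `^ a) (M := M `^ a)) => x Ox.
  exact: power_space_continuous.
apply: normr_powR_le => //; first exact: solution_pos.
by apply: HM; [exact: subset_closure|rewrite in_itv/= lexx (proj1 Tt)].
Qed.

Lemma power_integral_continuous a t : 0 <= a -> (`|t|%:E < T)%E ->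
  {for t, continuous (power_integral a)}.
Proof.
move=> a0 tT; have [b tb bT] := ereal_real_between tT.
have [M M0 HM] := solution_bounded bT.
have Ico s : s \in `]- b, b[ -> time_co T `|s|.
  rewrite in_itv/= -ltr_norml => sb; split => //.
  by apply: lt_trans bT; rewrite lte_fin.
have tI : t \in `]- b, b[ by rewrite in_itv/= -ltr_norml.
have := @continuity_under_integral R _ _ mu (fun t z => u (pt z) `|t| `^ a) D
  (domain_measurable oOm) (- b) b _ _ (fun=> M `^ a) (domain_cst_integrable oOm bOm _) _.
apply.
- by move=> s /Ico Ts; exact: power_integrable.
- apply: aeW => z Dz s; rewrite inE => /Ico Ts.
  apply: (@continuous_comp _ _ _ (fun s : R => u (pt z) `|s|) (@powR R ^~ a)).
    exact: solution_abs_continuous Ts.2.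
  by apply: continuous_powR_neq0; rewrite gt_eqF// solution_pos.
- move=> s sI; have Ts := Ico _ sI; apply: aeW => z Dz.
  apply: normr_powR_le => //; first exact: solution_pos.
  apply: HM; first exact: subset_closure.
  by have := sI; rewrite /= in_itv/= -ltr_norml => /ltW; rewrite in_itv/= normr_ge0.
- by rewrite inE.
Qed.

Lemma solution_C2_on t : time_oo T t -> C2_on Om (u^~ t).
Proof.
move=> Tt x Ox i; have [G cG [Ggrad _]] := solution_neumann sol; split.
- exact: (solution_derivable_space sol).
- exact: (solution_derivable_space2 sol).
(* Continuity of the first derivatives is available only through their extension [G], which agrees
   with the gradient near [x]. *)
- have cGi : {for x, continuous (fun y => G (y, t) 0 i)}.
    apply: (@continuous_comp _ _ _ (fun y => G (y, t)) (fun v : E => v 0 i)).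
      apply: (slice_continuous (S := time_oo T)) => //.
      by apply: continuous_subspaceW cG => -[y s] [Oy Ts]; split=> //; exact: subset_closure.
    exact: coord_continuous.
  apply: continuous_near_eq cGi.
  by apply: filterS (open_nbhs_nbhs (conj oOm Ox)) => y Oy; rewrite Ggrad// mxE.
- exact: (@slice_continuous R (time_oo T) (fun z => partial i (partial i (u^~ z.2)) z.1) x t
    (@solution_continuous_space2 _ _ _ _ _ _ _ _ _ _ sol i i) Ox Tt).
Qed.

(** At a boundary point the left-hand side vanishes by the Neumann condition while |grad h|^2 > 0,
    so the strict inequality persists nearby for every [C >= 0]; away from the boundary h^2 is
    bounded below and a large [C] does it. Compactness makes [C] uniform. Times stay away from 0
    because [G] extends the gradient for positive times only. *)
Lemma normal_derivative_small rho a b : 0 < rho -> 0 < a -> (b%:E < T)%E ->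
  exists2 C, 0 <= C & forall x t, Om x -> t \in `[a, b] ->
    `|dot (gradient h x) (gradient (u^~ t) x)| <=
      rho * dot (gradient h x) (gradient h x) + C * h x ^+ 2.
Proof.
move=> rho0 a0 bT; have [G cG [Ggrad Gnu]] := solution_neumann sol.
pose q (z : E * R) : R := `|dot (gradient h z.1) (G z)| - rho * dot (gradient h z.1) (gradient h z.1).
have cq : {within closure Om `*` time_oo T, continuous q}.
  have cgh i : {within closure Om `*` time_oo T, continuous (fun z : E * R => gradient h z.1 0 i)}.
    apply: continuous_subspaceT => z.
    apply: (@continuous_comp _ _ _ fst (fun y => gradient h y 0 i)); first exact: cvg_fst.
    exact: (@continuous_gradient R N h i (defining_C2 dh).1).
  apply: within_continuous_add.
    move=> z; apply: (@continuous_comp _ _ _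
      (fun z : subspace _ => dot (gradient h z.1) (G z)) (fun x : R => `|x|)).
      apply: within_continuous_sum => i; apply: within_continuous_mul; first exact: cgh.
      move=> y; apply: (@continuous_comp _ _ _ (G : subspace _ -> E) (fun v : E => v 0 i)).
        exact: cG.
      exact: coord_continuous.
    exact: norm_continuous.
  rewrite (_ : (fun z => _) = fun z => - rho * dot (gradient h z.1) (gradient h z.1)); last first.
    by apply/funext => z; rewrite mulNr.
  apply: within_continuous_mul; first by apply: continuous_subspaceT => z; exact: cst_continuous.
  by apply: within_continuous_sum => i; exact: within_continuous_mul.
pose K := closure Om `*` `[a, b]%classic.
have KT z : K z -> (closure Om `*` time_oo T) z.
  by move=> [clx tab]; split=> //; exact: itv_time_oo a0 bT tab.
(* In this form of compactness the constant [C], tending to [+oo], is the parameter; this replaces a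
   maximum over a finite subcover. *)
have nc : near_covering_within K by apply/near_covering_withinP/compact_near_coveringP/cylinder_compact.
have [C [C0 HC]] : exists C, 0 <= C /\ forall z, K z -> q z <= C * h z.1 ^+ 2.
  have loc z : K z -> exists c0, nbhs z (fun w => K w -> forall C, c0 <= C ->
      0 <= C /\ q w <= C * h w.1 ^+ 2).
    move=> Kz; have nq c : q z < c -> nbhs z (fun w => K w -> q w < c).
      move=> qc; have := near_within_lt cq (KT z Kz) qc.
      by apply: filterS => w qw /KT /qw.
    have [hz|hz] := eqVneq (h z.1) 0.
      have bdz : boundary Om z.1.
        split; first exact: Kz.1.
        by move=> /(defining_lt0 dh z.1).1; rewrite hz ltxx.
      have qz : q z < 0.
        rewrite /q dotC (defining_normal dh) ?normr0 ?sub0r ?oppr_lt0 ?mulr_gt0//.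
          exact: (defining_gradient dh).
        move=> nu nuz; case: z Kz {hz nq} bdz nuz => x t Kz bdz nuz.
        exact: Gnu bdz nuz (KT _ Kz).2.
      exists 0; apply: filterS (nq 0 qz) => w qw Kw C C0; split=> //.
      by rewrite (le_trans (ltW (qw Kw)))// mulr_ge0// sqr_ge0.
    have m0 : 0 < h z.1 ^+ 2 / 2 by rewrite divr_gt0// lt_neqAle sqr_ge0 eq_sym sqrf_eq0 hz.
    have hm : h z.1 ^+ 2 / 2 < h z.1 ^+ 2 by lra.
    have nh : nbhs z (fun w => h z.1 ^+ 2 / 2 < h w.1 ^+ 2).
      apply: (near_continuous_gt (f := fun w : E * R => h w.1 ^+ 2)) hm.
      have ch : {for z, continuous (fun w : E * R => h w.1)}.
        apply: (@continuous_comp _ _ _ fst h); first exact: cvg_fst.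
        exact: (defining_C2 dh).1.1.
      exact: (cvgM ch ch).
    exists ((`|q z| + 1) / (h z.1 ^+ 2 / 2)).
    have q1 : q z < `|q z| + 1 by rewrite (le_lt_trans (ler_norm _))// ltrDl.
    apply: filterS (filterI nh (nq _ q1)) => w [hw qw] Kw C cC.
    have C0 : 0 <= C.
      by apply: le_trans cC; rewrite divr_ge0// ?(ltW m0)// addr_ge0.
    split=> //; apply: le_trans (ltW (qw Kw)) _.
    by move: cC; rewrite ler_pdivrMr// => /le_trans; apply; rewrite ler_wpM2l// ltW.
  have : \forall C \near +oo, K `<=` (fun z => 0 <= C /\ q z <= C * h z.1 ^+ 2).
    apply: (nc R (+oo) (fun C z => 0 <= C /\ q z <= C * h z.1 ^+ 2)) => z Kz.
    have [c0 Hc0] := loc z Kz.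
    exists ((fun w => K w -> forall C, c0 <= C -> 0 <= C /\ q w <= C * h w.1 ^+ 2),
      [set C | c0 <= C]).
      by split; [exact: Hc0|exact: nbhs_pinfty_ge (num_real c0)].
    by move=> [w C] /= [Hw Cc0] Kw; exact: Hw.
  move=> /(filterI (nbhs_pinfty_ge (num_real (0 : R)))) /filter_ex[C [C0 HC]].
  by exists C; split=> // z /HC[].
exists C => // x t Ox tab.
have Kxt : K (x, t) by split; [exact: subset_closure|exact: tab].
by have := HC _ Kxt; rewrite /q /= Ggrad ?lerBlDl//; exact: itv_time_oo a0 bT tab.
Qed.

End Solution.

(** * The equation for the mean *)

(** Uniform limits of derivatives, with one approximant for each precision instead of a sequence:
    the mean value theorem for [F (t + s) - V t * s] controls the increment of [F], and passing from
    [F] to [U] costs the precision twice. *)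
Lemma is_derive_uniform_limit {R : realType} (U V : R -> R) (a b t : R) :
  a < t -> t < b -> {for t, continuous V} ->
  (forall e, 0 < e -> exists F, exists dF : R -> R, forall s, s \in `[a, b] ->
    [/\ is_derive s (1 : R) F (dF s), `|F s - U s| <= e & `|dF s - V s| <= e]) ->
  is_derive t (1 : R) U (V t).
Proof.
move=> at_ tb cV H; apply/is_deriveP => e e0.
have e20 : 0 < e / 2 by rewrite divr_gt0.
have nV : \forall s \near t, `|V s - V t| <= e / 2.
  by have /cvgrPdist_le/(_ _ e20) := cV; apply: filterS => s; rewrite distrC.
move: nV => /nbhs_ballP[d /= d0 dV].
pose d' := Num.min d (Num.min (t - a) (b - t)).
have d'0 : 0 < d' by rewrite !lt_min d0 !subr_gt0 at_ tb.
have abd s : `|s| < d' -> t + s \in `[a, b] /\ `|V (t + s) - V t| <= e / 2.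
  rewrite !lt_min => /andP[sd /andP[]]; rewrite !ltr_norml => sa sb; split.
    by rewrite in_itv/=; apply/andP; split; lra.
  by apply: dV; rewrite /ball/= opprD addrA subrr sub0r normrN.
apply/nbhs_ballP; exists d' => //= k; rewrite /ball/= sub0r normrN => kd.
have [->|k0] := eqVneq k 0; first by rewrite addr0 mulr0 subrr subr0 !normr0 mulr0.
(* Solves [(eta + e / 2) * |k| + 2 * eta = e * |k|]; the approximant therefore depends on the
   increment [k]. *)
pose eta := e / 2 * `|k| / (`|k| + 2).
have k_gt0 : 0 < `|k| by rewrite normr_gt0.
have eta0 : 0 < eta by rewrite divr_gt0 ?mulr_gt0// addr_gt0.
have [F [dF HF]] := H eta eta0.
pose g s := F (t + s) - V t * s.
have dg s : `|s| <= `|k| -> is_derive s (1 : R) g (dF (t + s) - V t).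
  move=> sk; have [_ _ _] := HF _ (abd s (le_lt_trans sk kd)).1.
  have [dFs _ _] := HF _ (abd s (le_lt_trans sk kd)).1.
  have shift : is_derive s (1 : R) (fun s => t + s) 1.
    have := is_deriveD (is_derive_cst t s (1 : R)) (is_derive_id s (1 : R)).
    by rewrite add0r.
  have d1 : is_derive s (1 : R) (fun s => F (t + s)) (dF (t + s)).
    by have := is_derive1_comp dFs shift; rewrite mulr1.
  have d2 : is_derive s (1 : R) (fun s => V t * s) (V t).
    have := is_deriveM (is_derive_cst (V t) s (1 : R)) (is_derive_id s (1 : R)).
    by rewrite scaler0 addr0 /GRing.scale/= mulr1.
  exact: is_deriveB d1 d2.
have [xi xik] := MVT_abs dg.
rewrite /g addr0 mulr0 subr0 => E.
have [xab xV] := abd xi (le_lt_trans xik kd).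
have [_ _ xF] := HF _ xab.
have [tkab _] := abd k kd.
have [_ Fk _] := HF _ tkab.
have [tab _] : t \in `[a, b] /\ True by rewrite in_itv/= !ltW.
have [_ Ft _] := HF _ tab.
have slope : `|dF (t + xi) - V t| <= eta + e / 2.
  rewrite (_ : _ - _ = (dF (t + xi) - V (t + xi)) + (V (t + xi) - V t)); last by ring.
  by rewrite (le_trans (ler_normD _ _))// lerD.
rewrite (_ : U (t + k) - U t - V t * k =
  (F (t + k) - V t * k - F t) - (F (t + k) - U (t + k)) + (F t - U t)); last by ring.
rewrite E (le_trans (ler_normD _ _))// (le_trans (lerD (ler_normB _ _) (lexx _)))//.
rewrite normrM (le_trans (lerD (lerD (ler_wpM2r _ slope) Fk) Ft))//.
have -> : e * `|k| = (eta + e / 2) * `|k| + eta + eta; last by [].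
rewrite /eta; field; rewrite gt_eqF// addr_gt0//.
Qed.

(** A vanishing integral would make [f] zero almost everywhere on [D], so that [D], where [f > 0],
    would be null. *)
Lemma Rintegral_gt0 d (T : measurableType d) (R : realType)
    (mu : {measure set T -> \bar R}) (D : set T) (f : T -> R) :
  measurable D -> mu.-integrable D (EFin \o f) -> (forall x, D x -> 0 < f x) ->
  mu D != 0%E -> 0 < \int[mu]_(x in D) f x.
Proof.
move=> mD intf f0 D0; rewrite lt_neqAle Rintegral_ge0 ?andbT; last by move=> x /f0/ltW.
apply: contra D0 => /eqP I0.
have abs0 : (\int[mu]_(x in D) `|(EFin \o f) x| = 0)%E.
  have -> : (\int[mu]_(x in D) `|(EFin \o f) x| = \int[mu]_(x in D) (f x)%:E)%E.
    by apply: eq_integral => x; rewrite inE => /f0 fx /=; rewrite gtr0_norm.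
  by rewrite -[LHS]fineK ?(integrable_fin_num mD intf)// -/(Rintegral mu D f) -I0.
have /integrableP[mf _] := intf.
have [A [mA A0 DA]] := (ae_eq_integral_abs mu mD mf).1 abs0.
rewrite -measure_le0 -A0; apply: le_measure; rewrite ?inE// => x Dx; apply: DA => /= H.
by have := f0 x Dx; have [->] := H Dx; rewrite ltxx.
Qed.

Section Mean.
Context {R : realType} {N : nat}.
Local Notation E := 'rV[R]_N.
Variables (Om : set E) (p r gamma : R) (phi : R -> R) (u0 : E -> R) (T : \bar R).
Variables (u : E -> R -> R) (h : E -> R).
Hypotheses (oOm : open Om) (bOm : bounded_set Om) (dh : defining_function Om h).
Hypotheses (p0 : 0 < p) (r0 : 0 < r) (vol0 : 0 < volume Om).
Hypothesis (sol : classical_solution Om p r gamma phi u0 T u).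
Hypothesis cPhi : forall t, time_oo T t -> {for t, continuous (Phi N phi)}.
Hypothesis cPsi : forall t, time_oo T t -> {for t, continuous (Psi N gamma phi)}.
Local Notation mu := (lebesgue_tuple N).
Local Notation D := (pt @^-1` Om).
Local Notation pow := (power_integral Om u).
Implicit Types (a b t e : R) (x y : E).

Let mD : measurable D := domain_measurable oOm.

Lemma continuous_cut_defect e : 0 < e -> continuous (fun x => 1 - cut e (h x)).
Proof.
move=> e0; apply: continuous_funB; first exact: cst_continuous.
move=> x; apply: continuous_comp; first exact: (defining_C2 dh).1.1.
exact: continuous_cut.
Qed.

Definition cut_defect e : R := \int[mu]_(z in D) (1 - cut e (h (pt z))).

(** Dominated convergence along [1 / (n + 1)]: since [h < 0] on [Om], the cut-off tends to 1 at each
    of its points. *)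
Lemma cut_defect_cvg e : 0 < e -> exists2 d, 0 < d <= e & cut_defect d <= e.
Proof.
move=> e0.
have d0 n : 0 < n.+1%:R^-1 :> R by rewrite invr_gt0.
have mf n : measurable_fun D (fun z => (1 - cut n.+1%:R^-1 (h (pt z)))%:E).
  apply/measurable_EFinP; apply: (measurable_fun_point (f := fun x => 1 - cut n.+1%:R^-1 (h x)) oOm) => x _.
  exact: continuous_cut_defect.
have cvf : {ae mu, forall z, D z ->
    (1 - cut n.+1%:R^-1 (h (pt z)))%:E @[n --> \oo] --> (0 : R)%:E}.
  apply: aeW => z Dz; apply/fine_cvgP; split; first exact: nearW.
  rewrite /comp/= -[X in _ --> X](subrr 1); apply: cvgB; first exact: cvg_cst.
  apply: cvg_cut; last exact: cvg_harmonic.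
  exact/(defining_lt0 dh).
have bdf : {ae mu, forall z n, D z -> (`|(1 - cut n.+1%:R^-1 (h (pt z)))%:E| <= 1%:E)%E}.
  apply: aeW => z n Dz; rewrite lee_fin ger0_norm ?subr_ge0 ?cut_le1//.
  by rewrite gerBl cut_ge0.
have [_ _] := dominated_convergence mD mf (measurable_cst _) cvf
  (domain_cst_integrable oOm bOm 1) bdf.
rewrite integral0 => /fine_cvg cv.
have n1 : \forall n \near \oo, cut_defect n.+1%:R^-1 <= e.
  exact: (cvgr_le _ cv _ e0).
have n2 : \forall n \near \oo, n.+1%:R^-1 <= e.
  exact: (cvgr_le _ (@cvg_harmonic R) _ e0).
have [n [n1e n2e]] := filter_ex (filterI n1 n2).
by exists n.+1%:R^-1 => //; rewrite d0.
Qed.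

Lemma cut_u_integrable e a t : 0 < e -> time_co T t ->
  mu.-integrable D (EFin \o (fun z => cut e (h (pt z)) * u (pt z) t `^ a)).
Proof.
move=> e0 Tt; apply: (cutoff_integrable oOm bOm dh (w := fun x => u x t `^ a) e0).
- exact: continuous_cut.
- exact: cut_eq0.
- by move=> x Ox; exact: (power_space_continuous oOm sol).
Qed.

Lemma sublevel_compact e : 0 < e -> compact [set x | h x <= - e].
Proof.
move=> e0; have sub : [set x | h x <= - e] `<=` Om.
  by move=> x /= hx; apply/(defining_lt0 dh); rewrite (le_lt_trans hx)// oppr_lt0.
apply: bounded_closed_compact.
  by have [M [Mr OM]] := bOm; exists M; split=> // m Mm x /sub; exact: OM.
rewrite -[X in closed X]setCK; apply: open_closedC; rewrite openE => x /= hx.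
have {}hx : - e < h x by rewrite ltNge; apply/negP.
by apply: filterS (near_continuous_gt ((defining_C2 dh).1.1 x) hx) => y hy; apply/negP; rewrite -ltNge.
Qed.

(** The time derivative may be unbounded near the boundary. On [h <= - e], a compact part of [Om]
    outside which the cut-off vanishes, it is bounded, and this bound is the dominating constant for
    differentiation under the integral. *)
Lemma derive_time_bounded e a b : 0 < e -> 0 < a -> (b%:E < T)%E ->
  exists2 M, 0 < M & forall x t, h x <= - e -> t \in `[a, b] -> `|derive1 (u x) t| <= M.
Proof.
move=> e0 a0 bT.
have cK : compact ([set x | h x <= - e] `*` `[a, b]%classic).
  by apply: compact_setX; [exact: sublevel_compact|exact: segment_compact].
have [|M M0 HM] := compact_bounded_fun cK (f := fun z : E * R => derive1 (u z.1) z.2).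
  apply: continuous_subspaceW (solution_continuous_time sol) => -[x t] /= [hx tab].
  split; last exact: itv_time_oo a0 bT tab.
  by apply/(defining_lt0 dh); rewrite (le_lt_trans hx)// oppr_lt0.
by exists M => // x t hx tab; exact: (HM (x, t)).
Qed.

Definition cut_mass e t : R := \int[mu]_(z in D) (cut e (h (pt z)) * u (pt z) t).

Lemma is_derive_cut_mass e t : 0 < e -> time_oo T t ->
  is_derive t (1 : R) (cut_mass e)
    (\int[mu]_(z in D) (cut e (h (pt z)) * derive1 (u (pt z)) t)).
Proof.
move=> e0 [t0 tT]; have [b tb bT] := ereal_real_between tT.
have a0 : 0 < t / 2 by rewrite divr_gt0.
have [M M0 HM] := derive_time_bounded e0 a0 bT.
have tab : `]t / 2, b[%classic t by rewrite /= in_itv/= tb andbT; lra.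
have Iab s : `]t / 2, b[%classic s -> s \in `[t / 2, b] by move=> /subset_itv_oo_cc.
have Ioo s : `]t / 2, b[%classic s -> time_oo T s by move=> /Iab; exact: itv_time_oo.
have du s z : `]t / 2, b[%classic s -> D z ->
    is_derive s (1 : R) (fun s => cut e (h (pt z)) * u (pt z) s)
      (cut e (h (pt z)) * derive1 (u (pt z)) s).
  move=> Is Dz.
  have dus : is_derive s (1 : R) (u (pt z)) (derive1 (u (pt z)) s).
    by rewrite derive1E; apply/derivableP/(solution_derivable_time sol) => //; exact: Ioo.
  have := is_deriveM (is_derive_cst (cut e (h (pt z))) s (1 : R)) dus.
  by rewrite scaler0 addr0.
have intf s : `]t / 2, b[%classic s ->
    mu.-integrable D (EFin \o (fun z => cut e (h (pt z)) * u (pt z) s)).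
  move=> Is; apply: (cutoff_integrable oOm bOm dh (w := u^~ s) e0).
  - exact: continuous_cut.
  - exact: cut_eq0.
  - move=> x Ox; apply: (solution_space_continuous oOm sol) => //.
    by have [? ?] := Ioo _ Is; split=> //; exact: ltW.
have der s z : `]t / 2, b[%classic s -> D z ->
    derivable ((fun s z => cut e (h (pt z)) * u (pt z) s)^~ z) s 1.
  by move=> Is Dz; case: (du s z Is Dz).
have bd s z : `]t / 2, b[%classic s -> D z ->
    `|partial1of2 (fun s z => cut e (h (pt z)) * u (pt z) s) s z| <= M.
  move=> Is Dz; rewrite /partial1of2 derive1E (@derive_val _ _ _ _ _ _ _ (du s z Is Dz)).
  have [hz|hz] := lerP (h (pt z)) (- e).
    rewrite normrM -[leRHS]mul1r ler_pM ?HM ?Iab//.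
    by rewrite ger0_norm ?cut_le1// cut_ge0.
  by rewrite cut_eq0 ?mul0r ?normr0 ?ltW.
have H1 := derivable_under_integral mD tab intf der (fun _ => ltW M0)
  (domain_cst_integrable oOm bOm M) bd.
have H2 := differentiation_under_integral mD tab intf der (fun _ => ltW M0)
  (domain_cst_integrable oOm bOm M) bd.
split; first exact: H1.
rewrite -derive1E H2; apply: eq_Rintegral => z; rewrite inE => Dz.
by rewrite /partial1of2 derive1E (@derive_val _ _ _ _ _ _ _ (du t z tab Dz)).
Qed.

Lemma pow_gt0 a t : 0 <= a -> time_co T t -> 0 < pow a t.
Proof.
move=> a0 Tt; apply: Rintegral_gt0 => //.
- by have := power_integrable oOm bOm sol a0 Tt; rewrite ger0_norm//; exact: Tt.1.
- by move=> z Dz; apply: powR_gt0; rewrite ger0_norm ?(proj1 Tt)//; exact: (solution_pos sol).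
- by apply: contraTneq vol0 => D0; rewrite /volume D0 ltxx.
Qed.

(** Right-hand side for the unnormalised integral of [u]: the volume enters only through the
    nonlocal denominator. *)
Definition mean_rhs t : R := - Phi N phi t * pow 1 t +
  Psi N gamma phi t / ((volume Om)^-1 * pow r t) `^ gamma * pow p t.

Lemma pow_continuous a t : 0 <= a -> time_oo T t -> {for t, continuous (pow a)}.
Proof.
by move=> a0 [t0 tT]; apply: (power_integral_continuous oOm bOm sol) => //; rewrite gtr0_norm.
Qed.

Lemma source_coef_continuous t : time_oo T t ->
  {for t, continuous (fun t => Psi N gamma phi t / ((volume Om)^-1 * pow r t) `^ gamma)}.
Proof.
move=> Tt; have Tt' : time_co T t by case: Tt => /ltW.
have pr0 : 0 < (volume Om)^-1 * pow r t by rewrite mulr_gt0 ?invr_gt0// pow_gt0// ltW.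
apply: (cvgM (cPsi Tt)); apply: cvgV; first by rewrite gt_eqF// powR_gt0.
apply: (@continuous_comp _ _ _ (fun t => (volume Om)^-1 * pow r t) (@powR R ^~ gamma)).
  exact: (cvgM (cvg_cst _) (pow_continuous (ltW r0) Tt)).
by apply: continuous_powR_neq0; rewrite gt_eqF.
Qed.

Lemma mean_rhs_continuous t : time_oo T t -> {for t, continuous mean_rhs}.
Proof.
move=> Tt; apply: cvgD; apply: cvgM.
- by apply: cvgN; exact: cPhi.
- exact: pow_continuous.
- exact: source_coef_continuous.
- exact: pow_continuous (ltW p0) Tt.
Qed.

Lemma averageE t a : 0 <= t ->
  average Om (fun y => u y t `^ a) = (volume Om)^-1 * pow a t.
Proof. by move=> t_ge0; rewrite /average /power_integral ger0_norm. Qed.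

Lemma cut_u1_integrable e t : 0 < e -> time_co T t ->
  mu.-integrable D (EFin \o (fun z => cut e (h (pt z)) * u (pt z) t)).
Proof.
move=> e0 Tt; apply: (cutoff_integrable oOm bOm dh (w := u^~ t) e0).
- exact: continuous_cut.
- exact: cut_eq0.
- by move=> x Ox; exact: (solution_space_continuous oOm sol).
Qed.

Lemma cut_laplacian_integrable e t : 0 < e -> time_oo T t ->
  mu.-integrable D (EFin \o (fun z => cut e (h (pt z)) * laplacian (u^~ t) (pt z))).
Proof.
move=> e0 Tt; apply: (cutoff_integrable oOm bOm dh (w := laplacian (u^~ t)) e0).
- exact: continuous_cut.
- exact: cut_eq0.
- move=> x Ox; apply: continuous_at_sum => i.
  by have [_ _ _] := solution_C2_on oOm sol Tt Ox i.
Qed.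

Lemma cut_mass_derive e t : 0 < e -> time_oo T t ->
  is_derive t (1 : R) (cut_mass e)
    (\int[mu]_(z in D) (cut e (h (pt z)) * laplacian (u^~ t) (pt z))
     - Phi N phi t * cut_mass e t
     + Psi N gamma phi t / ((volume Om)^-1 * pow r t) `^ gamma *
       \int[mu]_(z in D) (cut e (h (pt z)) * u (pt z) t `^ p)).
Proof.
move=> e0 Tt; have Tt' : time_co T t by case: Tt => /ltW.
apply: is_derive_eq; first exact: is_derive_cut_mass.
set c := Psi N gamma phi t / _.
have i1 := cut_laplacian_integrable e0 Tt.
have i2 := cut_u1_integrable e0 Tt'.
have i3 := cut_u_integrable p e0 Tt'.
have i2' : mu.-integrable D (EFin \o (fun z => - Phi N phi t * (cut e (h (pt z)) * u (pt z) t))).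
  exact: (integrableZl mD _ i2).
have i3' : mu.-integrable D (EFin \o (fun z => c * (cut e (h (pt z)) * u (pt z) t `^ p))).
  exact: (integrableZl mD _ i3).
rewrite -[X in _ = _ + X + _]mulNr /cut_mass -!RintegralZl// -!RintegralD//; last first.
  exact: (integrableD mD i1 i2').
apply: eq_Rintegral => z; rewrite inE => Dz.
rewrite (solution_equation sol Dz Tt) averageE ?(proj1 Tt')//.
by rewrite -/c /c; ring.
Qed.

Lemma defect_bound e (w : E -> R) M : 0 < e -> 0 <= M ->
  (forall x, Om x -> {for x, continuous w}) -> (forall x, Om x -> `|w x| <= M) ->
  `|\int[mu]_(z in D) (cut e (h (pt z)) * w (pt z)) - \int[mu]_(z in D) w (pt z)|
    <= M * cut_defect e.
Proof.
move=> e0 M0 cw wM.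
have i1 : mu.-integrable D (EFin \o (fun z => cut e (h (pt z)) * w (pt z))).
  exact: (cutoff_integrable oOm bOm dh e0 (continuous_cut e0) (@cut_eq0 _ e) cw).
have i2 := domain_integrable oOm bOm cw wM.
have i3 : mu.-integrable D (EFin \o (fun z => 1 - cut e (h (pt z)))).
  apply: (domain_integrable oOm bOm (f := fun x => 1 - cut e (h x)) (M := 1)) => x _.
    exact: continuous_cut_defect.
  by rewrite ger0_norm ?subr_ge0 ?cut_le1// gerBl cut_ge0.
have i4 : mu.-integrable D (EFin \o (fun z => cut e (h (pt z)) * w (pt z) - w (pt z))).
  exact: (integrableB mD i1 i2).
rewrite -RintegralB// (le_trans (le_normr_Rintegral mD i4))//.
rewrite /cut_defect -RintegralZl//; apply: le_Rintegral => //.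
- exact: integrable_norm i4.
- exact: (integrableZl mD _ i3).
move=> z Dz; rewrite -[X in _ - X]mul1r -mulrBl normrM mulrC ler_pM ?wM//.
by rewrite distrC ger0_norm ?subr_ge0 ?cut_le1.
Qed.

End Mean.

Section MeanDerivative.
Context {R : realType} {N : nat}.
Local Notation E := 'rV[R]_N.
Variables (Om : set E) (p r gamma : R) (phi : R -> R) (u0 : E -> R) (T : \bar R).
Variables (u : E -> R -> R) (h : E -> R).
Hypotheses (oOm : open Om) (bOm : bounded_set Om) (dh : defining_function Om h).
Hypotheses (p0 : 0 < p) (r0 : 0 < r) (vol0 : 0 < volume Om).
Hypothesis (sol : classical_solution Om p r gamma phi u0 T u).
Hypothesis cPhi : forall t, time_oo T t -> {for t, continuous (Phi N phi)}.
Hypothesis cPsi : forall t, time_oo T t -> {for t, continuous (Psi N gamma phi)}.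
Local Notation mu := (lebesgue_tuple N).
Local Notation D := (pt @^-1` Om).
Local Notation pow := (power_integral Om u).
Local Notation rhs := (mean_rhs Om p r gamma phi u).
Implicit Types (a b t e : R) (x y : E).

Lemma segment_bounded (f : R -> R) a b : 0 < a -> (b%:E < T)%E ->
  (forall t, time_oo T t -> {for t, continuous f}) ->
  exists2 M, 0 < M & forall t, t \in `[a, b] -> `|f t| <= M.
Proof.
move=> a0 bT cf; have [|M M0 HM] := compact_bounded_fun (@segment_compact R a b) (f := f).
  apply: continuous_in_subspaceT => t; rewrite inE => tab.
  by apply: cf; exact: itv_time_oo tab.
by exists M.
Qed.

Lemma laplacian_bounded : exists2 K, 0 < K & forall x, Om x -> `|laplacian h x| <= K.
Proof.
have [|K K0 HK] := compact_bounded_fun (closure_compact bOm) (f := laplacian h).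
  by apply: continuous_subspaceT; exact: continuous_laplacian (defining_C2 dh).
by exists K => // x Ox; apply: HK; exact: subset_closure.
Qed.

Lemma pow1E t : time_co T t -> pow 1 t = \int[mu]_(z in D) u (pt z) t.
Proof.
move=> Tt; apply: eq_Rintegral => z; rewrite inE => Dz.
by rewrite ger0_norm ?(proj1 Tt)// powRr1// ltW// (solution_pos sol).
Qed.

(** The approximant is the cut-off mass at a single level [d]; the Laplacian, damping and source
    terms of its derivative are each allowed an error [eta / 3]. *)
Lemma cut_mass_approx a b eta : 0 < a -> (b%:E < T)%E -> 0 < eta ->
  exists F, exists dF : R -> R, forall t, t \in `[a, b] ->
    [/\ is_derive t (1 : R) F (dF t), `|F t - pow 1 t| <= eta & `|dF t - rhs t| <= eta].
Proof.
move=> a0 bT eta0.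
have third : eta / 3 + eta / 3 + eta / 3 = eta by field.
have comm (c v k : R) : c * (2 * k) * v = k * (2 * c * v) by ring.
have regroup (l f m c k n w : R) :
    l - f * m + c * k - (- f * n + c * w) = l + - f * (m - n) + c * (k - w) by ring.
have [M M0 HM] := solution_bounded bOm sol bT.
have [KPhi KPhi0 HPhi] := segment_bounded a0 bT cPhi.
have [Kc Kc0 Hc] := segment_bounded a0 bT (source_coef_continuous oOm bOm r0 vol0 sol cPsi).
have [K K0 HK] := laplacian_bounded.
pose V := volume Om.
have eta3 : 0 < eta / 3 by rewrite divr_gt0.
(* Makes [rho * K * V] half of [eta / 3]. It is fixed first, because [C] depends on it and the level
   [d] on [C]. *)
pose rho := eta / 3 / 2 / (K * V).
have rho0 : 0 < rho by rewrite !divr_gt0// mulr_gt0.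
have [C C0 HC] := normal_derivative_small bOm dh sol rho0 a0 bT.
(* Thresholds, in turn, for the other half of the Laplacian term, the damping term, the source term
   and the mass itself; [C + 1] keeps the denominator positive when [C = 0]. *)
pose e0 := Num.min (eta / 3 / 2 / (2 * (C + 1) * V))
  (Num.min (eta / 3 / (KPhi * M)) (Num.min (eta / 3 / (Kc * M `^ p)) (eta / M))).
have e00 : 0 < e0.
  rewrite !lt_min !divr_gt0// ?mulr_gt0// ?powR_gt0// ltr_wpDl//.
have [d /andP[d0 de0] kd] := cut_defect_cvg oOm bOm dh e00.
move: de0 kd; rewrite !le_min => /and4P[d1 _ _ _] /and4P[_ k2 k3 k4].
have kge0 : 0 <= cut_defect Om h d.
  by apply: Rintegral_ge0 => z _; rewrite subr_ge0 cut_le1.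
exists (cut_mass Om u h d); eexists => t tab.
have Tt := itv_time_oo a0 bT tab.
have Tt' : time_co T t by case: Tt => /ltW.
have t0b : t \in `[0, b] by move: tab; rewrite !in_itv/= => /andP[/(le_trans (ltW a0))->].
have uM x : Om x -> `|u x t| <= M by move=> Ox; apply: HM => //; exact: subset_closure.
have B1 : `|cut_mass Om u h d t - pow 1 t| <= M * cut_defect Om h d.
  rewrite pow1E//; apply: (defect_bound oOm bOm dh (w := u^~ t) d0 (ltW M0)) => // x Ox.
  exact: (solution_space_continuous oOm sol).
have Bp : `|\int[mu]_(z in D) (cut d (h (pt z)) * u (pt z) t `^ p) - pow p t|
    <= M `^ p * cut_defect Om h d.
  rewrite /power_integral (ger0_norm (proj1 Tt')).
  apply: (defect_bound oOm bOm dh (w := fun x => u x t `^ p) d0 (powR_ge0 _ _)) => x Ox.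
    exact: (power_space_continuous oOm sol).
  by apply: normr_powR_le; [exact: ltW|exact: (solution_pos sol)|exact: uM].
have BL : `|\int[mu]_(z in D) (cut d (h (pt z)) * laplacian (u^~ t) (pt z))| <= eta / 3.
  apply: (le_trans (cut_laplacian_bound oOm bOm dh d0 HK
    (solution_C2_on oOm sol Tt) (ltW rho0) C0 (fun x Ox => HC x t Ox tab))).
  rewrite -/V mulrDl; have -> : rho * K * V = eta / 3 / 2.
    by rewrite /rho -mulrA divfK// gt_eqF// mulr_gt0.
  rewrite [leRHS]splitr lerD2l.
  move: d1; rewrite ler_pdivlMr; last by rewrite !mulr_gt0// ltr_wpDl.
  apply: le_trans; rewrite comm ler_wpM2l ?(ltW d0)//.
  by rewrite ler_wpM2r ?(ltW vol0)// ler_wpM2l// lerDl.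
split; first exact: (cut_mass_derive oOm bOm dh sol d0 Tt).
  by rewrite (le_trans B1)// mulrC -ler_pdivlMr.
cbv beta; set c := Psi N gamma phi t / _; set L := \int[mu]_(z in D) _ in BL *.
set P := \int[mu]_(z in D) _ in Bp *.
rewrite /mean_rhs -/c regroup.
have B2 : `|- Phi N phi t * (cut_mass Om u h d t - pow 1 t)| <= eta / 3.
  rewrite normrM normrN; apply: le_trans (ler_pM _ _ (HPhi t tab) B1) _ => //.
  by rewrite mulrA mulrC -ler_pdivlMr// mulr_gt0.
have B3 : `|c * (P - pow p t)| <= eta / 3.
  rewrite normrM; apply: le_trans (ler_pM _ _ (Hc t tab) Bp) _ => //.
  by rewrite mulrA mulrC -ler_pdivlMr// mulr_gt0// powR_gt0.
rewrite (le_trans (ler_normD _ _))// (le_trans (lerD (ler_normD _ _) (lexx _)))//.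
by rewrite (le_trans (lerD (lerD BL B2) B3))// third.
Qed.

Lemma mean_derive t : time_oo T t -> is_derive t (1 : R) (pow 1) (rhs t).
Proof.
move=> Tt; have [t0 tT] := Tt; have [b tb bT] := ereal_real_between tT.
have a0 : 0 < t / 2 by rewrite divr_gt0.
apply: (is_derive_uniform_limit (a := t / 2) (b := b)) => //; first by lra.
  exact: (mean_rhs_continuous oOm bOm p0 r0 vol0 sol cPhi cPsi).
by move=> e e0; exact: cut_mass_approx.
Qed.

End MeanDerivative.

(** * Jensen's inequality *)

(** The tangent line of the power at 1; it comes from Young's inequality for the factors [x] and
    1. *)
Lemma bernoulli_powR {R : realType} (a x : R) : 1 <= a -> 0 < x -> a * x - a + 1 <= x `^ a.
Proof.
rewrite le_eqVlt => /predU1P[<-|a1] x0; first by rewrite mul1r subrK (powRr1 (ltW x0)).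
have a0 : 0 < a by rewrite (lt_trans _ a1).
have q0 : 0 < 1 - a^-1 by rewrite subr_gt0 invf_lt1.
have := @conjugate_powR R x 1 a (1 - a^-1)^-1 (ltW x0) ler01 a0.
rewrite invr_gt0 invrK [a^-1 + _]addrC subrK => /(_ q0 erefl).
rewrite mulr1 powR1 mul1r => H.
have := ler_wpM2l (ltW a0) H; rewrite mulrDr mulrBr mulr1 divff ?gt_eqF// mulrCA divff ?gt_eqF// mulr1.
by lra.
Qed.

(** Bernoulli's inequality at [f x / m] is the tangent line of the power at the mean [m]; its
    integral over [D] is [m ^ a] times the measure of [D]. *)
Lemma jensen_powR d (T : measurableType d) (R : realType)
    (mu : {measure set T -> \bar R}) (D : set T) (f : T -> R) (a : R) :
  measurable D -> 0 < fine (mu D) -> 1 <= a -> (forall x, D x -> 0 < f x) ->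
  mu.-integrable D (EFin \o f) -> mu.-integrable D (EFin \o (fun x => f x `^ a)) ->
  ((fine (mu D))^-1 * \int[mu]_(x in D) f x) `^ a <=
  (fine (mu D))^-1 * \int[mu]_(x in D) (f x `^ a).
Proof.
move=> mD V0 a1 f0 intf intfa; set V := fine (mu D) in V0 *.
have Dfin : (mu D < +oo)%E.
  by rewrite ltey; apply: contraTneq V0 => E; rewrite /V E ltxx.
set m := V^-1 * \int[mu]_(x in D) f x.
have m0 : 0 < m.
  rewrite mulr_gt0 ?invr_gt0//; apply: Rintegral_gt0 => //.
  by apply: contraTneq V0 => E; rewrite /V E ltxx.
have mV : \int[mu]_(x in D) f x = m * V by rewrite /m mulrC mulrA divff ?mul1r// gt_eqF.
have intc (c : R) : mu.-integrable D (EFin \o (fun=> c)).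
  apply: (measurable_bounded_integrable mD Dfin) => //.
  exact: bounded_cst.
have int1 : mu.-integrable D (EFin \o (fun x => m `^ a * a / m * f x)).
  exact: (integrableZl mD _ intf).
have : \int[mu]_(x in D) (m `^ a * a / m * f x - m `^ a * (a - 1)) <=
    \int[mu]_(x in D) (f x `^ a).
  apply: le_Rintegral => //; first exact: (integrableB mD int1 (intc _)).
  move=> x Dx; have fm : 0 < f x / m by rewrite divr_gt0// f0.
  have -> : f x `^ a = m `^ a * (f x / m) `^ a.
    by rewrite -powRM ?(ltW m0) ?(ltW fm)// mulrC divfK// gt_eqF.
  rewrite -mulrA -mulrA -mulrBr ler_wpM2l ?powR_ge0//.
  have := bernoulli_powR a1 fm.
  by rewrite (_ : a * (m^-1 * f x) = a * (f x / m)) 1?(mulrC m^-1)//; lra.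
rewrite RintegralB// RintegralZl// Rintegral_cst// -/V mV.
rewrite (_ : _ - _ = m `^ a * V); last by field; rewrite gt_eqF.
by rewrite -ler_pdivlMr// mulrC.
Qed.

(** [m], [B] and [Q] stand for the means of [u], [u^p] and [u^r]. Since [m <= B^(1/p)] and
    [Q <= B^(r/p)], the powers of [B] that bound [m^(p - r gamma)] and [Q^gamma] have exponents
    [(p - r gamma)/p] and [r gamma/p], which add up to 1. *)
Lemma powR_ratio_lower {R : realType} (p r gamma m B Q : R) :
  1 < p -> 0 < r -> r <= p -> 0 < gamma -> 1 < p - r * gamma ->
  0 < m -> 0 < B -> 0 < Q -> m `^ p <= B -> Q `^ (p / r) <= B ->
  m `^ (p - r * gamma) <= B / Q `^ gamma.
Proof.
move=> p1 r0 rp gamma0 omega1 m0 B0 Q0 J1 J2.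
have p0 : 0 < p by rewrite (lt_trans _ p1).
rewrite ler_pdivlMr ?powR_gt0//.
have mB : m <= B `^ p^-1.
  have := ge0_ler_powR (ltW (_ : 0 < p^-1)) _ _ J1; rewrite invr_gt0 !nnegrE => /(_ p0 (powR_ge0 _ _) (ltW B0)).
  by rewrite -powRrM divff ?gt_eqF// powRr1// ltW.
have QB : Q <= B `^ (r / p).
  have rp0 : 0 < r / p by rewrite divr_gt0.
  have := ge0_ler_powR (ltW rp0) _ _ J2; rewrite !nnegrE => /(_ (powR_ge0 _ _) (ltW B0)).
  by rewrite -powRrM (_ : p / r * (r / p) = 1) ?powRr1// ?ltW//; field; rewrite !gt_eqF.
have om0 : 0 <= p - r * gamma by rewrite ltW// (lt_trans _ omega1).
have mo : m `^ (p - r * gamma) <= B `^ (p^-1 * (p - r * gamma)).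
  by rewrite powRrM; apply: ge0_ler_powR; rewrite ?nnegrE ?powR_ge0// ltW.
have Qg : Q `^ gamma <= B `^ (r / p * gamma).
  by rewrite powRrM; apply: ge0_ler_powR; rewrite ?nnegrE ?powR_ge0// ltW.
apply: le_trans (ler_pM (powR_ge0 _ _) (powR_ge0 _ _) mo Qg) _.
rewrite -powRD; last by rewrite (gt_eqF B0) implybT.
rewrite (_ : _ + _ = 1); first by rewrite powRr1// ltW.
by field; rewrite gt_eqF.
Qed.

Section SourceBound.
Context {R : realType} {N : nat}.
Local Notation E := 'rV[R]_N.
Variables (Om : set E) (p r gamma : R) (phi : R -> R) (u0 : E -> R) (T : \bar R).
Variables (u : E -> R -> R).
Hypotheses (oOm : open Om) (bOm : bounded_set Om).
Hypotheses (p1 : 1 < p) (r0 : 0 < r) (rp : r <= p) (gamma0 : 0 < gamma).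
Hypotheses (omega1 : 1 < p - r * gamma) (vol0 : 0 < volume Om).
Hypothesis (sol : classical_solution Om p r gamma phi u0 T u).
Local Notation mu := (lebesgue_tuple N).
Local Notation D := (pt @^-1` Om).
Local Notation pow := (power_integral Om u).
Local Notation V := (volume Om).

Lemma source_lower t : time_co T t ->
  (V^-1 * pow 1 t) `^ (p - r * gamma) <= V^-1 * pow p t / (V^-1 * pow r t) `^ gamma.
Proof.
move=> Tt; have mD := domain_measurable oOm.
have p0 : 0 < p by rewrite (lt_trans _ p1).
have tn : `|t| = t by rewrite ger0_norm// (proj1 Tt).
have up (z : RT R N) : D z -> 0 < u (pt z) t by move=> Dz; exact: (solution_pos sol).
have int_a a : 0 <= a -> mu.-integrable D (EFin \o (fun z => u (pt z) `|t| `^ a)).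
  by move=> a0; rewrite tn; exact: (power_integrable oOm bOm sol).
have J1 : (V^-1 * pow 1 t) `^ p <= V^-1 * pow p t.
  have := @jensen_powR _ _ _ mu D (fun z => u (pt z) `|t| `^ 1) p mD vol0 (ltW p1).
  rewrite (_ : (fun z => (u (pt z) `|t| `^ 1) `^ p) = fun z => u (pt z) `|t| `^ p); last first.
    by apply/funext => z; rewrite -powRrM mul1r.
  apply; [by move=> z Dz; rewrite tn powR_gt0// up|exact: int_a|exact: int_a (ltW p0)].
have pr1 : 1 <= p / r by rewrite ler_pdivlMr// mul1r.
have J2 : (V^-1 * pow r t) `^ (p / r) <= V^-1 * pow p t.
  have := @jensen_powR _ _ _ mu D (fun z => u (pt z) `|t| `^ r) (p / r) mD vol0.
  move=> /(_ pr1).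
  rewrite (_ : (fun z => (u (pt z) `|t| `^ r) `^ (p / r)) = fun z => u (pt z) `|t| `^ p); last first.
    by apply/funext => z; rewrite -powRrM mulrC divfK// gt_eqF.
  apply; [by move=> z Dz; rewrite tn powR_gt0// up|exact: int_a (ltW r0)|exact: int_a (ltW p0)].
have pow_pos a : 0 <= a -> 0 < V^-1 * pow a t.
  move=> a0; apply: mulr_gt0; first by rewrite invr_gt0; exact: vol0.
  exact: (pow_gt0 oOm bOm vol0 sol).
apply: powR_ratio_lower p1 r0 rp gamma0 omega1 _ _ _ J1 J2; apply: pow_pos.
- exact: ler01.
- exact: ltW p0.
- exact: ltW r0.
Qed.

End SourceBound.

(** * The differential inequality *)

(** Treats finite and infinite horizons alike; no real lies below [T = -oo], which the disjunction
    records. *)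
Lemma exhausting_sequence {R : realType} (T : \bar R) : exists b : R^nat,
  [/\ nondecreasing_seq b, forall n, ((b n)%:E < T)%E \/ T = -oo%E &
      forall t, (t%:E < T)%E -> exists n, t <= b n].
Proof.
case: T => [r| |].
- exists (fun n => r - n.+1%:R^-1); split.
  + by move=> m n mn; rewrite lerD2l lerN2 lef_pV2 ?posrE// ler_nat.
  + by move=> n; left; rewrite lte_fin gtrBl invr_gt0.
  + move=> t; rewrite lte_fin -subr_gt0 => tr.
    have [n _ /(_ n (leqnn n)) H] := near_infty_natSinv_lt (PosNum tr).
    by exists n; rewrite lerBrDl -lerBrDr ltW.
- exists (fun n => n%:R); split.
  + by move=> m n mn; rewrite ler_nat.
  + by move=> n; left; rewrite ltry.
  + move=> t _; exists (Num.truncn `|t|).+1.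
    by rewrite (le_trans (ler_norm _))// ltW// truncnS_gt.
- by exists (fun=> 0); split => // n; right.
Qed.

Lemma is_derive1_continuous {R : realType} (f : R -> R) (d t : R) :
  is_derive t (1 : R) f d -> {for t, continuous f}.
Proof.
move=> H; apply: differentiable_continuous; apply/derivable1_diffP.
exact: (@ex_derive _ _ _ _ _ _ _ H).
Qed.

Section SupersolutionIntegral.
Context {R : realType}.
Variables (T : \bar R) (U S G Ph Ps : R -> R) (omega : R).
Hypothesis omega1 : 1 < omega.
Hypothesis dU : forall t, time_oo T t -> is_derive t (1 : R) U (- Ph t * U t + Ps t * S t).
Hypothesis dG : forall t, time_oo T t -> is_derive t (1 : R) G (Ph t).
Hypothesis U_gt0 : forall t, time_oo T t -> 0 < U t.
Hypothesis U_le : forall t, time_oo T t -> U t `^ omega <= S t.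
Hypothesis Ps_gt0 : forall t, time_oo T t -> 0 < Ps t.
Hypothesis cS : forall t, time_oo T t -> {for t, continuous S}.
Hypothesis cPs : forall t, time_oo T t -> {for t, continuous Ps}.
Hypothesis U0 : U t @[t --> 0^'+] --> U 0.
Hypothesis U00 : 0 < U 0.
Hypothesis G0 : G t @[t --> 0^'+] --> (0 : R).

Let z t := expR (G t) * U t.

Let z_gt0 t : time_oo T t -> 0 < z t.
Proof. by move=> Tt; rewrite mulr_gt0 ?expR_gt0// U_gt0. Qed.

Let dz t : time_oo T t -> is_derive t (1 : R) z (expR (G t) * (Ps t * S t)).
Proof.
move=> Tt; have dUt := dU Tt; have dGt := dG Tt.
have dE : is_derive t (1 : R) (expR \o G) (expR (G t) * Ph t).
  by apply: is_derive1_comp; exact: is_derive_expR.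
have H := is_deriveM dE dUt.
by apply: is_derive_eq H _; rewrite /GRing.scale/=; ring.
Qed.

Let z0 : z t @[t --> 0^'+] --> U 0.
Proof.
rewrite -[U 0]mul1r -[1 in X in _ --> X]expR0; apply: cvgM => //.
exact: (cvg_comp _ _ G0 (@continuous_expR R 0)).
Qed.

(** [z] is nondecreasing, its derivative being a product of nonnegative factors. The equation holds
    on the open interval only, so the initial value is reached as the limit from the right. *)
Lemma supersolution_ge t : time_oo T t -> U 0 <= expR (G t) * U t.
Proof.
move=> Tt; apply: (cvgr_to_le z0); near=> a.
have a0 : 0 < a by near: a; exact: nbhs_right_gt.
have a_t : a < t by near: a; apply: nbhs_right_lt; exact: Tt.1.
have I s : s \in `[a, t] -> time_oo T s by apply: itv_time_oo => //; exact: Tt.2.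
have Io s : s \in `]a, t[ -> time_oo T s by move=> /subset_itv_oo_cc/I.
apply: (@ger0_derive1_le R z a t _ _ true false).
- by move=> s /Io Ts; exact: (@ex_derive _ _ _ _ _ _ _ (dz Ts)).
- move=> s /Io Ts; rewrite derive1E (@derive_val _ _ _ _ _ _ _ (dz Ts)).
  rewrite mulr_ge0 ?expR_ge0// mulr_ge0// ?(ltW (Ps_gt0 Ts))//.
  exact: le_trans (powR_ge0 _ _) (U_le Ts).
- apply: derivable_within_continuous => s /I Ts; exact: (@ex_derive _ _ _ _ _ _ _ (dz Ts)).
- by rewrite bound_itvE ltW.
- by rewrite bound_itvE ltW.
- exact: ltW.
Unshelve. all: by end_near. Qed.

(** [- F] is a primitive of [f], and [f] dominates the integrand [k] of the blow-up integral;
    integrals of [k] are thus bounded by decrements of [F]. *)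
Let F t := z t `^ (1 - omega) / (omega - 1).
Let f t := z t `^ (- omega) * (expR (G t) * (Ps t * S t)).
Let k t := Ps t * expR ((1 - omega) * G t).

Let dF t : time_oo T t -> is_derive t (1 : R) (fun s => - F s) (f t).
Proof.
move=> Tt; have dzt := dz Tt.
have dp := is_derive1_comp (is_derive1_powR (1 - omega) (z_gt0 Tt)) dzt.
have H := is_deriveN (is_deriveZ (omega - 1)^-1 dp).
have -> : (fun s => - F s) = - ((omega - 1)^-1 \*: ((@powR R)^~ (1 - omega) \o z)).
  by apply/funext => s; rewrite /F fctE /= /GRing.scale/= mulrC.
apply: is_derive_eq H _; rewrite /f /GRing.scale/= (_ : 1 - omega - 1 = - omega); last by ring.
by field; rewrite subr_eq0 gt_eqF.
Qed.

Let kf t : time_oo T t -> k t <= f t.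
Proof.
move=> Tt; have Ut := U_gt0 Tt; rewrite /k /f /z.
rewrite powRM ?expR_ge0 ?(ltW Ut)// -expRM (_ : (1 - omega) * G t = G t * - omega + G t); last by ring.
rewrite expRD -!mulrA mulrCA ler_pM2l ?expR_gt0//.
rewrite (_ : U t `^ (- omega) * _ = expR (G t) * (Ps t * (S t / U t `^ omega))); last first.
  by rewrite powRN; ring.
rewrite [leLHS]mulrC ler_pM2l ?expR_gt0// -[leLHS]mulr1 ler_pM2l ?Ps_gt0//.
by rewrite ler_pdivlMr ?powR_gt0// mul1r U_le.
Qed.

Let ck t : time_oo T t -> {for t, continuous k}.
Proof.
move=> Tt; have cG : {for t, continuous G}.
  exact: is_derive1_continuous (dG Tt).
have ce : {for t, continuous (fun s => expR ((1 - omega) * G s))}.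
  apply: (@continuous_comp _ _ _ (fun s => (1 - omega) * G s) expR); last exact: continuous_expR.
  exact: cvgMr cG.
exact: (cvgM (cPs Tt) ce).
Qed.

Let cf t : time_oo T t -> {for t, continuous f}.
Proof.
move=> Tt; have cz : {for t, continuous z}.
  exact: is_derive1_continuous (dz Tt).
have cG : {for t, continuous G}.
  exact: is_derive1_continuous (dG Tt).
have cz' : {for t, continuous (fun s => z s `^ (- omega))}.
  apply: (@continuous_comp _ _ _ z ((@powR R)^~ (- omega))) => //.
  by apply: continuous_powR_neq0; rewrite gt_eqF// z_gt0.
have ce : {for t, continuous (fun s => expR (G s))}.
  by apply: (@continuous_comp _ _ _ G expR) => //; exact: continuous_expR.
exact: (cvgM cz' (cvgM ce (cvgM (cPs Tt) (cS Tt)))).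
Qed.

Let integral_segment a b : 0 < a -> (b%:E < T)%E ->
  (\int[lebesgue_measure]_(t in `[a, b]) (k t)%:E <= (U 0 `^ (1 - omega) / (omega - 1))%:E)%E.
Proof.
move=> a0 bT; have [ba|ab] := leP b a.
  have F0 : 0 <= U 0 `^ (1 - omega) / (omega - 1).
    by rewrite divr_ge0 ?powR_ge0// subr_ge0 ltW.
  move: ba; rewrite le_eqVlt => /predU1P[->|ba].
    by rewrite set_itv1 integral_set1.
  by rewrite set_itv_ge ?integral_set0// bnd_simp -ltNge.
have I s : s \in `[a, b] -> time_oo T s by exact: itv_time_oo.
have Io s : s \in `]a, b[ -> time_oo T s by move=> /subset_itv_oo_cc/I.
have wf : {within `[a, b], continuous f}.
  by apply: continuous_in_subspaceT => s; rewrite inE => /I; exact: cf.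
have wk : {within `[a, b], continuous k}.
  by apply: continuous_in_subspaceT => s; rewrite inE => /I; exact: ck.
have mf (g : R -> R) : {within `[a, b], continuous g} ->
    measurable_fun (`[a, b]%classic : set (measurableTypeR R)) (EFin \o g).
  move=> cg; apply/measurable_EFinP.
  by apply: subspace_continuous_measurable_fun => //; exact: measurable_itv.
have k0 s : s \in `[a, b] -> 0 <= k s.
  by move=> /I Ts; rewrite mulr_ge0 ?expR_ge0// ltW// Ps_gt0.
have f0 s : s \in `[a, b] -> 0 <= f s by move=> sI; exact: le_trans (k0 _ sI) (kf (I _ sI)).
have cF s : s \in `[a, b] -> {for s, continuous (fun s => - F s)}.
  move=> /I Ts; exact: is_derive1_continuous (dF Ts).
apply: (@le_trans _ _ (\int[lebesgue_measure]_(t in `[a, b]) (f t)%:E)%E).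
  apply: ge0_le_integral => //.
  - exact: mf.
  - exact: mf.
  - by move=> s /I Ts; rewrite lee_fin kf.
rewrite (@continuous_FTC2 _ _ (fun s => - F s))//.
- have Ta : time_oo T a by apply: I; rewrite bound_itvE ltW.
  (* Dropping [F b >= 0] leaves [F a]; as [z a >= U 0] and [1 - omega] is negative, the bound is
     uniform in [a] and [b]. *)
  rewrite -EFinB lee_fin opprK addrC; apply: (@le_trans _ _ (F a)).
    by rewrite gerBl /F divr_ge0 ?powR_ge0// subr_ge0 ltW.
  rewrite /F ler_pM2r ?invr_gt0 ?subr_gt0// -opprB !powRN lef_pV2 ?posrE ?powR_gt0// ?z_gt0//.
  by apply: ge0_ler_powR; rewrite ?nnegrE ?subr_ge0 ?(ltW omega1) ?(ltW U00) ?(ltW (z_gt0 Ta))//;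
    exact: supersolution_ge.
- split.
  + by move=> s /Io Ts; exact: (@ex_derive _ _ _ _ _ _ _ (dF Ts)).
  + by apply: cvg_at_right_filter; apply: cF; rewrite bound_itvE ltW.
  + by apply: cvg_at_left_filter; apply: cF; rewrite bound_itvE ltW.
- by move=> s /Io Ts; rewrite derive1E (@derive_val _ _ _ _ _ _ _ (dF Ts)).
Qed.

(* z = exp(G) U satisfies z' >= Ps exp((1 - omega) G) z^omega, so that
   z^(1 - omega) decreases at least at the rate (omega - 1) Ps exp((1 - omega) G). *)
Lemma supersolution_integral_le :
  (\int[lebesgue_measure]_(t in time_oo T) (Ps t * expR ((1 - omega) * G t))%:E
    <= (U 0 `^ (1 - omega) / (omega - 1))%:E)%E.
Proof.
have [T0|T0] := leP T 0%E.
  rewrite (_ : time_oo T = set0) ?integral_set0 ?lee_fin.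
    by rewrite divr_ge0 ?powR_ge0// subr_ge0 ltW.
  apply/seteqP; split => // t [t0 tT]; have := lt_le_trans tT T0.
  by rewrite lte_fin ltNge ltW.
have [b [ndb bT exb]] := exhausting_sequence T.
pose A n := `[n.+1%:R^-1, b n]%classic.
have bT' n : ((b n)%:E < T)%E.
  by case: (bT n) => // TNy; move: T0; rewrite TNy.
have AE : \bigcup_n A n = time_oo T.
  apply/seteqP; split => [t [n _] /= tA|t [t0 tT]].
    by apply: itv_time_oo tA => //; rewrite invr_gt0.
  have [n tn] := exb t tT.
  have [m _ /(_ m (leqnn m)) Hm] := near_infty_natSinv_lt (PosNum t0).
  exists (maxn n m) => //; rewrite /A /= in_itv/= (le_trans tn) ?andbT; last exact/ndb/leq_maxl.
  by apply: le_trans (ltW Hm); rewrite lef_pV2 ?posrE// ler_nat ltnS leq_maxr.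
have IA n s : A n s -> time_oo T s by move=> As; rewrite -AE; exists n.
have cvgI := @ge0_nondecreasing_set_cvg_integral _ _ R (A : nat -> set (measurableTypeR R)) (EFin \o k) (@lebesgue_measure R).
rewrite -AE; apply: (cvge_to_le (cvgI _ _ _ _)).
- move=> m n mn; apply/subsetPset => s; rewrite /A /= !in_itv/= => /andP[ms sm].
  apply/andP; split; last by apply: le_trans sm _; exact: ndb.
  by apply: le_trans ms; rewrite lef_pV2 ?posrE// ler_nat ltnS.
- by move=> n; exact: measurable_itv.
- move=> n; apply/measurable_EFinP; apply: subspace_continuous_measurable_fun; first exact: measurable_itv.
  by apply: continuous_in_subspaceT => s; rewrite inE => /IA; exact: ck.
- by move=> n s /IA Ts; rewrite lee_fin mulr_ge0 ?expR_ge0// ltW// Ps_gt0.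
apply: nearW => n; exact: integral_segment.
Qed.

End SupersolutionIntegral.

(** * The coefficients *)

Lemma derive1_is_derive {R : realType} (f : R -> R) (t d : R) :
  derivable f t 1 -> derive1 f t = d -> is_derive t (1 : R) f d.
Proof. by move=> df fd; apply: DeriveDef => //; rewrite -derive1E. Qed.

Section Coefficients.
Context {R : realType}.
Variables (N : nat) (gamma : R) (phi : R -> R) (Sig : \bar R).
Hypotheses (gamma01 : 0 < gamma < 1) (hphi : C1_co Sig phi).
Hypothesis phi_gt0 : forall t, time_co Sig t -> 0 < phi t.
Implicit Types (t b : R).
Local Notation leb := (@lebesgue_measure R).

(** [derive1 phi 0] is a two-sided derivative and depends on values of [phi] at negative times, so
    [Phi] is uncontrolled at 0; [P] uses the continuous extension of the derivative instead. *)
Lemma Phi_extension : exists2 P : R -> R, {within time_co Sig, continuous P} &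
  forall t, time_oo Sig t -> Phi N phi t = P t.
Proof.
have [cphi [df cdf dphi]] := hphi.
exists (fun t => phi t ^+ 2 + N%:R * (df t / phi t)); last first.
  by move=> t Tt; rewrite /Phi derive1E (@derive_val _ _ _ _ _ _ _ (dphi t Tt)).
apply/subspace_continuousP => t Tt.
have ct := (subspace_continuousP _ _).1 cphi t Tt.
have cdt := (subspace_continuousP _ _).1 cdf t Tt.
apply: cvgD; first by rewrite expr2; under eq_fun do rewrite expr2; exact: cvgM.
apply: cvgMr; apply: cvgM => //; apply: cvgV => //.
by rewrite gt_eqF// phi_gt0.
Qed.

Lemma time_oo_co t : time_oo Sig t -> time_co Sig t.
Proof. by case=> /ltW. Qed.

Lemma within_time_continuous (P : R -> R) t : {within time_co Sig, continuous P} ->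
  time_oo Sig t -> {for t, continuous P}.
Proof.
move=> cP Tt; apply: (within_continuous_path (c := idfun) cP); first exact: cvg_id.
by apply: filterS (near_time_oo Tt) => s; exact: time_oo_co.
Qed.

Lemma Phi_continuous t : time_oo Sig t -> {for t, continuous (Phi N phi)}.
Proof.
move=> Tt; have [P cP HP] := Phi_extension.
apply: continuous_near_eq (within_time_continuous cP Tt).
by apply: filterS (near_time_oo Tt) => s /HP ->.
Qed.

Lemma Phi_bounded b : (b%:E < Sig)%E ->
  exists2 M, 0 < M & forall t, t \in `]0, b] -> `|Phi N phi t| <= M.
Proof.
move=> bS; have [P cP HP] := Phi_extension.
have [|M M0 HM] := compact_bounded_fun (@segment_compact R 0 b) (f := P).
  by apply: continuous_subspaceW cP => t /= tb; exact: itv_time_co bS tb.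
exists M => // t; rewrite in_itv/= => /andP[t0 tb]; rewrite HP.
  by apply: HM; rewrite /= in_itv/= (ltW t0).
by split => //; apply: le_lt_trans bS; rewrite lee_fin.
Qed.

Lemma Psi_bounded b : (b%:E < Sig)%E ->
  exists2 M, 0 < M & forall t, t \in `]0, b] -> `|Psi N gamma phi t| <= M.
Proof.
move=> bS; have [M M0 HM] := Phi_bounded bS.
have /andP[g0 g1] := gamma01.
have [|K K0 HK] := compact_bounded_fun (@segment_compact R 0 b) (f := phi).
  by apply: continuous_subspaceW hphi.1 => t /= tb; exact: itv_time_co bS tb.
(* The summand 1 covers times at which [Phi] is negative, where [powR] takes the value 1. *)
exists (K `^ (2 * (1 - gamma)) * (1 + M `^ gamma)).
  by rewrite mulr_gt0 ?powR_gt0// ltr_pwDl// powR_ge0.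
move=> t tb; rewrite normrM ler_pM//.
  have t0b : t \in `[0, b] by move: tb; rewrite !in_itv/= => /andP[/ltW-> ->].
  apply: normr_powR_le; last exact: HK.
    by rewrite mulr_ge0// subr_ge0 ltW.
  by apply: phi_gt0; exact: itv_time_co bS t0b.
have [P0|P0|P0] := ltgtP (Phi N phi t) 0.
- by rewrite lt0_powR1// normr1 lerDl powR_ge0.
- by rewrite (le_trans (normr_powR_le (ltW g0) P0 (HM _ tb)))// lerDr.
- by rewrite P0 powR0 ?gt_eqF// normr0 addr_ge0// powR_ge0.
Qed.

(** Positivity of [Psi] excludes [Phi = 0], because [0] to the power [gamma] is 0; away from 0 the
    power is continuous whatever the sign of [Phi]. *)
Lemma Psi_continuous t : time_oo Sig t -> 0 < Psi N gamma phi t ->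
  {for t, continuous (Psi N gamma phi)}.
Proof.
move=> Tt Psit; have /andP[g0 g1] := gamma01.
have Phit0 : Phi N phi t != 0.
  by apply/eqP => Pt0; move: Psit; rewrite /Psi Pt0 powR0 ?gt_eqF// mulr0 ltxx.
have cphit := within_time_continuous hphi.1 Tt.
have c1 : {for t, continuous (fun s => phi s `^ (2 * (1 - gamma)))}.
  apply: (@continuous_comp _ _ _ phi ((@powR R)^~ (2 * (1 - gamma)))) => //.
  by apply: continuous_powR_neq0; rewrite gt_eqF// phi_gt0//; exact: time_oo_co.
have c2 : {for t, continuous (fun s => Phi N phi s `^ gamma)}.
  apply: (@continuous_comp _ _ _ (Phi N phi) ((@powR R)^~ gamma)); first exact: Phi_continuous.
  exact: continuous_powR_neq0.
exact: (cvgM c1 c2).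
Qed.

Let G t := \int[leb]_(s in `[0, t]) Phi N phi s.

(** [Phi] and its extension can differ on [0, t] only at 0, a null set. *)
Lemma Phi_primitive (P : R -> R) t : {within time_co Sig, continuous P} ->
  (forall t, time_oo Sig t -> Phi N phi t = P t) -> (t%:E < Sig)%E ->
  G t = \int[leb]_(s in `[0, t]) P s.
Proof.
move=> cP HP tS.
have iP : leb.-integrable (`[0, t]%classic : set (measurableTypeR R)) (EFin \o P).
  apply: continuous_compact_integrable; first exact: segment_compact.
  by apply: continuous_subspaceW cP => s /= st; exact: itv_time_co tS st.
have iP' : leb.-integrable (`]0, t]%classic : set (measurableTypeR R)) (EFin \o P).
  by apply: integrableS iP => //; exact: subset_itv_oc_cc.
have E : {in `]0, t]%classic, P =1 Phi N phi}.
  move=> s; rewrite inE/= in_itv/= => /andP[s0 st]; rewrite HP//; split => //.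
  by apply: le_lt_trans tS; rewrite lee_fin.
rewrite /G -!Rintegral_itv_obnd_cbnd//; last first.
  by apply: eq_integrable iP' => //= s sI; rewrite /= E.
by apply: eq_Rintegral => s sI; rewrite E.
Qed.

Lemma is_derive_Phi_primitive t : time_oo Sig t -> is_derive t (1 : R) G (Phi N phi t).
Proof.
move=> Tt; have [P cP HP] := Phi_extension.
have [b tb bS] := ereal_real_between Tt.2.
have iP : leb.-integrable (`[0, b]%classic : set (measurableTypeR R)) (EFin \o P).
  apply: continuous_compact_integrable; first exact: segment_compact.
  by apply: continuous_subspaceW cP => s /= st; exact: itv_time_co bS st.
have [dG vG] := continuous_FTC1_closed tb iP Tt.1 (within_time_continuous cP Tt).
have dP := derive1_is_derive dG vG.
rewrite (HP _ Tt); apply: near_eq_is_derive dP.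
by apply: filterS (near_time_oo Tt) => s Ts; rewrite (Phi_primitive cP HP)//; exact: Ts.2.
Qed.

Lemma Phi_primitive_cvg0 : (0 < Sig)%E -> G t @[t --> 0^'+] --> (0 : R).
Proof.
move=> S0; have [P cP HP] := Phi_extension.
have [b b0 bS] := ereal_real_between S0.
have iP : leb.-integrable (`[0, b]%classic : set (measurableTypeR R)) (EFin \o P).
  apply: continuous_compact_integrable; first exact: segment_compact.
  by apply: continuous_subspaceW cP => s /= st; exact: itv_time_co bS st.
have H := cvg_at_right_filter (parameterized_integral_cvg_left b0 iP).
apply: cvg_trans H; apply: near_eq_cvg; near=> t.
rewrite (Phi_primitive cP HP)//; apply: lt_trans bS; rewrite lte_fin.
by near: t; exact: nbhs_right_lt.
Unshelve. all: by end_near. Qed.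

Lemma Phi_primitive_bounded b : 0 <= b -> (b%:E < Sig)%E ->
  exists2 M, 0 < M & forall t, t \in `[0, b] -> `|G t| <= M.
Proof.
move=> b0 bS; have [P cP HP] := Phi_extension.
have iP : leb.-integrable (`[0, b]%classic : set (measurableTypeR R)) (EFin \o P).
  apply: continuous_compact_integrable; first exact: segment_compact.
  by apply: continuous_subspaceW cP => s /= st; exact: itv_time_co bS st.
have cG : {within `[0, b], continuous (fun t => \int[leb]_(s in `[0, t]) P s)}.
  exact: parameterized_integral_continuous b0 iP.
have [M M0 HM] := compact_bounded_fun (@segment_compact R 0 b) cG.
exists M => // t tb; rewrite (Phi_primitive cP HP); first exact: HM.
exact: (itv_time_co (lexx 0) bS tb).2.
Qed.

End Coefficients.

(** * The maximum principle *)

Lemma within_continuous_comp {T T' U : topologicalType} (S : set T) (B : set T') (F : T -> U)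
    (c : T' -> T) : {within S, continuous F} -> continuous c ->
  (forall y, B y -> S (c y)) -> {within B, continuous (fun y => F (c y))}.
Proof.
move=> cF cc BS; apply/subspace_continuousP => y By A FA.
have H : nbhs (c y) (fun z => S z -> A (F z)) :=
  (subspace_continuousP _ _).1 cF (c y) (BS _ By) A FA.
have H' : nbhs y (fun w => B w -> A (F (c w))).
  by apply: (@filterS _ (nbhs y) _ _ _ _ (cc y _ H)) => w /= Fw /BS; exact: Fw.
exact: H'.
Qed.

Section Maximum.
Context {R : realType} {N : nat}.
Local Notation E := 'rV[R]_N.
Variables (Om : set E) (h : E -> R).
Hypotheses (oOm : open Om) (dh : defining_function Om h).
Implicit Types (x y : E) (v g : E -> R).

(** Each coordinate line through [x] carries a local maximum of [v - g]; the one-dimensional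
    second-derivative tests are summed. *)
Lemma laplacian_le_at_max v g x : C2_on Om v -> C2_on Om g -> Om x ->
  (forall y, Om y -> v y - g y <= v x - g x) -> laplacian v x <= laplacian g x.
Proof.
move=> Cv Cg Ox vmax; apply: ler_sum => i _; rewrite -subr_le0.
pose e : E := delta_mx 0 i.
have nO : \forall s \near (0 : R), Om (x + s *: e).
  by apply: near_line; exact: open_nbhs_nbhs (conj oOm Ox).
apply: (@second_derivative_at_max _ (fun s => v (x + s *: e) - g (x + s *: e))
  (fun s => partial i v (x + s *: e) - partial i g (x + s *: e))).
- apply: filterS nO => s Os.
  have [dv _ _ _] := Cv _ Os i; have [dg _ _ _] := Cg _ Os i.
  have dv' := (is_derive_line v x e s _).2 (derivableP dv).
  have dg' := (is_derive_line g x e s _).2 (derivableP dg).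
  exact: (is_deriveB dv' dg').
- have [_ dv _ _] := Cv _ Ox i; have [_ dg _ _] := Cg _ Ox i.
  have dv' := (is_derive_line0 (partial i v) x e _).2 (derivableP dv).
  have dg' := (is_derive_line0 (partial i g) x e _).2 (derivableP dg).
  exact: (is_deriveB dv' dg').
- by apply: filterS nO => s Os; rewrite scale0r addr0; exact: vmax.
Qed.

(* Along the inward direction - grad h, the derivative of v - h at x is
   |grad h(x)|^2 > 0. *)
Lemma boundary_not_max v (gr : E -> E) x : boundary Om x ->
  {within closure Om, continuous v} -> C2_on Om v ->
  {within closure Om, continuous gr} -> (forall y, Om y -> gr y = gradient v y) ->
  dot (gr x) (gradient h x) = 0 -> exists2 y, Om y & v x - h x < v y - h y.
Proof.
move=> bx cv Cv cgr grE gr0; have Ch := defining_C2 dh.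
pose d := - gradient h x.
have hx0 := defining_boundary dh bx.
have gh0 := defining_gradient dh bx.
have dhl s : is_derive s (1 : R) (fun s : R => h (x + s *: d)) (dot (gradient h (x + s *: d)) d).
  by apply/is_derive_line; exact: C1_gradient Ch.1.
have nO : \forall s \near (0 : R), 0 < s -> Om (x + s *: d).
  have dh0 := dhl 0; rewrite scale0r addr0 in dh0.
  have neg : dot (gradient h x) d < 0 by rewrite dotC dotNl oppr_lt0.
  apply: filterS (near_derive_lt dh0 neg) => s Hs s0.
  by apply/(defining_lt0 dh); move: (Hs s0); rewrite scale0r addr0 hx0.
(* Slope of [v - h] along [d], written with the extension [gr] so that it is defined and continuous
   up to the boundary point, where no derivative of [v] is at hand. *)
pose q y := \sum_(i <- enum 'I_N) (gr y 0 i - gradient h y 0 i) * d 0 i.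
have qE y : q y = dot (gr y) d - dot (gradient h y) d.
  by rewrite /q /dot big_enum -sumrB; apply: eq_bigr => i _; rewrite mulrBl.
have cq : {within closure Om, continuous q}.
  apply: within_continuous_sum => i; apply: within_continuous_mul; last first.
    by apply: continuous_subspaceT => y; exact: cst_continuous.
  move=> y; apply: (cvgB (f := fun z : subspace (closure Om) => gr z 0 i)
    (g := fun z : subspace (closure Om) => gradient h z 0 i)).
    apply: (@continuous_comp _ _ _ (gr : subspace _ -> E) (fun v : E => v 0 i)).
      exact: cgr.
    exact: coord_continuous.
  have cgh : {within closure Om, continuous (fun z => gradient h z 0 i)}.
    by apply: continuous_subspaceT; exact: continuous_gradient Ch.1.
  exact: cgh.
have qx : 0 < q x by rewrite qE /d dotC dotNl dotC gr0 oppr0 sub0r dotC dotNl opprK.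
have nq := near_line d (near_within_gt cq bx.1 qx).
have nn : \forall s \near (0 : R), (0 < s -> Om (x + s *: d)) /\
    (closure Om (x + s *: d) -> 0 < q (x + s *: d)).
  exact: filterI nO nq.
move/nbhs_ballP : nn => [e /= e0 He].
pose c := e / 2.
have c0 : 0 < c by rewrite divr_gt0.
have ce s : 0 < s -> s <= c -> Om (x + s *: d) /\ 0 < q (x + s *: d).
  move=> s0 sc; have /He[H1 H2] : ball 0 e s.
    by rewrite /ball/= sub0r normrN gtr0_norm// (le_lt_trans sc)// /c ltr_pdivrMr// ltr_pMr// ltr1n.
  by split; [exact: H1|apply/H2/subset_closure/H1].
have [|||xi] := @MVT _ (fun s => v (x + s *: d) - h (x + s *: d)) (fun s => q (x + s *: d)) 0 c.
- exact: c0.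
- move=> s; rewrite in_itv/= => /andP[s0 /ltW sc]; have [Os _] := ce s s0 sc.
  have dv : is_derive (x + s *: d) d v (dot (gradient v (x + s *: d)) d).
    apply: is_derive_partial => [|i]; last by have [] := Cv _ Os i.
    by apply: filterS (open_nbhs_nbhs (conj oOm Os)) => y Oy i; have [] := Cv y Oy i.
  have dvs := (is_derive_line v x d s _).2 dv.
  by rewrite qE grE//; exact: is_deriveB dvs (dhl s).
- apply: continuous_funB.
    apply: (within_continuous_comp (c := fun s : R => x + s *: d) cv); first exact: continuous_line.
    move=> s /=; rewrite in_itv/= => /andP[]; rewrite le_eqVlt => /predU1P[<- _|s0 sc].
      by rewrite scale0r addr0; exact: bx.1.
    by apply/subset_closure/(proj1 (ce s s0 sc)).
  apply: continuous_subspaceT => s.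
  exact: is_derive1_continuous (dhl s).
rewrite in_itv/= => /andP[xi0 /ltW xic]; rewrite scale0r addr0 => kc.
exists (x + c *: d); first exact: (ce c c0 (lexx _)).1.
by rewrite -subr_gt0 kc subr0 mulr_gt0//; exact: (ce xi xi0 xic).2.
Qed.

End Maximum.

Lemma left_increment_derive_ge {R : realType} (f : R -> R) (t d L : R) :
  is_derive t (1 : R) f d -> (\forall s \near (0 : R), 0 < s -> f (t - s) + L * s <= f t) ->
  L <= d.
Proof.
move=> /is_deriveP H /nbhs_ballP[e1 /= e10 He1]; rewrite leNgt; apply/negP => dL.
have e0 : 0 < (L - d) / 2 by lra.
have /nbhs_ballP[e2 /= e20 He2] := H _ e0.
have m0 : 0 < Num.min e1 e2 by rewrite lt_min e10.
pose s := Num.min e1 e2 / 2.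
have s0 : 0 < s by rewrite divr_gt0.
have /andP[s1 s2] : (s < e1) && (s < e2).
  by rewrite -lt_min /s ltr_pdivrMr// ltr_pMr ?ltr1n.
have /He1 /(_ s0) L1 : ball 0 e1 s by rewrite /ball/= sub0r normrN gtr0_norm.
have /He2 : ball 0 e2 (- s) by rewrite /ball/= sub0r opprK gtr0_norm.
rewrite [`|- s|]normrN (gtr0_norm s0) ler_norml => /andP[L2 _].
by move: L1 L2 s0 dL; clear; nra.
Qed.

Lemma compact_superlevel {X : topologicalType} {R : realType} (Q : set X) (w : X -> R) :
  hausdorff_space X -> compact Q -> {within Q, continuous w} ->
  compact (Q `&` [set z | 0 <= w z]).
Proof.
move=> hX cQ cw.
have clS : closed (Q `&` [set z | 0 <= w z]).
  move=> y cly; have Qy : Q y.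
    by apply: (compact_closed hX cQ); apply: closure_subset cly => ? [].
  split=> //=; rewrite leNgt; apply/negP => wy.
  have [v [[Qv wv] /(_ Qv)]] := cly _ (near_within_lt cw Qy wy).
  by rewrite ltNge wv.
by apply: subclosed_compact clS cQ _ => y [].
Qed.

(** * Short-time bounds by comparison *)

Section Continuation.
Context {R : realType} {N : nat}.
Local Notation E := 'rV[R]_N.
Variables (Om : set E) (p r gamma : R) (phi : R -> R) (u0 : E -> R) (T : \bar R).
Variables (u : E -> R -> R) (h : E -> R).
Hypotheses (oOm : open Om) (bOm : bounded_set Om) (dh : defining_function Om h).
Hypotheses (p0 : 0 < p) (r0 : 0 < r) (gamma0 : 0 < gamma) (vol0 : 0 < volume Om).
Hypothesis (sol : classical_solution Om p r gamma phi u0 T u).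
Variables (A B m : R).
Hypothesis PhiA : forall t, time_oo T t -> `|Phi N phi t| <= A.
Hypothesis PsiB : forall t, time_oo T t -> `|Psi N gamma phi t| <= B.
Hypothesis m0 : 0 < m.
Hypothesis meanm : forall t, time_oo T t -> m <= (volume Om)^-1 * power_integral Om u 1 t.
Local Notation mu := (lebesgue_tuple N).
Local Notation D := (pt @^-1` Om).
Local Notation pow := (power_integral Om u).
Local Notation V := (volume Om).
Implicit Types (t K M : R) (x y : E).

(** For [r >= 1] Jensen's inequality gives [c = m^r]. For [r < 1] the bound [u <= M] yields
    [u <= M^(1 - r) u^r], hence [c = m / M^(1 - r)]. *)
Lemma average_power_lower M : 0 < M -> exists2 c, 0 < c &
  forall t, time_oo T t -> (forall x, Om x -> u x t <= M) ->
    c <= average Om (fun y => u y t `^ r).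
Proof.
move=> M0; have mD := domain_measurable oOm.
have tco t : time_oo T t -> time_co T t by case=> /ltW.
have [r1|r1] := leP 1 r.
  exists (m `^ r) => [|t Tt _]; first exact: powR_gt0.
  have Tc := tco _ Tt; have tn : `|t| = t by rewrite ger0_norm// (proj1 Tc).
  rewrite averageE ?(proj1 Tc)//.
  apply: (@le_trans _ _ ((V^-1 * pow 1 t) `^ r)).
    apply: ge0_ler_powR; rewrite ?nnegrE ?(ltW r0) ?(ltW m0)//; last exact: meanm.
    exact: le_trans (ltW m0) (meanm Tt).
  have int_a a : 0 <= a -> mu.-integrable D (EFin \o (fun z => u (pt z) `|t| `^ a)).
    by move=> a0; rewrite tn; exact: (power_integrable oOm bOm sol).
  have := @jensen_powR _ _ _ mu D (fun z => u (pt z) `|t| `^ 1) r mD vol0 r1.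
  rewrite (_ : (fun z => (u (pt z) `|t| `^ 1) `^ r) = fun z => u (pt z) `|t| `^ r); last first.
    by apply/funext => z; rewrite -powRrM mul1r.
  apply; [|exact: int_a|exact: int_a (ltW r0)].
  by move=> z Dz; rewrite tn powR_gt0// (solution_pos sol).
exists (m / M `^ (1 - r)) => [|t Tt uM]; first by rewrite divr_gt0// powR_gt0.
have Tc := tco _ Tt; have tn : `|t| = t by rewrite ger0_norm// (proj1 Tc).
rewrite averageE ?(proj1 Tc)// ler_pdivrMr ?powR_gt0//.
apply: le_trans (meanm Tt) _; rewrite -mulrA ler_wpM2l ?invr_ge0 ?(ltW vol0)//.
have int_a a : 0 <= a -> mu.-integrable D (EFin \o (fun z => u (pt z) `|t| `^ a)).
  by move=> a0; rewrite tn; exact: (power_integrable oOm bOm sol).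
rewrite mulrC /power_integral -RintegralZl//; last exact: int_a (ltW r0).
apply: le_Rintegral => //; first exact: int_a.
  by apply: (integrableZl mD _ (int_a _ (ltW r0))).
move=> z Dz; rewrite tn; have uz := solution_pos sol Dz Tc.
rewrite powRr1 ?(ltW uz)// -{1}(powRr1 (ltW uz)) -{1}(subrK r 1).
rewrite powRD ?(gt_eqF uz) ?implybT// ler_wpM2r ?powR_ge0//.
by apply: ge0_ler_powR; rewrite ?nnegrE ?subr_ge0 ?(ltW r1) ?(ltW uz) ?(ltW M0)//; exact: uM.
Qed.

(* Comparison with the strict supersolution K + 1 + H + h + L (t - t0), where
   H bounds |h| and L dominates the right-hand side of the equation below the
   value M: at a first contact time the contact point is neither interior (by the
   equation) nor on the boundary (grad h points outward there). *)
Lemma short_time_bound K : 0 < K -> exists2 L : R, 0 < L & exists M : R, forall t0 t1,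
  time_oo T t0 -> (forall x, Om x -> u x t0 <= K) ->
  t0 <= t1 -> (t1%:E < T)%E -> L * (t1 - t0) <= 1 -> forall x, Om x -> u x t1 <= M.
Proof.
move=> K0; have [H H0 HH] : exists2 H : R, 0 < H & forall x, closure Om x -> `|h x| <= H.
  apply: compact_bounded_fun; first exact: closure_compact.
  by apply: continuous_subspaceT; exact: (defining_C2 dh).1.1.
have [C C0 HC] := laplacian_bounded bOm dh.
(* An upper bound for the barrier [K + 1 + H + h + L (t - t0)] while [L (t - t0) <= 1]. *)
pose M := K + 2 * H + 2.
have M0 : 0 < M by rewrite /M; lra.
have [c c0 Hc] := average_power_lower M0.
(* The three terms bound the Laplacian of [h], the damping and the source below the value [M]; the
   [+ 1] makes the barrier strict. *)
pose L := C + `|A| * M + `|B| * M `^ p / c `^ gamma + 1.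
have L0 : 0 < L.
  have LA : 0 <= `|A| * M by rewrite mulr_ge0// ltW.
  have LB : 0 <= `|B| * M `^ p / c `^ gamma by rewrite divr_ge0 ?mulr_ge0 ?powR_ge0.
  by rewrite /L; lra.
exists L => //; exists M => t0 t1 Tt0 uK t01 t1T Lt x Ox.
have I s : s \in `[t0, t1] -> time_oo T s by exact: itv_time_oo Tt0.1 t1T.
have Ic s : s \in `[t0, t1] -> time_co T s by move=> /I[/ltW].
pose Q : set (E * R) := closure Om `*` `[t0, t1].
pose w (z : E * R) := u z.1 z.2 - h z.1 - L * (z.2 - t0) - (K + H + 1).
have cw : {within Q, continuous w}.
  have cst_cont (k : R) : {within Q, continuous (fun=> k)}.
    by apply: continuous_subspaceT => y; exact: cst_continuous.
  have cu : {within Q, continuous (fun z => u z.1 z.2)}.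
    by apply: continuous_subspaceW (solution_continuous sol) => -[y s] [cly /Ic].
  have ch : {within Q, continuous (fun z => h z.1)}.
    apply: continuous_subspaceT => y; apply: (@continuous_comp _ _ _ fst h).
      exact: cvg_fst.
    exact: (defining_C2 dh).1.1.
  have ct : {within Q, continuous (fun z => z.2)}.
    by apply: continuous_subspaceT => y; exact: cvg_snd.
  exact: (continuous_funB (continuous_funB (continuous_funB cu ch)
    (continuous_funM (cst_cont L) (continuous_funB ct (cst_cont t0)))) (cst_cont _)).
(* [u <= K] is assumed on [Om] only and passes to the closure by continuity. *)
have wt0 y : closure Om y -> w (y, t0) < 0.
  move=> cly; have uy : u y t0 <= K.
    rewrite leNgt; apply/negP => uy.
    have Tc : time_co T t0 by case: Tt0 => /ltW.
    have /(@continuous_pairl _ _ t0 y) nu := near_within_gt (solution_continuous sol)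
      (conj cly Tc : (closure Om `*` time_co T) (y, t0)) uy.
    have [v [Ov uv]] := cly _ nu.
    by have := uK v Ov; rewrite leNgt uv//; split => //; exact: subset_closure.
  by rewrite /w /= subrr mulr0 subr0; have := HH y cly; rewrite ler_norml => /andP[+ _]; lra.
suff wneg z : Q z -> w z < 0.
  have /wneg : Q (x, t1) by split; [exact: subset_closure|rewrite /= bound_itvE].
  have := HH x (subset_closure Ox); rewrite ler_norml => /andP[_ hH].
  by rewrite /w /= /M; lra.
move=> Qz; rewrite ltNge; apply/negP => wz.
pose S := Q `&` [set z | 0 <= w z].
have cS : compact S.
  by apply: compact_superlevel; [exact: norm_hausdorff|exact: cylinder_compact|exact: cw].
(* A first contact: a point of smallest time in the compact set where [w >= 0]. *)
have [||[xs ts] /=] := @compact_EVT_min _ _ (fun z : E * R => z.2) S _ cS.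
- by exists z.
- by apply: continuous_subspaceT => y; exact: cvg_snd.
rewrite inE => -[[/= clxs tsI] ws] tsmin.
have before y s : closure Om y -> t0 <= s -> s < ts -> w (y, s) < 0.
  move=> cly s0 sts; rewrite ltNge; apply/negP => wys.
  have sI : s \in `[t0, t1].
    by move: tsI; rewrite !in_itv/= s0 => /andP[_ /(le_trans (ltW sts))].
  have /tsmin /= : (y, s) \in S by rewrite inE.
  by rewrite leNgt sts.
have t0ts : t0 < ts.
  rewrite lt_neqAle; move: (tsI); rewrite /= in_itv/= => /andP[-> _]; rewrite andbT.
  by apply: contraTneq ws => <-; rewrite -ltNge wt0.
(* A positive value at time [ts] would persist slightly earlier, before the first contact. *)
have wmax y : closure Om y -> w (y, ts) <= 0.
  move=> cly; rewrite leNgt; apply/negP => wy.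
  have /(@continuous_pairr _ _ y ts) nw := near_within_gt cw (conj cly tsI : Q (y, ts)) wy.
  have nwl : \forall s \near ts^'-, Q (y, s) -> 0 < w (y, s).
    by apply: (@filterS _ (nbhs ts) _ _ _ _ nw) => s Hs _; exact: Hs.
  have nw' : \forall s \near ts^'-, [/\ t0 < s, s < ts & Q (y, s) -> 0 < w (y, s)].
    near=> s; split; first by near: s; exact: nbhs_left_gt.
      by near: s; exact: nbhs_left_lt.
    by near: s; exact: nwl.
  have [s [s0 s1 ws']] := filter_ex nw'.
  have sI : s \in `[t0, t1].
    by move: tsI; rewrite /= !in_itv/= (ltW s0) => /andP[_ /(le_trans (ltW s1))].
  have := before y s cly (ltW s0) s1.
  by rewrite ltNge ltW// ws'.
have Tts := I _ tsI.
have uM y : Om y -> u y ts <= M.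
  move=> /subset_closure cly; have := wmax y cly; rewrite /w /= /M.
  have : L * (ts - t0) <= 1.
    apply: le_trans Lt; rewrite ler_pM2l// lerB//.
    by move: tsI; rewrite /= in_itv/= => /andP[].
  by have := HH y cly; rewrite ler_norml => /andP[_]; lra.
have wmax' y : closure Om y -> u y ts - h y <= u xs ts - h xs.
  by move=> /wmax; move: ws; rewrite /w /=; lra.
have [Oxs|nOxs] := pselect (Om xs); last first.
  have [G cG [GE Gnu]] := solution_neumann sol.
  have bxs : boundary Om xs by [].
  have [|||||y Oy] := @boundary_not_max _ _ Om h oOm dh (u ^~ ts) (fun y => G (y, ts)) xs bxs.
  - apply: (within_continuous_comp (c := fun y => (y, ts)) (solution_continuous sol)).
      exact: continuous_pairl.
    by move=> y cly; split=> //=; exact: Ic.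
  - exact: (solution_C2_on oOm sol).
  - by apply: (within_continuous_comp (c := fun y => (y, ts)) cG) => //; exact: continuous_pairl.
  - by move=> y Oy; exact: GE.
  - by apply: (defining_normal dh) => // nu bnu; exact: Gnu.
  - by rewrite ltNge wmax'//; exact: subset_closure.
have lap : laplacian (u ^~ ts) xs <= C.
  apply: (@le_trans _ _ (laplacian h xs)); last exact: le_trans (ler_norm _) (HC _ Oxs).
  apply: (laplacian_le_at_max oOm) => //.
  - exact: (solution_C2_on oOm sol).
  - exact: C2_C2_on (defining_C2 dh).
  - by move=> y Oy; apply: wmax'; exact: subset_closure.
(* At [xs] the function [w] is negative before [ts] and nonnegative at [ts], so [u] rises at least
   as fast as the barrier. *)
have time : L <= derive1 (u xs) ts.
  have du : is_derive ts (1 : R) (u xs) (derive1 (u xs) ts).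
    by apply: derive1_is_derive => //; exact: solution_derivable_time sol _ _ Oxs Tts.
  apply: (left_increment_derive_ge du).
  have nt : \forall s \near (0 : R), s < ts - t0.
    by apply: lt_nbhsl; rewrite subr_gt0.
  apply: filterS nt => s st s0; have s1 : t0 <= ts - s by lra.
  have s2 : ts - s < ts by lra.
  by have := before xs (ts - s) clxs s1 s2; move: ws; rewrite /w /=; lra.
have u_gt0 := solution_pos sol Oxs (Ic _ tsI).
have uxM := uM _ Oxs.
have term1 : - Phi N phi ts * u xs ts <= `|A| * M.
  apply: (@le_trans _ _ (`|Phi N phi ts| * u xs ts)).
    by rewrite ler_wpM2r// ?(ltW u_gt0)// -normrN ler_norm.
  by apply: ler_pM => //; [exact: ltW|exact: le_trans (PhiA Tts) (ler_norm _)].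
have avg := Hc ts Tts uM.
have term2 : Psi N gamma phi ts * u xs ts `^ p / average Om (fun y => u y ts `^ r) `^ gamma
    <= `|B| * M `^ p / c `^ gamma.
  apply: ler_pM.
  - by rewrite mulr_ge0 ?powR_ge0// mulr_ge0 ?powR_ge0.
  - by rewrite invr_ge0 powR_ge0.
  - apply: ler_pM; rewrite ?mulr_ge0 ?powR_ge0//.
      exact: le_trans (ler_norm _) (le_trans (PsiB Tts) (ler_norm _)).
    by apply: ge0_ler_powR; rewrite ?nnegrE ?(ltW p0) ?(ltW u_gt0) ?(ltW M0).
  - rewrite lef_pV2 ?posrE ?powR_gt0//; last exact: lt_le_trans avg.
    by apply: ge0_ler_powR; rewrite ?nnegrE ?(ltW gamma0) ?(ltW c0)// (le_trans (ltW c0)).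
have := solution_equation sol Oxs Tts.
move: time lap term1 term2; rewrite mulNr /L.
have sum_lt (k a b l d a' b' : R) : k + a + b + 1 <= d -> l <= k -> - a' <= a -> b' <= b ->
    d = l - a' + b' -> False by lra.
exact: sum_lt.
Unshelve. all: by end_near. Qed.
End Continuation.

(** * Blow-up *)

(** The exponent [1 / (1 - omega)] is negative, so raising to it reverses the comparison of
    [U^(1 - omega)] with [(omega - 1) I]. *)
Lemma blowup_threshold {R : realType} (omega I U : R) : 1 < omega -> 0 <= I -> 0 < U ->
  0 < (omega - 1) `^ (1 / (1 - omega)) * I `^ (1 / (1 - omega)) < U ->
  U `^ (1 - omega) / (omega - 1) < I.
Proof.
move=> w1 I0 U0; have w0 : 0 < omega - 1 by rewrite subr_gt0.
have E : 1 / (1 - omega) = - (omega - 1)^-1 by field; rewrite !subr_eq0 (gt_eqF w1) (lt_eqF w1).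
rewrite -powRM ?(ltW w0)// E => /andP[X0 XU].
(* [powR] sends 0 to 0 for every nonzero exponent, even a negative one, so positivity of the
   threshold excludes [I = 0]. *)
have X : 0 < (omega - 1) * I.
  rewrite lt_neqAle mulr_ge0 ?(ltW w0)// andbT eq_sym; apply: contraTneq X0 => ->.
  by rewrite powR0 ?ltxx// oppr_eq0 invr_eq0 gt_eqF.
rewrite ltr_pdivrMr// mulrC ltNge; apply/negP => XU'.
move: XU; rewrite ltNge => /negP; apply.
have -> : U = (U `^ (1 - omega)) `^ (- (omega - 1)^-1).
  rewrite -powRrM (_ : _ * _ = 1) ?powRr1 ?(ltW U0)//.
  by field; rewrite gt_eqF.
rewrite !powRN lef_pV2 ?posrE ?powR_gt0//.
by apply: ge0_ler_powR; rewrite ?nnegrE ?invr_ge0 ?powR_ge0 ?(ltW w0) ?(ltW X).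
Qed.

(** * The mean as a solution of the differential inequality *)

Section MeanInequality.
Context {R : realType} {N : nat}.
Local Notation E := 'rV[R]_N.
Variables (Om : set E) (p r gamma : R) (phi : R -> R) (u0 : E -> R) (Sig T : \bar R).
Variables (u : E -> R -> R) (h : E -> R).
Hypotheses (oOm : open Om) (bOm : bounded_set Om) (dh : defining_function Om h).
Hypotheses (p1 : 1 < p) (r0 : 0 < r) (rp : r <= p) (gamma01 : 0 < gamma < 1).
Hypotheses (omega1 : 1 < p - r * gamma) (vol0 : 0 < volume Om).
Hypothesis (sol : classical_solution Om p r gamma phi u0 T u).
Hypotheses (T0 : (0 < T)%E) (TSig : (T <= Sig)%E) (hphi : C1_co Sig phi).
Hypothesis phi_gt0 : forall t, time_co Sig t -> 0 < phi t.
Hypothesis Psi_gt0 : forall t, time_oo Sig t -> 0 < Psi N gamma phi t.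
Local Notation leb := (@lebesgue_measure R).
Local Notation mu := (lebesgue_tuple N).
Local Notation D := (pt @^-1` Om).
Local Notation pow := (power_integral Om u).
Local Notation V := (volume Om).

Let U t := V^-1 * pow 1 t.
Let S t := V^-1 * pow p t / (V^-1 * pow r t) `^ gamma.
Let G t := \int[leb]_(s in `[0, t]) Phi N phi s.

Let p0 : 0 < p. Proof. exact: lt_trans p1. Qed.
Let gamma0 : 0 < gamma. Proof. by case/andP : gamma01. Qed.

Let TS t : time_oo T t -> time_oo Sig t.
Proof. by move=> [t0 tT]; split => //; exact: lt_le_trans TSig. Qed.

Let cPhi t : time_oo T t -> {for t, continuous (Phi N phi)}.
Proof. by move=> /TS Tt; exact: (Phi_continuous hphi phi_gt0 Tt). Qed.

Let cPsi t : time_oo T t -> {for t, continuous (Psi N gamma phi)}.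
Proof. by move=> /TS Tt; exact: (Psi_continuous gamma01 hphi phi_gt0 Tt (Psi_gt0 Tt)). Qed.

Let dU t : time_oo T t ->
  is_derive t (1 : R) U (- Phi N phi t * U t + Psi N gamma phi t * S t).
Proof.
move=> Tt; have H := mean_derive oOm bOm dh p0 r0 vol0 sol cPhi cPsi Tt.
have H' := is_deriveZ V^-1 H.
apply: is_derive_eq H' _; rewrite /mean_rhs /U /S /GRing.scale/=; ring.
Qed.

Let U_pos t : time_co T t -> 0 < U t.
Proof.
move=> Tt; rewrite mulr_gt0 ?invr_gt0//.
by apply: (pow_gt0 oOm bOm vol0 sol) => //; exact: ler01.
Qed.

Let U_gt0 t : time_oo T t -> 0 < U t.
Proof. by move=> [/ltW ? ?]; exact: U_pos. Qed.

Let U_le t : time_oo T t -> U t `^ (p - r * gamma) <= S t.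
Proof.
move=> [/ltW t0 tT].
exact: (source_lower oOm bOm p1 r0 rp gamma0 omega1 vol0 sol (conj t0 tT)).
Qed.

Let cS t : time_oo T t -> {for t, continuous S}.
Proof.
move=> Tt; have Tc : time_co T t by case: Tt => /ltW.
have c1 : {for t, continuous (fun t => V^-1 * pow p t)}.
  exact: cvgMr (pow_continuous oOm bOm sol (ltW p0) Tt).
have c2 : {for t, continuous (fun t => V^-1 * pow r t)}.
  exact: cvgMr (pow_continuous oOm bOm sol (ltW r0) Tt).
have pr0 : 0 < V^-1 * pow r t.
  by rewrite mulr_gt0 ?invr_gt0//; apply: (pow_gt0 oOm bOm vol0 sol) => //; exact: ltW.
have c3 : {for t, continuous (fun t => (V^-1 * pow r t) `^ gamma)}.
  apply: (@continuous_comp _ _ _ (fun t => V^-1 * pow r t) ((@powR R)^~ gamma)) => //.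
  by apply: continuous_powR_neq0; rewrite gt_eqF.
apply: (cvgM c1 (cvgV _ c3)).
by rewrite gt_eqF// powR_gt0.
Qed.

Let U_cvg0 : U t @[t --> 0^'+] --> U 0.
Proof.
apply: cvg_at_right_filter; apply: cvgMr.
by apply: (power_integral_continuous oOm bOm sol ler01); rewrite normr0.
Qed.

Lemma mean_initial : U 0 = average Om u0.
Proof.
rewrite /U /average /power_integral; congr (_ * _).
apply: eq_Rintegral => z; rewrite inE => Dz; rewrite normr0 powRr1.
  exact: (solution_initial sol (subset_closure Dz)).
by apply: ltW; apply: (solution_pos sol Dz).
Qed.

Let G_cvg0 : G t @[t --> 0^'+] --> (0 : R).
Proof. exact: (@Phi_primitive_cvg0 _ N _ _ hphi phi_gt0 (lt_le_trans T0 TSig)). Qed.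

Let dG t : time_oo T t -> is_derive t (1 : R) G (Phi N phi t).
Proof. by move=> /TS Tt; exact: (is_derive_Phi_primitive N hphi phi_gt0 Tt). Qed.

Let U00 : 0 < U 0. Proof. by apply: U_pos. Qed.

Let Ps_gt0 t : time_oo T t -> 0 < Psi N gamma phi t.
Proof. by move=> /TS; exact: Psi_gt0. Qed.

(** Where [G] is bounded this keeps the mean away from 0, and with it the nonlocal denominator in
    the comparison argument. *)
Lemma mean_ge t : time_oo T t -> average Om u0 <= expR (G t) * (V^-1 * pow 1 t).
Proof.
rewrite -mean_initial.
exact: (supersolution_ge (Ps := Psi N gamma phi) dU dG U_le Ps_gt0 U_cvg0 G_cvg0).
Qed.

Lemma blowup_integral_le : (blowup_integral N gamma (p - r * gamma) phi T <=
  (average Om u0 `^ (1 - (p - r * gamma)) / (p - r * gamma - 1))%:E)%E.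
Proof.
rewrite -mean_initial.
exact: (supersolution_integral_le omega1 dU dG U_gt0 U_le Ps_gt0 cS cPsi U_cvg0 U00 G_cvg0).
Qed.

End MeanInequality.

Unset Implicit Arguments.

Theorem theorem2p1 (R : realType) (N : nat) (hN : (1 <= N <= 3)%N)
  (Om : set 'rV[R]_N) (hOm : bounded_smooth_domain Om)
  (Sig : \bar R) (hSig : (0 < Sig)%E)
  (p q r s gamma omega : R)
  (hp : 1 < p) (hq : 0 < q) (hr : 0 < r) (hs : -1 < s)
  (hgamma : gamma = q / (s + 1)) (homega : omega = p - r * gamma)
  (hpr : r <= p) (hgamma01 : 0 < gamma < 1) (homega1 : 1 < omega)
  (phi : R -> R) (hphi : C1_co Sig phi)
  (hphi_pos : forall t, time_co Sig t -> 0 < phi t) (hphi0 : phi 0 = 1)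
  (hPsi : forall t, time_oo Sig t -> 0 < Psi N gamma phi t)
  (hI : (blowup_integral N gamma omega phi Sig < +oo)%E)
  (u0 : 'rV[R]_N -> R)
  (hu0_cont : {within closure Om, continuous u0})
  (hu0_pos : forall x, closure Om x -> 0 < u0 x)
  (hu0 : 0 < (omega - 1) `^ (1 / (1 - omega))
               * fine (blowup_integral N gamma omega phi Sig) `^ (1 / (1 - omega))
           < average Om u0)
  (T : \bar R) (hT : (0 < T <= Sig)%E)
  (u : 'rV[R]_N -> R -> R)
  (hu : classical_solution Om p r gamma phi u0 T u)
  (hmax : continued_while_bounded Om Sig T u) :
  exists Sb : R, [/\ T = Sb%:E, (Sb%:E < Sig)%E & blows_up_at Om u Sb].
Proof.
have [oOm _ _ bOm _] := hOm; have [h dh] := exists_defining_function hOm.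
have /andP[T0 TSig] := hT; have /andP[gamma0 _] := hgamma01.
have p0 : 0 < p by rewrite (lt_trans _ hp).
have avg0 : 0 < average Om u0 by case/andP : hu0 => /lt_trans; apply.
(* With [0^-1 = 0], a zero volume would give a zero average, against the lower bound on the initial
   mean. *)
have vol0 : 0 < volume Om.
  rewrite lt_neqAle fine_ge0 ?measure_ge0// andbT eq_sym.
  by apply: contraTneq avg0 => V0; rewrite /average V0 invr0 mul0r ltxx.
rewrite homega in homega1 hI hu0.
have I0 : (0 <= blowup_integral N gamma (p - r * gamma) phi Sig)%E.
  by apply: integral_ge0 => t Tt; rewrite lee_fin mulr_ge0 ?expR_ge0// ltW// hPsi.
have Tneq : T <> Sig.
  move=> TE; have := blowup_integral_le oOm bOm dh hp hr hpr hgamma01 homega1 vol0 hu T0 TSig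
    hphi hphi_pos hPsi.
  rewrite TE -[X in (X <= _)%E]fineK ?ge0_fin_numE// lee_fin leNgt => /negP; apply.
  by apply: blowup_threshold => //; exact: fine_ge0.
have TltSig : (T < Sig)%E by rewrite lt_neqAle TSig andbT; exact/eqP.
have [Sb TE] : exists Sb, T = Sb%:E.
  exists (fine T); rewrite fineK// ge0_fin_numE ?(ltW T0)//.
  exact: lt_le_trans TltSig (leey _).
exists Sb; rewrite -TE; split => //.
have Sb0 : 0 < Sb by rewrite -lte_fin -TE.
have SbSig : (Sb%:E < Sig)%E by rewrite -TE.
have Tco t : time_oo T t -> t \in `]0, Sb].
  by rewrite TE => -[t0]; rewrite lte_fin in_itv/= t0 => /ltW.
have [A _ HA] := Phi_bounded N hphi hphi_pos SbSig.
have [B _ HB] := Psi_bounded N hgamma01 hphi hphi_pos SbSig.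
have [MG MG0 HMG] := Phi_primitive_bounded N hphi hphi_pos (ltW Sb0) SbSig.
(* From [mean_ge], as [G <= MG] on [0, Sb]. *)
pose m := average Om u0 / expR MG.
have m0 : 0 < m by rewrite divr_gt0// expR_gt0.
have meanm t : time_oo T t -> m <= (volume Om)^-1 * power_integral Om u 1 t.
  move=> Tt; rewrite ler_pdivrMr ?expR_gt0//.
  apply: le_trans (mean_ge oOm bOm dh hp hr hpr hgamma01 homega1 vol0 hu T0 TSig
    hphi hphi_pos hPsi Tt) _.
  have pow0 : 0 < power_integral Om u 1 t.
    by apply: (pow_gt0 oOm bOm vol0 hu ler01); case: Tt => /ltW.
  rewrite mulrC ler_wpM2l ?mulr_ge0 ?invr_ge0 ?(ltW vol0) ?(ltW pow0)// ler_expR.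
  apply: le_trans (ler_norm _) (HMG _ _).
  by have := Tco _ Tt; rewrite !in_itv/= => /andP[/ltW-> ->].
have PhiA t : time_oo T t -> `|Phi N phi t| <= A by move=> /Tco/HA.
have PsiB t : time_oo T t -> `|Psi N gamma phi t| <= B by move=> /Tco/HB.
apply/cvgeyPge => K.
(* The level [K] may be nonpositive, while [short_time_bound] asks for a positive one. *)
have K1 : 0 < Num.max K 1 by rewrite lt_max ltr01 orbT.
have [L L0 [M HM]] := short_time_bound oOm bOm dh p0 hr gamma0 vol0 hu PhiA PsiB m0 meanm K1.
(* Either the norm stays at least [K] throughout the last stretch of length [1 / L] before [Sb], or
   it is below [K] at some [t0] there, and then [short_time_bound] reaches all the way to [Sb]. *)
have [[t0 [t0_gt0 t0S t0L t0K]]|noK] := pselect (exists t0,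
    [/\ 0 < t0, t0 < Sb, Sb - L^-1 < t0 & (sup_norm Om (u ^~ t0) < K%:E)%E]).
  have t0T : (t0%:E < T)%E by rewrite TE lte_fin.
  have ut0 x : Om x -> u x t0 <= Num.max K 1.
    move=> Ox; rewrite le_max -lee_fin (_ : (_ <= K%:E)%E)//.
    apply: le_trans (ltW t0K); apply: (@le_trans _ _ `|u x t0|%:E).
      by rewrite lee_fin ler_norm.
    by apply: ereal_sup_ubound; exists x.
  have [M1 M10 HM1] := solution_bounded bOm hu t0T.
  (* [M1] bounds [u] up to [t0] and [M] from [t0] on; boundedness up to [T] would force
     [T = Sig]. *)
  case: Tneq; apply: hmax; exists (Num.max M1 M) => x t Ox Tt; rewrite le_max.
  have [tt0|/ltW t0t] := leP t t0.
    by rewrite HM1//; [exact: subset_closure|rewrite in_itv/= tt0 (proj1 Tt)].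
  apply/orP; right; rewrite gtr0_norm; last exact: (solution_pos hu).
  apply: (HM t0) => //; first exact: Tt.2.
  have := Tt.2; rewrite TE lte_fin => tS.
  by rewrite mulrC -ler_pdivlMr// mul1r; lra.
near=> t; rewrite leNgt; apply/negP => tK; apply: noK; exists t; split; last exact: tK.
- by near: t; exact: nbhs_left_gt.
- by near: t; exact: nbhs_left_lt.
- by near: t; apply: nbhs_left_gt; rewrite gtrBl invr_gt0.
Unshelve. all: by end_near. Qed.
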